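(* Let $r\in\mathbb N$ and let $L:\mathbb R^+\to[0,\infty)$ be any loss function satisfying all of the following. (1) For any $x_1,x_2\in\mathbb R^+$ with $x_2>x_1$, $L$ is of bounded variation on $[x_1,x_2]$. (2) $L$ has a finite number of discontinuities in $\mathbb R^+$. (3) There exists a real $K<r$ such that $L(x)$ is $\Theta(x^K)$ as $x\to0$, and there exists a real $K'<r$ such that $L(x)$ is $\Theta(x^{K'})$ as $x\to\infty$. (4) There exists $\xi\in\mathbb R^+$ such that $L$ is non-increasing on $(0,\xi)$ and $\int_{\xi}^\infty \frac{L(\xi)-L(x)}{x^{r+1}}\,dx>0$. (5) There exists $\xi'\in\mathbb R^+$ such that $L$ is non-decreasing on $(\xi',\infty)$ and one of these conditions holds: (a) $L(\xi'-)<L(\xi'+)$; or (b) there is $t\in\mathbb N$ such that $L$ is of class $C^t$ on an interval containing $\xi'$, $\frac{d^iL}{dx^i}(\xi')=0$ for $i=1,\dots,t-1$, and $(-1)^{t-1}\frac{d^tL}{dx^t}(\xi')>0$. Then $\limsup_{p\to0}\eta(p)$ has a minimum over the general class of all (possibly randomized) estimators, and this minimum equals $\eta^*$, the minimum of $\bar\eta(\Omega)$ over $\Omega\in\mathbb R^+$.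
   Context: $\mathbb R^+=(0,\infty)$, $\mathbb N=\{1,2,\dots\}$. $h(a-)$, $h(a+)$ denote one-sided limits. $h_1(x)$ is $\Theta(h_2(x))$ as $x\to0$ (resp. $x\to\infty$) if there are $a,m,M\in\mathbb R^+$ with $m h_2(x)\le h_1(x)\le M h_2(x)$ for all $x\le a$ (resp. $x\ge a$). Inverse binomial sampling: for $p\in(0,1)$, $N$ is the number of i.i.d. Bernoulli($p$) trials needed to obtain $r$ successes, so $f(n)=\Pr[N=n]=\binom{n-1}{r-1}p^r(1-p)^{n-r}$ for $n\ge r$. A (possibly randomized) estimator $\hat p$ of $p$ is specified by a family $(\Pi_n)_{n\ge r}$ of distribution functions of positive random variables, not depending on $p$; $\Pi_n$ is the distribution function of $\hat p$ conditioned on $N=n$. Its risk is $\eta(p)=\mathrm E[L(\hat p/p)]=\sum_{n=r}^\infty f(n)\int_0^\infty L(y/p)\,d\Pi_n(y)\in[0,\infty]$. A non-randomized estimator is $\hat p=g(N)$ with $g:\{r,r+1,\dots\}\to\mathbb R^+$ (each $\Pi_n$ is a point mass at $g(n)$). For $\Omega\in\mathbb R^+$, $\bar\eta(\Omega)=\int_0^\infty\phi(\nu)L(\Omega/\nu)\,d\nu$ with $\phi(\nu)=\nu^{r-1}e^{-\nu}/(r-1)!$; it is the limit as $p\to0$ of the risk of any non-randomized estimator $g(N)$ with $\lim_{n\to\infty}n\,g(n)=\Omega$. Under the stated hypotheses $\bar\eta$ attains a minimum over $\Omega\in\mathbb R^+$, denoted $\eta^*$.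
   Formalization: η* is taken as the infimum of η̄ over Ω; that this infimum is attained is proved only if L(ξ) ≤ L(x) for some x in (0,ξ), because under (1)–(5) alone it can fail (r=1, L=1 on (0,1), L(1)=1000, L=2 beyond: η̄(Ω)=2−exp(−Ω)). *)

(* Defs.v *)
From HB Require Import structures.
From mathcomp Require Import all_boot all_order all_algebra.
From mathcomp Require Import all_classical all_reals all_analysis.

Set Implicit Arguments.
Unset Strict Implicit.
Unset Printing Implicit Defensive.

Import Order.TTheory GRing.Theory Num.Theory.
Import numFieldNormedType.Exports.

Local Open Scope classical_set_scope.
Local Open Scope ring_scope.

Definition is_minimum {R : realType} (A : set (\bar R)) (m : \bar R) : Prop :=
  A m /\ lbound A m.

Section Theta.
Context {R : realType}.

(* Functions on (0, +oo) are represented by functions on R whose values on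
   (-oo, 0] are never constrained nor used. *)
Definition Theta_at_0 (h1 h2 : R -> R) : Prop :=
  exists a m M : R, [/\ 0 < a, 0 < m, 0 < M &
    forall x, 0 < x -> x <= a -> m * h2 x <= h1 x /\ h1 x <= M * h2 x].

Definition Theta_at_infty (h1 h2 : R -> R) : Prop :=
  exists a m M : R, [/\ 0 < a, 0 < m, 0 < M &
    forall x, a <= x -> m * h2 x <= h1 x /\ h1 x <= M * h2 x].

End Theta.

Definition class_C {R : realType} (t : nat) (L : R -> R) (a b : R) : Prop :=
  (forall i x, (i < t)%N -> x \in `]a, b[ -> derivable (derive1n i L) x 1) /\
  (forall x, x \in `]a, b[ -> {for x, continuous (derive1n t L)}).

Section InverseBinomialSampling.
Context {R : realType}.
Implicit Types (r n : nat) (L : R -> R) (p Omega : R).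

Definition negbin_pmf r p n : R :=
  'C(n.-1, r.-1)%:R * p ^+ r * (1 - p) ^+ (n - r).

(* [Pi n] is the conditional distribution function of the estimator given
   N = n; it is relevant for n >= r only.  [Pi n 0 = 0] says that the
   corresponding random variable is (almost surely) positive. *)
Definition estimator r (Pi : nat -> cumulativeBounded (0 : R) (1 : R)) : Prop :=
  forall n, (r <= n)%N -> Pi n 0 = 0.

Definition risk r L (Pi : nat -> cumulativeBounded (0 : R) (1 : R)) p : \bar R :=
  (\sum_(r <= n <oo) ((negbin_pmf r p n)%:E *
     \int[lebesgue_stieltjes_measure (Pi n)]_(y in `]0%R, +oo[) (L (y / p))%:E))%E.

Definition limsup_risk r L (Pi : nat -> cumulativeBounded (0 : R) (1 : R)) : \bar R :=
  limf_esup (risk r L Pi) (0 : R)^'+.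

Definition gamma_pdf r (nu : R) : R :=
  nu ^+ r.-1 * expR (- nu) / (r.-1)`!%:R.

Definition eta_bar r L Omega : \bar R :=
  (\int[lebesgue_measure]_(nu in `]0%R, +oo[)
     (gamma_pdf r nu * L (Omega / nu))%:E)%E.

Definition eta_bar_values r L : set (\bar R) :=
  [set eta_bar r L Omega | Omega in [set Omega | 0 < Omega]].

(* The infimum always exists, and it is the minimum whenever there is one.  There
   may be none: for r = 1, L = 1 on (0, 1), L(1) = 1000 and L = 2 on (1, +oo),
   eta_bar Omega = 2 - expR (- Omega). *)
Definition eta_star r L : \bar R := ereal_inf (eta_bar_values r L).

End InverseBinomialSampling.

(* Main.v *)
Require Import Defs.
From HB Require Import structures.
From mathcomp Require Import all_boot all_order all_algebra.
From mathcomp Require Import all_classical all_reals all_analysis.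
From mathcomp Require Import measurable_realfun ring lra.
Import Order.TTheory GRing.Theory Num.Theory.
Import numFieldNormedType.Exports.
Set Implicit Arguments.
Unset Strict Implicit.
Unset Printing Implicit Defensive.
Local Open Scope classical_set_scope.
Local Open Scope ring_scope.

(* Lower bound: average the risk over the scale-invariant prior dp/p on an
   interval [a, b] with b fixed and a -> 0.  For large n the Bayes weight of
   [N = n] is close to [gamma_pdf r (p * n) dp], so by Tonelli the contribution
   of every n is at least, up to 1 + o(1), the infimum over Omega of [eta_bar]
   truncated to nu in [1/M, M], divided by n.  Summing over 1/b << n << 1/a gives
   that infimum times log(b/a), while a risk at most c on (0, b) averages to at
   most c log(b/a).  The truncated infimum tends to [eta_star] as M grows, because
   [L] exceeds every number below [eta_star] both near 0 and near infinity.

   Upper bound: writing n = trunc(nu / p) + r turns the risk into an integral of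
   step functions over nu, and dominated convergence gives the limit [eta_bar].
   Either [L > eta_star] somewhere on (0, xi); then [eta_bar] stays above [eta_star]
   near 0 and infinity, attains its infimum by continuity at some Omega, and
   Omega / N is optimal.  Or [L <= eta_star] on (0, xi); then 1 / N ^ 2, for which
   the ratio of estimate to p tends to 0, is optimal. *)

(** * Integrals on the half-line *)

(** The prior dp/p has the scale invariance of the limiting problem and infinite mass near 0: what
    truncation spoils at the ends of [[a, b]] is a bounded amount, set against log(b/a). That [L]
    exceeds [eta_star] near infinity comes from (5). If [L] has a finite supremum [c] on
    [(xi', +oo)], then for large [Omega] the gamma weight of the dip of [L] before [xi'] exceeds by
    an exponential factor the weight of the arguments below the dip, where [L] may be huge; hence
    [eta_bar Omega < c]. Near 0 there is no such dip; instead, [L <= c] on [(0, xi)] forces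
    [eta_star <= c], by taking [Omega] small. The integral in (4) bears on whether [eta_bar] attains
    its infimum: if [L] is constant on [(0, xi]], it is [(r-1)!] times the coefficient of
    [Omega ^ r] in [L xi - eta_bar Omega] as [Omega] tends to 0. The substitution [nu = Omega * u]
    moves [Omega] out of [L], which may jump, into a smooth kernel. *)

Section tonelli.
Context d1 d2 (T1 : measurableType d1) (T2 : measurableType d2) (R : realType).
Variables (m1 : {sigma_finite_measure set T1 -> \bar R})
  (m2 : {sigma_finite_measure set T2 -> \bar R}).
Local Open Scope ereal_scope.

Lemma fubini_tonelli_in (D1 : set T1) (D2 : set T2) (f : T1 * T2 -> \bar R) :
  measurable D1 -> measurable D2 -> measurable_fun setT f ->
  (forall z, 0 <= f z) ->
  \int[m1]_(x in D1) \int[m2]_(y in D2) f (x, y) =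
  \int[m2]_(y in D2) \int[m1]_(x in D1) f (x, y).
Proof.
move=> mD1 mD2 mf f0.
have mh : measurable_fun setT (f \_ (D1 `*` D2)).
  apply/(measurable_restrictT f (measurableX _ _)) => //.
  exact: measurable_funS mf.
have h0 z : 0 <= (f \_ (D1 `*` D2)) z by apply: erestrict_ge0 => ? _; exact: f0.
rewrite [LHS]integral_mkcond [RHS]integral_mkcond /=.
transitivity (\int[m1]_x \int[m2]_y (f \_ (D1 `*` D2)) (x, y)).
  apply: eq_integral => x _; rewrite patchE; case: ifPn => xD.
    rewrite [LHS]integral_mkcond; apply: eq_integral => y _.
    by rewrite !patchE in_setX xD.
  rewrite integral0_eq// => y _; rewrite patchE in_setX.
  by rewrite (negbTE xD).
rewrite (fubini_tonelli _ mh h0).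
apply: eq_integral => y _; rewrite patchE; case: ifPn => yD.
  rewrite [RHS]integral_mkcond; apply: eq_integral => x _.
  by rewrite !patchE in_setX yD andbT.
rewrite integral0_eq// => x _; rewrite patchE in_setX.
by rewrite (negbTE yD) andbF.
Qed.

Lemma measurable_integral_tonelli (D2 : set T2) (f : T1 * T2 -> \bar R) :
  measurable D2 -> measurable_fun setT f -> (forall z, 0 <= f z) ->
  measurable_fun setT (fun x => \int[m2]_(y in D2) f (x, y)).
Proof.
move=> mD2 mf f0.
have mh : measurable_fun setT (f \_ (setT `*` D2)).
  apply/(measurable_restrictT f (measurableX _ _)) => //.
  exact: measurable_funS mf.
rewrite (_ : (fun x => _) =
    (fun x => \int[m2]_y (f \_ (setT `*` D2)) (x, y))); last first.
  apply/funext => x; rewrite integral_mkcond; apply: eq_integral => y _.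
  by rewrite !patchE in_setX in_setT.
have h0 z : 0 <= (f \_ (setT `*` D2)) z by apply: erestrict_ge0 => ? _; exact: f0.
exact: measurable_fun_fubini_tonelli_F mh h0.
Qed.

End tonelli.

(** * Linear and inverse changes of variables for Lebesgue measure *)

Section change_of_variables.
Context {R : realType}.
Local Notation mu := (@lebesgue_measure R).

Lemma measurable_mulrl (c : R) :
  measurable_fun setT ( *%R c : measurableTypeR R -> measurableTypeR R).
Proof. exact: mulrl_measurable. Qed.

(** Packaged as a measure so that the uniqueness of Lebesgue measure identifies it with [mu]; a
    linear substitution is then valid for every non-negative measurable integrand. *)
Definition scaled_lebesgue (c : {posnum R}) :
    {measure set (measurableTypeR R) -> \bar R} :=
  mscale c%:num%:nng
    (measure_function_pushforward__canonical__measure_function_Measure mu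
       (measurable_mulrl c%:num)).

Lemma lebesgue_measure_scale (c : {posnum R}) (A : set (measurableTypeR R)) :
  measurable A -> mu A = scaled_lebesgue c A.
Proof.
move=> mA; apply: lebesgue_measure_unique => //= _ [[a b]] _ <-.
rewrite /scaled_lebesgue /mscale /= /pushforward /=.
rewrite (_ : _ @^-1` _ = `]c%:num^-1 * a, c%:num^-1 * b]%classic); last first.
  apply/seteqP; split => x /=; rewrite !in_itv/= => /andP[h1 h2].
    by rewrite ltr_pdivrMl// ler_pdivlMl// h1 h2.
  by move: h1 h2; rewrite ltr_pdivrMl// ler_pdivlMl// => -> ->.
rewrite !lebesgue_measure_itv/= !lte_fin ltr_pM2l ?invr_gt0//.
case: ifP => _; last by rewrite mule0.
by rewrite -!EFinB -EFinM; congr (_%:E); rewrite -mulrBr mulVKf.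
Qed.

Lemma ge0_integral_scale (c : R) (D : set R) (f : R -> \bar R) : 0 < c ->
  measurable D -> measurable_fun D f -> (forall x, D x -> 0 <= f x)%E ->
  (\int[mu]_(x in D) f x =
   c%:E * \int[mu]_(x in ( *%R c) @^-1` D) f (c * x)%R)%E.
Proof.
move=> /posnumP[{}c] mD mf f0.
have f0' : {in D, forall y, (0 <= f y)%E} by move=> y /set_mem; exact: f0.
rewrite -(ge0_integral_pushforward (measurable_mulrl c%:num) mu mD mf f0').
transitivity (\int[scaled_lebesgue c]_(x in D) f x)%E.
  by apply: eq_measure_integral => A mA AD; exact: lebesgue_measure_scale.
by rewrite ge0_integral_mscale.
Qed.

Lemma ge0_integral_scaley (c : R) (f : R -> \bar R) : 0 < c ->
  measurable_fun setT f -> (forall x : R, (0 < x)%R -> (0 <= f x)%E) ->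
  (\int[mu]_(x in `]0%R, +oo[) f x =
   c%:E * \int[mu]_(x in `]0%R, +oo[) f (c * x)%R)%E.
Proof.
move=> c0 mf f0; rewrite (ge0_integral_scale c0)//.
- congr (_ * integral _ _ _)%E; apply/seteqP.
  by split=> x /=; rewrite !in_itv/= !andbT pmulr_rgt0.
- exact: measurable_funS mf.
- by move=> x /=; rewrite in_itv/= andbT; exact: f0.
Qed.

Lemma measurable_inv : measurable_fun setT (fun x : R => x^-1).
Proof.
(* [x^-1 = x * |x| ^ -2], also at 0, where both sides vanish: this reduces the claim to the
   measurability of real powers. *)
rewrite (_ : (fun x => _) = (fun x : R => x * (powR `|x| (-1)) ^+ 2)).
  apply: measurable_funM => //; apply: measurable_funX.
  apply: (@measurableT_comp _ _ _ _ _ _ (@powR R ^~ (-1)) _ (@Num.norm R R)).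
    exact: (measurable_powR (-1)).
  exact: normr_measurable.
apply/funext => x; rewrite powR_inv1 ?normr_ge0//.
have [->|x0] := eqVneq x 0; first by rewrite invr0 mul0r.
by rewrite exprVn real_normK ?num_real// expr2 invfM mulrA divff// mul1r.
Qed.

Local Notation pos := (`]0%R, +oo[%classic : set R).

(* Both sides are Haar integrals on the multiplicative group (0, +oo), so they
   agree by the usual uniqueness argument: expand the product of the integrals
   of [g] and of the indicator of [1, 2] by Tonelli and rescale. *)
Lemma ge0_integral_inv_haar (g : R -> \bar R) :
  measurable_fun setT g -> (forall x, 0 <= g x)%E ->
  (\int[mu]_(u in pos) (u^-1%:E * g u^-1%R) =
   \int[mu]_(x in pos) (x^-1%:E * g x))%E.
Proof.
move=> mg g0.
pose h : R -> \bar R := EFin \o \1_(`[1, 2]%classic : set R).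
have h0 x : (0 <= h x)%E by rewrite lee_fin.
have mh : measurable_fun setT h.
  by apply/measurable_EFinP; exact: measurable_indic.
have minv : measurable_fun setT (fun x : R => x^-1%:E).
  by apply/measurable_EFinP; exact: measurable_inv.
have mc (k : R -> \bar R) : measurable_fun setT k ->
    measurable_fun setT (fun x : R => x^-1%:E * k x)%E.
  by move=> mk; apply: emeasurable_funM.
have mcv (k : R -> \bar R) : measurable_fun setT k ->
    measurable_fun setT (fun x : R => x^-1%:E * k x^-1%R)%E.
  move=> mk; apply: emeasurable_funM => //.
  exact: (measurableT_comp mk measurable_inv).
have haar (k : R -> \bar R) (c : R) : 0 < c -> measurable_fun setT k ->
    (forall x : R, 0 <= k x)%E ->
  (\int[mu]_(x in pos) (x^-1%:E * k x) =
   \int[mu]_(x in pos) (x^-1%:E * k (c * x)%R))%E.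
  move=> c0 mk k0; rewrite (ge0_integral_scaley c0); last 2 first.
  - exact: mc.
  - by move=> x x0; rewrite mule_ge0// lee_fin invr_ge0 ltW.
  rewrite -ge0_integralZl//; last 3 first.
  - apply: (measurable_funS measurableT) => //.
    exact: (measurableT_comp (mc k mk) (@mulrl_measurable R setT c)).
  - move=> x /=; rewrite in_itv/= andbT => x0.
    by rewrite mule_ge0// lee_fin invr_ge0 mulr_ge0// ltW.
  - by rewrite lee_fin ltW.
  apply: eq_integral => x /set_mem/=; rewrite in_itv/= andbT => x0.
  by rewrite muleA -EFinM invfM mulVKf// gt_eqF.
have mhv : measurable_fun setT (fun x : R => h x^-1).
  exact: (measurableT_comp mh measurable_inv).
have mgv : measurable_fun setT (fun x : R => g x^-1).
  exact: (measurableT_comp mg measurable_inv).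
set Th := (\int[mu]_(u in pos) (u^-1%:E * h u^-1%R))%E.
set Tg := LHS; set Sg := RHS.
have hE (u : R) : 0 < u -> h u^-1 = (\1_(`[2^-1, 1]%classic : set R) u)%:E.
  move=> u0; rewrite /h /= !indicE; congr (_%:R%:E); congr nat_of_bool.
  apply/idP/idP => /set_mem/= uI; apply/mem_set => /=; move: uI.
    by rewrite !in_itv/= invf_ge1// invf_ple ?posrE// => /andP[-> ->].
  by rewrite !in_itv/= invf_ge1// [(_ <= 2)]invf_ple ?posrE// => /andP[-> ->].
have muI : mu (`[2^-1, 1]%classic `&` pos) = (2^-1)%:E.
  rewrite (_ : _ `&` _ = `[2^-1, 1]%classic).
    rewrite lebesgue_measure_itv/= lte_fin invf_lt1// ltr1n.
    by rewrite -EFinB; congr (_%:E); lra.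
  apply/setIidPl => x /=; rewrite !in_itv/= andbT => /andP[+ _].
  by apply: lt_le_trans; rewrite invr_gt0.
have m1 : measurable_fun pos
    (fun u : R => (\1_(`[2^-1, 1]%classic : set R) u : R)%:E).
  by apply/measurable_EFinP; apply: measurable_indic.
have Th_gt0 : (0 < Th)%E.
  apply: (@lt_le_trans _ _ (2^-1)%R%:E); first by rewrite lte_fin invr_gt0.
  rewrite -muI -integral_indic//; apply: ge0_le_integral => //.
  - exact: measurable_funS (mcv _ mh).
  - move=> u /=; rewrite in_itv/= andbT => u0; rewrite hE// -EFinM lee_fin.
    rewrite indicE; have [|_] := boolP (_ \in _); last by rewrite mulr0.
    by move/set_mem; rewrite /= in_itv/= mulr1 => /andP[_ u1]; rewrite invf_ge1.
have Th_lty : (Th < +oo)%E.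
  apply: (@le_lt_trans _ _ (2%:E * (2^-1)%R%:E)%E); last by rewrite -EFinM ltry.
  rewrite -muI -integral_indic// -ge0_integralZl//.
  apply: ge0_le_integral => //.
  - move=> u /=; rewrite in_itv/= andbT => u0.
    by rewrite mule_ge0// lee_fin invr_ge0 ltW.
  - exact: measurable_funS (mcv _ mh).
  - exact: emeasurable_funM.
  - move=> u /=; rewrite in_itv/= andbT => u0; rewrite hE// -!EFinM lee_fin.
    rewrite indicE; have [|_] := boolP (_ \in _); last by rewrite !mulr0.
    move/set_mem; rewrite /= in_itv/= !mulr1 => /andP[u1 _].
    by rewrite invf_ple ?posrE.
have gev (k : R -> \bar R) (x : R) : (forall x : R, 0 <= k x)%E -> pos x ->
    (0 <= x^-1%:E * k x)%E.
  move=> k0; rewrite /= in_itv/= andbT => x0.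
  by rewrite mule_ge0// lee_fin invr_ge0 ltW.
have nv_ge0 (x y : R) : (0 <= (`|x|^-1 * `|y|^-1)%:E)%E.
  by rewrite lee_fin mulr_ge0// invr_ge0.
(* The absolute values make [F] and [G] non-negative on the whole plane, as the Tonelli lemma
   requires; they disappear on the positive quadrant. *)
pose F (z : R * R) : \bar R :=
  ((`|z.1|^-1 * `|z.2|^-1)%:E * (h z.1^-1%R * g (z.1^-1 * z.2)%R))%E.
pose G (z : R * R) : \bar R :=
  ((`|z.1|^-1 * `|z.2|^-1)%:E * (h (z.2 * z.1)^-1%R * g z.2^-1%R))%E.
have mfst : measurable_fun setT (fun z : R * R => z.1) by exact: measurable_fst.
have msnd : measurable_fun setT (fun z : R * R => z.2) by exact: measurable_snd.
have minvc (k : R * R -> R) : measurable_fun setT k ->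
    measurable_fun setT (fun z => (k z)^-1).
  by move=> mk; exact: (measurableT_comp measurable_inv mk).
have mnrm (k : R * R -> R) : measurable_fun setT k ->
    measurable_fun setT (fun z => `|k z|).
  by move=> mk; exact: (measurableT_comp (@normr_measurable R setT) mk).
have mnv : measurable_fun setT (fun z : R * R => (`|z.1|^-1 * `|z.2|^-1)%:E).
  by apply/measurable_EFinP/measurable_funM; apply: minvc; exact: mnrm.
have mF : measurable_fun setT F.
  apply: emeasurable_funM => //; apply: emeasurable_funM.
    by apply: (measurableT_comp mh); exact: minvc.
  by apply: (measurableT_comp mg); apply: measurable_funM => //; exact: minvc.
have mG : measurable_fun setT G.
  apply: emeasurable_funM => //; apply: emeasurable_funM.
    by apply: (measurableT_comp mh); apply: minvc; exact: measurable_funM.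
  by apply: (measurableT_comp mg); exact: minvc.
have F0 z : (0 <= F z)%E by apply: mule_ge0 => //; apply: mule_ge0.
have G0 z : (0 <= G z)%E by apply: mule_ge0 => //; apply: mule_ge0.
suff : (Th * Sg = Th * Tg)%E.
  have Th_fin : Th \is a fin_num by rewrite ge0_fin_numE ?ltW.
  by move=> /eqP; rewrite eq_le !lee_pmul2l// => /andP[? ?]; apply/le_anti/andP.
transitivity (\int[mu]_(v in pos) \int[mu]_(y in pos) F (v, y))%E.
  rewrite /Th -ge0_integralZr//; last 3 first.
  - exact: measurable_funS (mcv _ mh).
  - by move=> x; apply: (gev (fun x : R => h x^-1)).
  - by apply: integral_ge0 => x; exact: gev.
  apply: eq_integral => v /set_mem/=; rewrite in_itv/= andbT => v0.
  rewrite /Sg (haar g v^-1) ?invr_gt0// -ge0_integralZl//; last 3 first.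
  - apply: (measurable_funS measurableT) => //; apply: mc.
    exact: (measurableT_comp mg (@mulrl_measurable R setT v^-1)).
  - by move=> x; apply: (gev (fun x : R => g (v^-1 * x))).
  - by rewrite mule_ge0// lee_fin invr_ge0 ltW.
  apply: eq_integral => y /set_mem/=; rewrite in_itv/= andbT => y0.
  by rewrite /F /= !gtr0_norm// EFinM !muleA; congr (_ * _)%E; rewrite muleAC.
transitivity (\int[mu]_(y in pos) \int[mu]_(v in pos) F (v, y))%E.
  exact: (@fubini_tonelli_in _ _ _ _ R mu mu pos pos F).
(* Rescaling [v] by [y] turns [v^-1 * y] into [w^-1]: after the next exchange [g] leaves the inner
   integral, and a rescaling of [y] by [w] frees [h] from [w]. *)
transitivity (\int[mu]_(y in pos) \int[mu]_(w in pos) G (y, w))%E.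
  apply: eq_integral => y /set_mem/=; rewrite in_itv/= andbT => y0.
  transitivity ((y^-1)%:E * \int[mu]_(v in pos)
      ((v^-1)%:E * (h v^-1%R * g (v^-1 * y)%R)))%E.
    rewrite -ge0_integralZl//; last 3 first.
    - apply: (measurable_funS measurableT) => //; apply: mc.
      apply: emeasurable_funM => //.
      apply: (measurableT_comp mg); apply: measurable_funM => //.
      exact: measurable_inv.
    - move=> x; apply: (gev (fun x : R => h x^-1%R * g (x^-1 * y)%R)%E).
      by move=> ?; exact: mule_ge0.
    - by rewrite lee_fin invr_ge0 ltW.
    apply: eq_integral => v /set_mem/=; rewrite in_itv/= andbT => v0.
    by rewrite /F /= !gtr0_norm// EFinM !muleA; congr (_ * _ * _)%E; rewrite muleC.
  rewrite (haar (fun v : R => h v^-1%R * g (v^-1 * y)%R)%E y)//; last 2 first.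
  - apply: emeasurable_funM => //.
    apply: (measurableT_comp mg); apply: measurable_funM => //.
    exact: measurable_inv.
  - by move=> ?; exact: mule_ge0.
  rewrite -ge0_integralZl//; last 3 first.
  - apply: (measurable_funS measurableT) => //; apply: mc.
    apply: emeasurable_funM => //.
      apply: (measurableT_comp mh).
      exact: (measurableT_comp measurable_inv (@mulrl_measurable R setT y)).
    apply: (measurableT_comp mg); apply: measurable_funM => //.
    exact: (measurableT_comp measurable_inv (@mulrl_measurable R setT y)).
  - move=> x; apply: (gev (fun x : R => h (y * x)^-1%R * g ((y * x)^-1 * y)%R)%E).
    by move=> ?; exact: mule_ge0.
  - by rewrite lee_fin invr_ge0 ltW.
  apply: eq_integral => w /set_mem/=; rewrite in_itv/= andbT => w0.
  rewrite /G /= !gtr0_norm// EFinM !muleA; congr (_ * _ * g _)%E.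
    by rewrite [w * y]mulrC.
  by rewrite invfM mulrAC mulVf ?mul1r// gt_eqF.
transitivity (\int[mu]_(w in pos) \int[mu]_(y in pos) G (y, w))%E.
  exact: (@fubini_tonelli_in _ _ _ _ R mu mu pos pos G).
rewrite muleC /Tg -ge0_integralZr//; last 3 first.
- exact: measurable_funS (mcv _ mg).
- by move=> x; apply: (gev (fun x : R => g x^-1)).
- by rewrite ltW.
apply: eq_integral => w /set_mem/=; rewrite in_itv/= andbT => w0.
rewrite /Th (haar (fun x : R => h x^-1) w)// -ge0_integralZl//; last 3 first.
- apply: (measurable_funS measurableT) => //; apply: mc.
  apply: (measurableT_comp mh).
  exact: (measurableT_comp measurable_inv (@mulrl_measurable R setT w)).
- by move=> x; apply: (gev (fun x : R => h (w * x)^-1)).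
- by rewrite mule_ge0// lee_fin invr_ge0 ltW.
apply: eq_integral => y /set_mem/=; rewrite in_itv/= andbT => y0.
by rewrite /G /= !gtr0_norm// EFinM [LHS]muleACA [LHS]muleC.
Qed.

(** Positive and negative parts are treated separately, so [f] may change sign. For each part the
    Haar identity is applied to [x * g x] cut off at [c]: the factor [x] cancels the density [1 / x]
    on one side and yields [u ^- 2] on the other. *)
Lemma integral_inv (f : R -> R) (c : R) : 0 < c -> measurable_fun setT f ->
  (\int[mu]_(x in `]c%R, +oo[) (f x)%:E =
   \int[mu]_(u in `]0%R, c^-1%R[) (f u^-1 / u ^+ 2)%:E)%E.
Proof.
move=> c0 mf.
have ge0 (g : R -> \bar R) : measurable_fun setT g -> (forall x : R, 0 <= g x)%E ->
    (\int[mu]_(x in `]c%R, +oo[) g x =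
     \int[mu]_(u in `]0%R, c^-1%R[) ((u ^- 2)%:E * g u^-1%R))%E.
  move=> mg g0.
  pose k := (fun x : R => `|x|%:E * (g \_ `]c%R, +oo[) x)%E.
  have mk : measurable_fun setT k.
    apply: emeasurable_funM.
      by apply/measurable_EFinP; exact: normr_measurable.
    by apply/(measurable_restrictT g) => //; exact: measurable_funS mg.
  have k0 x : (0 <= k x)%E.
    by rewrite mule_ge0// ?lee_fin//; apply: erestrict_ge0 => ? _; exact: g0.
  have := ge0_integral_inv_haar mk k0.
  rewrite [X in _ = X -> _](_ : _ = \int[mu]_(x in `]c%R, +oo[) g x)%E; last first.
    rewrite [RHS]integral_mkcond [LHS]integral_mkcond.
    apply: eq_integral => x _; rewrite !patchE /k.
    case: ifPn => [/set_mem/=|/negP + ].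
      rewrite in_itv/= andbT => x0; rewrite gtr0_norm// muleA -EFinM mulVf ?gt_eqF//.
      by rewrite mul1e patchE.
    case: ifPn => // /set_mem/=; rewrite in_itv/= andbT => cx []; apply/mem_set => /=.
    by rewrite in_itv/= andbT (lt_trans c0).
  move=> <-.
  rewrite [RHS]integral_mkcond [LHS]integral_mkcond.
  apply: eq_integral => u _; rewrite !patchE /k patchE.
  have -> : (u \in (`]0, c^-1[%classic : set R)) =
      (u \in pos) && (u^-1 \in (`]c, +oo[%classic : set R)).
    apply/idP/andP => [/set_mem/=|[/set_mem/= + /set_mem/=]].
      rewrite in_itv/= => /andP[u0 uc]; split; apply/mem_set => /=.
        by rewrite in_itv/= andbT.
      by rewrite in_itv/= andbT invf_pgt ?posrE.
    rewrite !in_itv/= !andbT => u0; rewrite invf_pgt ?posrE// => uc.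
    by apply/mem_set; rewrite /= in_itv/= u0.
  case: ifPn => //= /set_mem/=; rewrite in_itv/= andbT => u0.
  case: ifPn => // _; last by rewrite !mule0.
  rewrite normrV ?unitfE ?gt_eqF// gtr0_norm// muleA -EFinM.
  by rewrite -exprVn expr2.
rewrite integralE [RHS]integralE; congr (_ - _)%E.
- rewrite ge0; last 2 first.
  + by apply/measurable_funepos/measurable_EFinP.
  + by move=> x; exact: funepos_ge0.
  apply: eq_integral => u /set_mem/=; rewrite in_itv/= => /andP[u0 _].
  rewrite /= !funeposE mulrC EFinM -[in RHS](mule0 (u ^- 2)%:E).
  by rewrite maxe_pMr ?lee_fin ?invr_ge0 ?exprn_ge0 ?ltW.
- rewrite ge0; last 2 first.
  + by apply/measurable_funeneg/measurable_EFinP.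
  + by move=> x; exact: funeneg_ge0.
  apply: eq_integral => u /set_mem/=; rewrite in_itv/= => /andP[u0 _].
  rewrite /= !funenegE mulrC EFinM -muleN -[in RHS](mule0 (u ^- 2)%:E).
  by rewrite maxe_pMr ?lee_fin ?invr_ge0 ?exprn_ge0 ?ltW.
Qed.

End change_of_variables.

(** * Integrability of the gamma density and of powers near 0 *)

Section integrability.
Context {R : realType}.
Local Notation mu := (@lebesgue_measure R).
Local Notation pos := (`]0%R, +oo[%classic : set R).

Lemma expr_le_fact_expR (m : nat) (y : R) : 0 <= y -> y ^+ m <= m`!%:R * expR y.
Proof.
move=> y0; case: m => [|m]; first by rewrite expr0 fact0 mul1r -(expR0 R) ler_expR.
have := expR_ge1Dxn m y0.
rewrite -ler_pdivrMl ?ltr0n ?fact_gt0//; apply: le_trans.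
by rewrite mulrC lerDr.
Qed.

Lemma cvg_expr_expRN (m : nat) : x ^+ m * expR (- x) @[x --> +oo] --> (0 : R).
Proof.
apply: (@squeeze_cvgr _ _ _ _ (cst 0) (fun x : R => (m.+1)`!%:R * x^-1)).
- near=> x; have x0 : 0 < x by near: x; exact: nbhs_pinfty_gt.
  apply/andP; split; first by rewrite mulr_ge0 ?expR_ge0// exprn_ge0// ltW.
  rewrite expRN ler_pdivrMr ?expR_gt0// mulrAC ler_pdivlMr// -exprSr.
  by apply: expr_le_fact_expR; exact: ltW.
- exact: cvg_cst.
- rewrite -[X in _ --> X](mulr0 (m.+1)`!%:R); apply: cvgM; first exact: cvg_cst.
  by apply/gtr0_cvgV0; [exact: nbhs_pinfty_gt | exact: cvg_id].
Unshelve. all: by end_near. Qed.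

Lemma is_derive_gamma_pdf1 (x : R) : is_derive x 1 (gamma_pdf 1) (- gamma_pdf 1 x).
Proof.
have -> : gamma_pdf 1 = (fun y : R => expR (- y)).
  by apply/funext => y; rewrite /gamma_pdf /= expr0 mul1r fact0 mulr1n divr1.
have h : is_derive x 1 (fun y : R => expR (- y)) (expR (- x) * (- 1)).
  by apply: (@is_derive1_comp _ expR (fun y : R => - y)).
by apply: (is_derive_eq h); rewrite mulrN1.
Qed.

Lemma is_derive_gamma_pdfS (m : nat) (x : R) :
  is_derive x 1 (gamma_pdf m.+2) (gamma_pdf m.+1 x - gamma_pdf m.+2 x).
Proof.
have -> : gamma_pdf m.+2 =
    ((m.+1)`!%:R^-1 *: ((id : R -> R) ^+ m.+1 * gamma_pdf 1) : R -> R).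
  apply/funext => y; rewrite !fctE /gamma_pdf /= expr0 mul1r fact0 mulr1n divr1.
  by rewrite mulrC.
apply: (is_derive_eq (is_deriveZ _ (is_deriveM (is_deriveX _ (is_derive_id x 1)) (is_derive_gamma_pdf1 x)))).
rewrite !fctE /gamma_pdf /= !expr0 !mul1r !fact0 !mulr1n !divr1 factS natrM exprS.
rewrite /GRing.scale /=. field.
by rewrite pnatr_eq0 -lt0n fact_gt0 /= nat1r pnatr_eq0.
Qed.

(** The derivative of [gamma_pdf i.+2] is [gamma_pdf i.+1 - gamma_pdf i.+2], so the sum telescopes.
    Up to the constant 1 this antiderivative is the Erlang distribution function, whose complement
    is a sum of Poisson probabilities. *)
Lemma is_derive_gamma_pdf_sum (m : nat) (x : R) :
  is_derive x 1 (fun y : R => - \sum_(i < m.+1) gamma_pdf i.+1 y)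
    (gamma_pdf m.+1 x).
Proof.
elim: m => [|m IH].
  under eq_fun do rewrite big_ord1.
  rewrite -[X in is_derive _ _ _ X]opprK.
  by apply: (@is_deriveN _ _ _ (gamma_pdf 1)); exact: is_derive_gamma_pdf1.
under eq_fun do rewrite big_ord_recr opprD /=.
apply: (is_derive_eq (is_deriveB IH (is_derive_gamma_pdfS m x))).
by rewrite opprB addrC subrK.
Qed.

Lemma continuous_gamma_pdf (r : nat) : continuous (@gamma_pdf R r).
Proof.
move=> x; apply: cvgM; last exact: cvg_cst.
apply: cvgM; first exact: exprn_continuous.
by apply: continuous_comp; [exact: oppr_continuous | exact: continuous_expR].
Qed.

Lemma gamma_pdf_ge0 (r : nat) (x : R) : 0 <= x -> 0 <= gamma_pdf r x.
Proof.
by move=> x0; rewrite /gamma_pdf divr_ge0 ?ler0n// mulr_ge0 ?expR_ge0// exprn_ge0.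
Qed.

Lemma integral_gamma_pdf (r : nat) : (0 < r)%N ->
  (\int[mu]_(x in pos) (gamma_pdf r x)%:E = 1)%E.
Proof.
case: r => // m _.
have cF (x : R) : {for x, continuous (fun y : R => - \sum_(i < m.+1) gamma_pdf i.+1 y)}.
  by have [/derivable1_diffP/differentiable_continuous] := is_derive_gamma_pdf_sum m x.
rewrite integral_itv_obnd_cbnd; last first.
  apply/measurable_EFinP; apply: measurable_funTS.
  by apply: continuous_measurable_fun; exact: continuous_gamma_pdf.
rewrite (@ge0_continuous_FTC2y _ _ (fun y : R => - \sum_(i < m.+1) gamma_pdf i.+1 y) 0 0).
- rewrite -EFinB sub0r opprK big_ord_recl big1 ?addr0.
    by rewrite /gamma_pdf /= expr0 oppr0 expR0 fact0 mulr1n divr1 mulr1.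
  by move=> i _; rewrite /gamma_pdf /= expr0n /= mul0r mul0r.
- exact: gamma_pdf_ge0.
- by apply: continuous_subspaceT; exact: continuous_gamma_pdf.
- rewrite -[X in _ --> X]oppr0; apply: cvgN.
  elim: m.+1 => [|n IH].
    rewrite [X in X @ _ --> _](_ : _ = cst 0); first exact: cvg_cst.
    by apply/funext => y; rewrite big_ord0.
  rewrite [X in X @ _ --> _](_ : _ =
      (fun y : R => \sum_(i < n) gamma_pdf i.+1 y + gamma_pdf n.+1 y)); last first.
    by apply/funext => y; rewrite big_ord_recr.
  rewrite -[X in _ --> X]addr0; apply: cvgD => //.
  rewrite -[X in _ --> X](mul0r (n`!%:R^-1)); apply: cvgM; last exact: cvg_cst.
  exact: cvg_expr_expRN.
- by move=> x _; have [] := is_derive_gamma_pdf_sum m x.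
- by apply: cvg_at_right_filter; exact: cF.
- by move=> x _; rewrite derive1E; apply: derive_val; exact: is_derive_gamma_pdf_sum.
Qed.

(** The bound does not depend on [a]; monotone convergence carries it to [(0, 1]]. *)
Lemma integral_powRN_le (s a : R) : s < 1 -> 0 < a -> a < 1 ->
  (\int[mu]_(x in `[a, 1%R]) (x `^ (- s))%:E <= ((1 - s)^-1)%:E)%E.
Proof.
move=> s1 a0 a1.
have dF (x : R) : 0 < x ->
    is_derive x 1 (fun y : R => (1 - s)^-1 * y `^ (1 - s)) (x `^ (- s)).
  move=> x0; apply: (@is_derive_eq _ _ _ _ _ _ _ ((1 - s)^-1 *: ((1 - s) * x `^ (1 - s - 1)))).
    by apply: is_deriveZ; exact: is_derive1_powR.
  by rewrite /GRing.scale /= mulKf ?subr_eq0 ?gt_eqF// addrAC subrr add0r.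
have df (x : R) : 0 < x -> derivable (fun y : R => y `^ (- s)) x 1.
  by move=> x0; have [] := is_derive1_powR (- s) x0.
have cF (x : R) : 0 < x ->
    {for x, continuous (fun y : R => (1 - s)^-1 * y `^ (1 - s))}.
  by move=> x0; have [/derivable1_diffP/differentiable_continuous] := dF x x0.
rewrite (@continuous_FTC2 _ _ (fun y : R => (1 - s)^-1 * y `^ (1 - s)))//.
- rewrite powR1 mulr1 -EFinB lee_fin lerBlDr lerDl mulr_ge0 ?powR_ge0//.
  by rewrite invr_ge0 subr_ge0 ltW.
- apply: derivable_within_continuous => x; rewrite in_itv/= => /andP[ax _].
  by apply: df; exact: lt_le_trans ax.
- split.
  + by move=> x; rewrite in_itv/= => /andP[/(lt_trans a0)/dF[]].
  + by apply: cvg_at_right_filter; exact: cF.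
  + by apply: cvg_at_left_filter; exact: cF.
- move=> x; rewrite in_itv/= => /andP[/(lt_trans a0) x0 _].
  by rewrite derive1E; apply: derive_val; exact: dF.
Qed.

Lemma measurable_powRN (s : R) D : measurable_fun D (fun x : R => x `^ (- s)).
Proof. by apply: measurable_funTS; exact: measurable_powR. Qed.

Lemma integral_powRN_lty (s : R) : s < 1 ->
  (\int[mu]_(x in `]0%R, 1%R]) (x `^ (- s))%:E < +oo)%E.
Proof.
(* Starting at 1/2 keeps the left end strictly inside [(0, 1)], where the uniform bound applies. *)
move=> s1; pose F (n : nat) : set R := `[n.+2%:R^-1, 1]%classic.
have ndF : nondecreasing_seq F.
  move=> m n mn; apply/subsetPset; apply: subset_itvr; rewrite bnd_simp.
  by rewrite lef_pV2 ?posrE// ler_nat.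
have -> : (`]0, 1]%classic : set R) = \bigcup_n F n.
  apply/seteqP; split => x /=; last first.
    by move=> [n _]; rewrite /F /= !in_itv/= => /andP[+ ->]; rewrite andbT; apply: lt_le_trans.
  rewrite in_itv/= => /andP[x0 x1].
  exists (Num.truncn x^-1) => //; rewrite /F /= in_itv/= x1 andbT invf_ple ?posrE//.
  by apply: ltW; rewrite (lt_trans (Num.Theory.truncnS_gt _))// ltr_nat.
apply: (@le_lt_trans _ _ ((1 - s)^-1)%:E); last exact: ltry.
have := @ge0_nondecreasing_set_cvg_integral _ (measurableTypeR R) R F (fun x => (x `^ (- s))%:E) mu ndF.
move=> /(_ _ _ _)/cvg_lim <- //.
- apply: lime_le.
    apply: ereal_nondecreasing_is_cvgn.
    apply: ge0_nondecreasing_set_nondecreasing_integral => // [i|i|i x _].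
      exact: measurable_itv.
      by apply/measurable_EFinP; exact: measurable_powRN.
    by rewrite lee_fin powR_ge0.
  by apply: nearW => n; apply: integral_powRN_le => //; rewrite invf_lt1// ltr1n.
- by move=> i; exact: measurable_itv.
- by move=> i; apply/measurable_EFinP; exact: measurable_powRN.
- by move=> i x _; rewrite lee_fin powR_ge0.
Qed.

Lemma integral_tail (f : R -> R) (e : R) : measurable_fun pos f ->
  (forall x, 0 < x -> 0 <= f x) -> (\int[mu]_(x in pos) (f x)%:E < +oo)%E ->
  0 < e -> exists2 M : R, 1 < M &
    (\int[mu]_(x in pos `\` `[M^-1%R, M%R]) (f x)%:E <= e%:E)%E.
Proof.
move=> mf f0 foo e0; pose F (n : nat) : set R := `[n.+2%:R^-1, n.+2%:R]%classic.
have ndF : nondecreasing_seq F.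
  move=> m n mn; apply/subsetPset; apply: subset_itv; rewrite bnd_simp ?ler_nat//.
  by rewrite lef_pV2 ?posrE// ler_nat.
have Fpos n : F n `<=` pos.
  move=> x; rewrite /F /= !in_itv/= andbT => /andP[+ _].
  by apply: lt_le_trans; rewrite invr_gt0.
have posE : pos = \bigcup_n F n.
  apply/seteqP; split => x; last by move=> [n _]; exact: Fpos.
  rewrite /= in_itv/= andbT => x0.
  exists (maxn (Num.truncn x^-1) (Num.truncn x)) => //; rewrite /F /= in_itv/= invf_ple ?posrE//.
  apply/andP; split; apply: ltW; apply: (lt_le_trans (Num.Theory.truncnS_gt _)); rewrite ler_nat ltnS.
    by rewrite leqW// leq_maxl.
  by rewrite leqW// leq_maxr.
have mfF n : measurable_fun (F n) (EFin \o f).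
  by apply/measurable_EFinP; apply: measurable_funS mf => //; exact: Fpos.
have f0F n x : F n x -> (0 <= (f x)%:E)%E.
  by move/Fpos; rewrite /= in_itv/= andbT lee_fin; exact: f0.
have fin n : (\int[mu]_(x in F n) (f x)%:E)%E \is a fin_num.
  rewrite ge0_fin_numE; last by apply: integral_ge0 => x; exact: f0F.
  apply: le_lt_trans foo; apply: ge0_subset_integral => //.
  - exact: measurable_itv.
  - exact/measurable_EFinP.
  - by move=> x; rewrite /= in_itv/= andbT lee_fin; exact: f0.
have cvgF := @ge0_nondecreasing_set_cvg_integral _ (measurableTypeR R) R F (EFin \o f) mu ndF
  (fun i => measurable_itv _) mfF f0F.
rewrite -posE in cvgF.
have : (\int[mu]_(x in pos) (f x)%:E - e%:E < \int[mu]_(x in pos) (f x)%:E)%E.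
  by rewrite lteBlDr// lteDl// ?lte_fin// ge0_fin_numE// integral_ge0// => x /=;
     rewrite in_itv/= andbT lee_fin; exact: f0.
rewrite ltNge => /negP HI.
have [N] : exists N, ~~ (\int[mu]_(x in F N) (f x)%:E <=
    \int[mu]_(x in pos) (f x)%:E - e%:E)%E.
  apply: contrapT => /forallNP H; apply: HI; rewrite -[leLHS](cvg_lim _ cvgF)//.
  apply: lime_le; first by apply/cvg_ex; eexists; exact: cvgF.
  by apply: nearW => n; apply: contrapT => /negP; exact: H.
rewrite -ltNge => HN.
exists N.+2%:R; first by rewrite ltr1n.
suff -> : (\int[mu]_(x in pos `\` F N) (f x)%:E =
    \int[mu]_(x in pos) (f x)%:E - \int[mu]_(x in F N) (f x)%:E)%E.
  by rewrite leeBlDr// addeC -leeBlDr// ltW.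
rewrite -[in X in (X - _)%E](setDUK (Fpos N)) ge0_integral_setU//=.
- by rewrite addeAC subee// add0e.
- exact: measurable_itv.
- by apply: measurableD => //; exact: measurable_itv.
- by rewrite setDUK//; exact/measurable_EFinP.
- move=> x [/f0F//|[]]; rewrite /= in_itv/= andbT lee_fin => x0 _; exact: f0.
- by apply/disj_setPS => x [Fx []].
Qed.

End integrability.

(** * An integrable majorant for the gamma-weighted loss *)

Section domination.
Context {R : realType}.
Local Notation mu := (@lebesgue_measure R).
Local Notation pos := (`]0%R, +oo[%classic : set R).

(** Used with [s = kap - (r - 1)], which lies in [(0, 1)]. The power accounts for [L] at infinity,
    reached as [nu] tends to 0; half of the exponential decay is spent on absorbing the positive
    powers of [nu] that come from [L] near 0. *)
Definition dominator (s nu : R) : R := (nu `^ (- s) + 1) * expR (- (nu / 2)).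

Lemma dominator_ge0 s nu : 0 <= dominator s nu.
Proof. by rewrite mulr_ge0 ?expR_ge0// addr_ge0 ?powR_ge0. Qed.

Lemma measurable_expRN_half : measurable_fun setT (fun nu : R => expR (- (nu / 2))).
Proof.
apply: continuous_measurable_fun => x.
apply: (@continuous_comp _ _ _ (fun nu : R => - (nu / 2)) expR); last exact: continuous_expR.
by apply: continuousN; apply: mulrr_continuous.
Qed.

Lemma measurable_dominator s : measurable_fun setT (dominator s).
Proof.
apply: measurable_funM; last exact: measurable_expRN_half.
by apply: measurable_funD => //; exact: measurable_powRN.
Qed.

Lemma integral_expRN_half : (\int[mu]_(nu in pos) (expR (- (nu / 2)))%:E = 2%R%:E)%E.
Proof.
rewrite (@ge0_integral_scaley _ 2)//; last first.
  by apply/measurable_EFinP; exact: measurable_expRN_half.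
transitivity (2%R%:E * \int[mu]_(nu in pos) (gamma_pdf 1 nu)%:E)%E.
  congr (_ * _)%E; apply: eq_integral => nu _.
  by rewrite /gamma_pdf /= expr0 mul1r fact0 mulr1n divr1 mulrC mulKf.
by rewrite integral_gamma_pdf// mule1.
Qed.

Lemma integral_dominator_lty s : 0 <= s -> s < 1 ->
  (\int[mu]_(nu in pos) (dominator s nu)%:E < +oo)%E.
Proof.
move=> s0 s1.
have -> : pos = `]0, 1]%classic `|` `]1, +oo[%classic.
  by rewrite -itv_bndbnd_setU// bnd_simp.
have md D : measurable_fun D (fun nu => (dominator s nu)%:E).
  by apply/measurable_EFinP; apply: measurable_funTS; exact: measurable_dominator.
rewrite ge0_integral_setU//=; last 3 first.
- exact: md.
- by move=> x _; rewrite lee_fin dominator_ge0.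
- apply/disj_setPS => x [] /=; rewrite !in_itv/= => /andP[_ x1].
  by rewrite ltNge x1.
apply: lte_add_pinfty.
- apply: (@le_lt_trans _ _ (\int[mu]_(x in `]0%R, 1%R]) (2%R%:E * (x `^ (- s))%:E))%E).
    apply: ge0_le_integral => //.
    + by move=> x _; rewrite lee_fin dominator_ge0.
    + exact: md.
    + by apply: emeasurable_funM => //; apply/measurable_EFinP; exact: measurable_powRN.
    + move=> x; rewrite /= in_itv/= => /andP[x0 x1]; rewrite -EFinM lee_fin.
      rewrite /dominator -[leRHS]mulr1 ler_pM ?expR_ge0 ?addr_ge0 ?powR_ge0//.
        rewrite mulr2n mulrDl mul1r lerD2l.
        by rewrite -[leLHS](powRr0 x) ger_powR ?x0// oppr_le0.
      by rewrite expR_le1 oppr_le0 divr_ge0// ltW.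
  rewrite ge0_integralZl//; last 2 first.
  - by apply/measurable_EFinP; exact: measurable_powRN.
  - by move=> x _; rewrite lee_fin powR_ge0.
  by rewrite lte_mul_pinfty//; exact: integral_powRN_lty.
- apply: (@le_lt_trans _ _ (\int[mu]_(x in pos) (2%R%:E * (expR (- (x / 2)))%:E))%E).
    apply: (@le_trans _ _ (\int[mu]_(x in `]1%R, +oo[) (2%R%:E * (expR (- (x / 2)))%:E))%E).
      apply: ge0_le_integral => //.
      + by move=> x _; rewrite lee_fin dominator_ge0.
      + exact: md.
      + by apply: emeasurable_funM => //; apply/measurable_EFinP;
          apply: measurable_funTS; exact: measurable_expRN_half.
      + move=> x; rewrite /= in_itv/= andbT => x1; rewrite -EFinM lee_fin.
        rewrite /dominator ler_wpM2r ?expR_ge0// [leRHS](_ : 2 = 1 + 1)// lerD2r.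
        by rewrite -[leRHS](powRr0 x) ler_powR ?oppr_le0// ltW.
    apply: ge0_subset_integral => //.
    + by apply: emeasurable_funM => //; apply/measurable_EFinP;
          apply: measurable_funTS; exact: measurable_expRN_half.
    + by apply: subset_itvr; rewrite bnd_simp.
  rewrite ge0_integralZl//; last first.
    by apply/measurable_EFinP; apply: measurable_funTS; exact: measurable_expRN_half.
  by rewrite integral_expRN_half -EFinM ltry.
Qed.

(** Here [nu] is the integration variable and [x] either [nu] itself or the lattice point [p * n] to
    its right. The positive power of [x] is absorbed by half of the exponential; the other term has
    the negative exponent [r.-1 - kap], so [nu <= x] allows [x] to be replaced by [nu]. *)
Lemma gamma_weight_le_dominator (r k : nat) (kap : R) : (0 < r)%N ->
  r.-1%:R < kap -> exists2 C : R, 0 < C & forall nu x, 0 < nu -> nu <= x ->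
    x <= nu + 1 ->
    x ^+ r.-1 * (x ^+ k + x `^ (- kap)) * expR (- nu) <=
    C * dominator (kap - r.-1%:R) nu.
Proof.
move=> r0 rkap; pose m := (r.-1 + k)%N.
(* From [(nu + 1) ^ m = 2 ^ m * ((nu + 1) / 2) ^ m] and [y ^ m <= m! * exp y] at [y = (nu + 1) / 2];
   the extra half in [y] leaves the factor exp(1/2). *)
pose c := 2 ^+ m * (m`!%:R * expR (2^-1 : R)).
have c0 : 0 < c.
  by rewrite mulr_gt0 ?exprn_gt0// mulr_gt0 ?expR_gt0// ltr0n fact_gt0.
exists (c + 1) => [|nu x nu0 nux xnu]; first by rewrite addr_gt0.
have x0 : 0 < x by exact: lt_le_trans nux.
have half : expR (- nu) = expR (- (nu / 2)) * expR (- (nu / 2)).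
  by rewrite -expRD; congr expR; lra.
rewrite mulrDr mulrDl /dominator.
have le1 : x ^+ r.-1 * x ^+ k * expR (- nu) <= c * expR (- (nu / 2)).
  rewrite -exprD half mulrA ler_wpM2r ?expR_ge0//.
  rewrite expRN ler_pdivrMr ?expR_gt0//.
  apply: (@le_trans _ _ ((nu + 1) ^+ m)); first by rewrite lerXn2r ?nnegrE ?addr_ge0// ltW.
  have -> : nu + 1 = 2 * ((nu + 1) / 2) by rewrite mulrC divfK.
  rewrite exprMn /c -mulrA ler_wpM2l ?exprn_ge0//.
  rewrite -mulrA -expRD [X in expR X](_ : _ = (nu + 1) / 2); last by lra.
  by apply: expr_le_fact_expR; rewrite divr_ge0// addr_ge0// ltW.
have le2 : x ^+ r.-1 * x `^ (- kap) * expR (- nu) <=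
    nu `^ (- (kap - r.-1%:R)) * expR (- (nu / 2)).
  rewrite ler_pM ?expR_ge0 ?mulr_ge0 ?powR_ge0 ?exprn_ge0 ?(ltW x0)//; last first.
    by rewrite ler_expR; lra.
  rewrite -powR_mulrn ?(ltW x0)// -powRD; last by rewrite (gt_eqF x0) implybT.
  rewrite [X in x `^ X](_ : _ = - (kap - r.-1%:R)); last by rewrite opprB.
  rewrite !powRN lef_pV2 ?posrE ?powR_gt0//.
  by rewrite ge0_ler_powR ?nnegrE ?subr_ge0 ?(ltW rkap) ?(ltW nu0) ?(ltW x0).
apply: le_trans (lerD le1 le2) _.
rewrite -mulrDl mulrA ler_wpM2r ?expR_ge0//.
have := powR_ge0 nu (- (kap - r.-1%:R)).
set p := _ `^ _ => p0; rewrite mulrDr mulr1 mulrDl mul1r.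
rewrite -subr_ge0 [leRHS](_ : _ = c * p + 1); last by ring.
by rewrite addr_ge0// mulr_ge0// ltW.
Qed.

End domination.

(** * The asymptotic risk *)

Section eta_bar_theory.
Context {R : realType}.
Local Notation mu := (@lebesgue_measure R).
Local Notation pos := (`]0%R, +oo[%classic : set R).

(** The density of [nu / Omega] when [nu] has density [gamma_pdf r]. In this variable the argument
    of the loss is [u^-1], whatever [Omega] is. *)
Definition gamma_kernel (r : nat) (Omega u : R) : R := Omega * gamma_pdf r (Omega * u).

Lemma gamma_kernelE r (Omega u : R) : (0 < r)%N -> gamma_kernel r Omega u =
  Omega ^+ r / (r.-1)`!%:R * (u ^+ r.-1 * expR (- (Omega * u))).
Proof.
case: r => // r _; rewrite /gamma_kernel /gamma_pdf /= exprMn exprS.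
by ring.
Qed.

Lemma gamma_kernel_ge0 r (Omega u : R) : 0 <= Omega -> 0 <= u ->
  0 <= gamma_kernel r Omega u.
Proof. by move=> ? ?; rewrite mulr_ge0// gamma_pdf_ge0// mulr_ge0. Qed.

Lemma measurable_gamma_pdf r D : measurable_fun D (@gamma_pdf R r).
Proof.
apply: measurable_funTS; apply: continuous_measurable_fun.
exact: continuous_gamma_pdf.
Qed.

Lemma measurable_gamma_kernel r (Omega : R) D :
  measurable_fun D (gamma_kernel r Omega).
Proof.
apply: measurable_funTS; apply: measurable_funM => //.
exact: (measurableT_comp (@measurable_gamma_pdf r setT) (@mulrl_measurable R setT Omega)).
Qed.

Lemma integral_gamma_kernel r (Omega : R) : (0 < r)%N -> 0 < Omega ->
  (\int[mu]_(u in pos) (gamma_kernel r Omega u)%:E = 1)%E.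
Proof.
move=> r0 O0; rewrite -(integral_gamma_pdf r0) [RHS](ge0_integral_scaley O0); last 2 first.
- by apply/measurable_EFinP; exact: (@measurable_gamma_pdf r _).
- by move=> x /ltW x0; rewrite lee_fin gamma_pdf_ge0.
rewrite -[RHS]ge0_integralZl//.
- apply/measurable_EFinP; apply: measurable_funTS.
  exact: (measurableT_comp (@measurable_gamma_pdf r setT) (@mulrl_measurable R setT Omega)).
- move=> x; rewrite /= in_itv/= andbT => x0.
  by rewrite lee_fin gamma_pdf_ge0// mulr_ge0// ltW.
- by rewrite lee_fin ltW.
Qed.

(* Requiring [r.-1%:R < kap] is no loss, and keeps the exponent of [nu] in
   [dominator] negative. *)
Definition admissible (r : nat) (L : R -> R) : Prop :=
  [/\ measurable_fun setT L, forall x, 0 <= L x &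
    exists (k : nat) (kap A : R), [/\ r.-1%:R < kap, kap < r%:R, 0 < A &
      forall x, 0 < x -> L x <= A * (x ^- k + x `^ kap)]].

Variables (r : nat) (L : R -> R).
Hypothesis r0 : (0 < r)%N.
Hypothesis aL : admissible r L.

Lemma admissible_measurable : measurable_fun setT L. Proof. by case: aL. Qed.

Lemma admissible_ge0 x : 0 <= L x. Proof. by case: aL. Qed.

#[local] Hint Resolve admissible_measurable admissible_ge0 : core.

Lemma measurable_loss_div (Omega : R) D :
  measurable_fun D (fun nu : R => L (Omega / nu)).
Proof.
apply: measurable_funTS; apply: (measurableT_comp admissible_measurable).
by apply: measurable_funM => //; exact: measurable_inv.
Qed.

Lemma eta_bar_ge0 Omega : (0 <= eta_bar r L Omega)%E.
Proof.
apply: integral_ge0 => x; rewrite /= in_itv/= andbT => x0.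
by rewrite lee_fin mulr_ge0// gamma_pdf_ge0// ltW.
Qed.

Lemma eta_bar_kernel Omega : 0 < Omega -> eta_bar r L Omega =
  (\int[mu]_(u in pos) (gamma_kernel r Omega u * L u^-1)%:E)%E.
Proof.
move=> O0; rewrite /eta_bar.
rewrite (@ge0_integral_scaley _ Omega); last 3 first.
- by [].
- apply/measurable_EFinP; apply: measurable_funM; first exact: (@measurable_gamma_pdf r _).
  exact: measurable_loss_div.
- by move=> x /ltW x0; rewrite lee_fin mulr_ge0// gamma_pdf_ge0.
rewrite -ge0_integralZl//.
- apply: eq_integral => u _; rewrite -EFinM /gamma_kernel !mulrA.
  by rewrite invfM mulrA divff ?gt_eqF// mul1r.
- apply/measurable_EFinP; apply: measurable_funTS; apply: measurable_funM.
    exact: (measurableT_comp (@measurable_gamma_pdf r setT) (@mulrl_measurable R setT Omega)).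
  exact: (measurableT_comp (@measurable_loss_div Omega setT) (@mulrl_measurable R setT Omega)).
- move=> x; rewrite /= in_itv/= andbT => x0.
  by rewrite lee_fin mulr_ge0// gamma_pdf_ge0// mulr_ge0// ltW.
- by rewrite lee_fin ltW.
Qed.

Lemma measurable_kernel_loss Omega D :
  measurable_fun D (fun u : R => (gamma_kernel r Omega u * L u^-1)%:E).
Proof.
apply/measurable_EFinP; apply: measurable_funM; first exact: measurable_gamma_kernel.
by apply: measurable_funTS; exact: (measurableT_comp admissible_measurable measurable_inv).
Qed.

(** One majorant for two uses: [x = nu] gives the integrand of [eta_bar], and [x = p * n] the terms
    of the risk. At [Omega / x] the bound on [L] becomes, up to the factor [A],
    [a ^- k * x ^ k + b ^ kap * x ^ -kap] for all [Omega] in [[a, b]], and [kap < r] keeps the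
    singularity at 0 integrable. *)
Lemma loss_dominated (a b : R) : 0 < a -> exists W : R -> R,
  [/\ measurable_fun setT W, forall x, 0 <= W x,
    (\int[mu]_(nu in pos) (W nu)%:E < +oo)%E &
    forall nu x Omega, 0 < nu -> nu <= x -> x <= nu + 1 ->
      a <= Omega -> Omega <= b ->
      x ^+ r.-1 * L (Omega / x) * expR (- nu) <= W nu].
Proof.
move=> a0; have [_ _ [k [kap [A [rk kr A0 Lb]]]]] := aL.
have kap0 : 0 < kap by apply: le_lt_trans rk.
have [C C0 HC] := gamma_weight_le_dominator k r0 rk.
pose D := A * (a ^- k + b `^ kap) * C.
have D0 : 0 < D.
  rewrite mulr_gt0// mulr_gt0// ltr_wpDr ?powR_ge0//.
  by rewrite invr_gt0 exprn_gt0.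
exists (fun nu => D * dominator (kap - r.-1%:R) nu); split.
- by apply: measurable_funM => //; exact: measurable_dominator.
- by move=> x; rewrite mulr_ge0 ?(ltW D0)// dominator_ge0.
- under eq_integral do rewrite EFinM.
  rewrite ge0_integralZl//.
  + rewrite lte_mul_pinfty// ?lee_fin ?(ltW D0)//; apply: integral_dominator_lty.
      by rewrite subr_ge0 ltW.
    by rewrite ltrBlDr nat1r prednK.
  + by apply/measurable_EFinP; apply: measurable_funTS; exact: measurable_dominator.
  + by move=> x _; rewrite lee_fin dominator_ge0.
  + by rewrite lee_fin ltW.
move=> nu x Om nu0 nux xnu aO Ob.
have x0 : 0 < x := lt_le_trans nu0 nux.
have O0 : 0 < Om := lt_le_trans a0 aO.
rewrite /= /D -[leRHS]mulrA; apply: le_trans (ler_wpM2l _ (HC nu x nu0 nux xnu)); last first.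
  by rewrite mulr_ge0 ?(ltW A0)// addr_ge0 ?powR_ge0// invr_ge0 exprn_ge0// ltW.
rewrite !mulrA ler_wpM2r ?expR_ge0// [leRHS]mulrAC [leRHS]mulrC ler_wpM2l ?exprn_ge0 ?(ltW x0)//.
apply: (le_trans (Lb _ _)); first exact: divr_gt0.
rewrite -[leRHS]mulrA ler_wpM2l ?(ltW A0)//.
have h1 : (Om / x) ^- k <= a ^- k * x ^+ k.
  rewrite expr_div_n invfM invrK ler_wpM2r ?exprn_ge0 ?(ltW x0)//.
  by rewrite lef_pV2 ?posrE ?exprn_gt0// lerXn2r ?nnegrE ?(ltW a0) ?(ltW O0).
have h2 : (Om / x) `^ kap <= b `^ kap * x `^ (- kap).
  rewrite powRM ?(ltW O0) ?invr_ge0 ?(ltW x0)// -powR_inv1 ?(ltW x0)// -powRrM mulN1r.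
  rewrite ler_wpM2r ?powR_ge0// ge0_ler_powR ?(ltW kap0) ?nnegrE ?(ltW O0)//.
  exact: le_trans (ltW O0) Ob.
apply: le_trans (lerD h1 h2) _.
rewrite mulrDl !mulrDr -subr_ge0.
rewrite [leRHS](_ : _ = a ^- k * x `^ (- kap) + b `^ kap * x ^+ k); last by ring.
by rewrite addr_ge0// mulr_ge0 ?powR_ge0 ?invr_ge0 ?exprn_ge0// ltW.
Qed.

Lemma eta_bar_integrand_dominated (a b : R) : 0 < a -> exists W : R -> R,
  [/\ measurable_fun setT W, forall x, 0 <= W x,
    (\int[mu]_(nu in pos) (W nu)%:E < +oo)%E &
    forall nu Omega, 0 < nu -> a <= Omega -> Omega <= b ->
      gamma_pdf r nu * L (Omega / nu) <= W nu].
Proof.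
move=> a0; have [W [mW W0 Woo HW]] := loss_dominated b a0.
exists W; split => // nu Om nu0 aO Ob.
apply: le_trans (HW nu nu Om nu0 (lexx _) _ aO Ob); last by rewrite lerDl.
rewrite [leLHS](_ : _ = nu ^+ r.-1 * L (Om / nu) * expR (- nu) / (r.-1)`!%:R).
  rewrite ler_piMr ?mulr_ge0 ?expR_ge0 ?exprn_ge0 ?(ltW nu0)//.
  by rewrite invf_le1 ?ltr0n ?fact_gt0// ler1n fact_gt0.
by rewrite /gamma_pdf; ring.
Qed.

Lemma measurable_eta_bar_integrand Omega D :
  measurable_fun D (fun nu => (gamma_pdf r nu * L (Omega / nu))%:E).
Proof.
apply/measurable_EFinP; apply: measurable_funM; first exact: (@measurable_gamma_pdf r _).
exact: measurable_loss_div.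
Qed.

Lemma eta_bar_lty Omega : 0 < Omega -> (eta_bar r L Omega < +oo)%E.
Proof.
move=> O0; have [W [mW W0 Woo HW]] := eta_bar_integrand_dominated Omega O0.
apply: le_lt_trans Woo; apply: ge0_le_integral => //.
- move=> x; rewrite /= in_itv/= andbT => x0.
  by rewrite lee_fin mulr_ge0// gamma_pdf_ge0// ltW.
- exact: measurable_eta_bar_integrand.
- by apply/measurable_EFinP; apply: measurable_funTS.
- by move=> x; rewrite /= in_itv/= andbT => x0; rewrite lee_fin; exact: HW.
Qed.

Lemma eta_bar_fin_num Omega : 0 < Omega -> eta_bar r L Omega \is a fin_num.
Proof. by move=> O0; rewrite ge0_fin_numE ?eta_bar_ge0// eta_bar_lty. Qed.

Lemma eta_star_le Omega : 0 < Omega -> (eta_star r L <= eta_bar r L Omega)%E.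
Proof. by move=> O0; apply: ereal_inf_lbound; exists Omega. Qed.

Lemma eta_star_ge0 : (0 <= eta_star r L)%E.
Proof. by apply: le_ereal_inf_tmp => _ [Om _ <-]; exact: eta_bar_ge0. Qed.

Lemma eta_star_fin_num : eta_star r L \is a fin_num.
Proof.
rewrite ge0_fin_numE ?eta_star_ge0//.
by apply: (le_lt_trans (eta_star_le ltr01)); exact: eta_bar_lty.
Qed.

End eta_bar_theory.

(** * Small, bounded and extreme values of [Omega] *)

Section eta_bar_extrema.
Context {R : realType}.
Local Notation mu := (@lebesgue_measure R).
Local Notation pos := (`]0%R, +oo[%classic : set R).
Variables (r : nat) (L : R -> R).
Hypothesis r0 : (0 < r)%N.
Hypothesis aL : admissible r L.

#[local] Hint Resolve admissible_measurable admissible_ge0 : core.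

(** The bound is a constant plus a positive power, and the latter vanishes when the argument is
    scaled to 0. Beyond [xi] the negative power is at most [xi ^- k], which a multiple of [x ^ kap]
    absorbs. *)
Lemma loss_le_powR (xi c : R) : 0 < xi -> 0 <= c ->
  (forall x, 0 < x -> x < xi -> L x <= c) -> exists kap B : R,
  [/\ r.-1%:R < kap, kap < r%:R, 0 < B &
    forall x, 0 < x -> L x <= c + B * x `^ kap].
Proof.
move=> xi0 c0 Lc; have [_ _ [k [kap [A [rk kr A0 Lb]]]]] := aL.
have kap0 : 0 < kap by apply: le_lt_trans rk.
exists kap, (A * (xi ^- k * xi `^ (- kap) + 1)); split => //.
  by rewrite mulr_gt0// ltr_wpDl// mulr_ge0 ?powR_ge0// invr_ge0 exprn_ge0// ltW.
move=> x x0; have [xxi|xix] := ltP x xi.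
  apply: (le_trans (Lc _ x0 xxi)); rewrite lerDl !mulr_ge0 ?powR_ge0 ?(ltW A0)//.
  by rewrite addr_ge0// mulr_ge0 ?powR_ge0// invr_ge0 exprn_ge0// ltW.
apply: (le_trans (Lb _ x0)).
apply: (@le_trans _ _ (A * (xi ^- k * xi `^ (- kap) + 1) * x `^ kap)); last by rewrite lerDr.
rewrite -mulrA ler_wpM2l ?(ltW A0)// mulrDl mul1r lerD2r.
have h1 : x ^- k <= xi ^- k.
  by rewrite lef_pV2 ?posrE ?exprn_gt0// lerXn2r ?nnegrE ?(ltW x0) ?(ltW xi0).
apply: (le_trans h1); rewrite -mulrA ler_peMr ?invr_ge0 ?exprn_ge0 ?(ltW xi0)//.
rewrite powRN mulrC ler_pdivlMr ?powR_gt0// mul1r.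
by rewrite ge0_ler_powR ?(ltW kap0)// nnegrE ltW.
Qed.

(** By the bound [c + B * x ^ kap] on the loss, [eta_bar Omega] is at most [c + O(Omega ^ kap)], and
    [Omega] may be taken arbitrarily small. *)
Lemma eta_star_le_small_loss (xi c : R) : 0 < xi -> 0 <= c ->
  (forall x, 0 < x -> x < xi -> L x <= c) -> (eta_star r L <= c%:E)%E.
Proof.
move=> xi0 c0 Lc; have [kap [B [rk kr B0 HB]]] := loss_le_powR xi0 c0 Lc.
have kap0 : 0 < kap by apply: le_lt_trans rk.
have [C C0 HC] := gamma_weight_le_dominator 0 r0 rk.
pose s := kap - r.-1%:R.
have s0 : 0 <= s by rewrite subr_ge0 ltW.
have s1 : s < 1 by rewrite ltrBlDr nat1r prednK.
have [D D0 HD] : exists2 D : R, 0 < D &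
    (\int[mu]_(nu in pos) (dominator s nu)%:E <= D%:E)%E.
  have := integral_dominator_lty s0 s1.
  have : (0 <= \int[mu]_(nu in pos) (dominator s nu)%:E)%E.
    by apply: integral_ge0 => x _; rewrite lee_fin dominator_ge0.
  case: (integral _ _ _) => // d; rewrite lee_fin => d0 _.
  by exists (d + 1); rewrite ?lee_fin ?lerDl// ltr_wpDl.
have key (Om : R) : 0 < Om -> (eta_bar r L Om <= (c + B * Om `^ kap * C * D)%:E)%E.
  move=> O0; pose b := B * Om `^ kap * C.
  have b0 : 0 <= b by rewrite !mulr_ge0 ?powR_ge0// ltW.
  apply: (@le_trans _ _ (\int[mu]_(nu in pos)
    (c%:E * (gamma_pdf r nu)%:E + b%:E * (dominator s nu)%:E))%E).
    apply: ge0_le_integral => //.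
    - move=> x; rewrite /= in_itv/= andbT => x0.
      by rewrite lee_fin mulr_ge0 ?gamma_pdf_ge0 ?(ltW x0)//; apply: admissible_ge0 aL _.
    - by apply: measurable_eta_bar_integrand.
    - apply: emeasurable_funD; apply: emeasurable_funM => //; apply/measurable_EFinP.
        exact: (@measurable_gamma_pdf _ r _).
      by apply: measurable_funTS; exact: measurable_dominator.
    - move=> nu; rewrite /= in_itv/= andbT => nu0; rewrite -!EFinM -EFinD lee_fin.
      apply: (@le_trans _ _ (gamma_pdf r nu * (c + B * (Om / nu) `^ kap))).
        by rewrite ler_wpM2l ?gamma_pdf_ge0 ?(ltW nu0)//; apply: HB; rewrite divr_gt0.
      rewrite mulrDr mulrC lerD2l.
      rewrite powRM ?(ltW O0) ?invr_ge0 ?(ltW nu0)// -powR_inv1 ?(ltW nu0)// -powRrM mulN1r.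
      rewrite [leLHS](_ : _ = B * Om `^ kap * (gamma_pdf r nu * nu `^ (- kap))); last by ring.
      rewrite /b -[leRHS]mulrA ler_wpM2l ?mulr_ge0 ?powR_ge0 ?(ltW B0)//.
      apply: le_trans (HC nu nu nu0 (lexx _) _); last by rewrite lerDl.
      rewrite [leLHS](_ : _ = nu ^+ r.-1 * nu `^ (- kap) * expR (- nu) / (r.-1)`!%:R); last first.
        by rewrite /gamma_pdf; ring.
      apply: (@le_trans _ _ (nu ^+ r.-1 * nu `^ (- kap) * expR (- nu))).
        rewrite ler_piMr ?mulr_ge0 ?expR_ge0 ?exprn_ge0 ?powR_ge0 ?(ltW nu0)//.
        by rewrite invf_le1 ?ltr0n ?fact_gt0// ler1n fact_gt0.
      rewrite ler_wpM2r ?expR_ge0// ler_wpM2l ?exprn_ge0 ?(ltW nu0)//.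
      by rewrite expr0 lerDr.
  rewrite ge0_integralD//; last 4 first.
  - move=> x; rewrite /= in_itv/= andbT => x0.
    by rewrite mule_ge0// lee_fin gamma_pdf_ge0// ltW.
  - by apply: emeasurable_funM => //; apply/measurable_EFinP; exact: (@measurable_gamma_pdf _ r _).
  - by move=> x _; rewrite mule_ge0// lee_fin dominator_ge0.
  - by apply: emeasurable_funM => //; apply/measurable_EFinP;
        apply: measurable_funTS; exact: measurable_dominator.
  rewrite ge0_integralZl//; last 2 first.
  - by apply/measurable_EFinP; exact: (@measurable_gamma_pdf _ r _).
  - by move=> x; rewrite /= in_itv/= andbT => x0; rewrite lee_fin gamma_pdf_ge0// ltW.
  rewrite integral_gamma_pdf// mule1 EFinD leeD2lE// ge0_integralZl//; last 2 first.
  - by apply/measurable_EFinP; apply: measurable_funTS; exact: measurable_dominator.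
  - by move=> x _; rewrite lee_fin dominator_ge0.
  by rewrite -/b [leRHS]EFinM lee_wpmul2l ?lee_fin.
apply/lee_addgt0Pr => e e0.
(* Solves [B * Om ^ kap * C * D = e]. *)
pose Om := (e / (B * C * D)) `^ kap^-1.
have O0 : 0 < Om by rewrite powR_gt0// divr_gt0// !mulr_gt0.
apply: (le_trans (eta_star_le r L O0)); apply: (le_trans (key _ O0)).
rewrite -EFinD lee_fin lerD2l /Om -powRrM mulVf ?gt_eqF// powRr1; last first.
  by rewrite divr_ge0 ?mulr_ge0 ?ltW.
rewrite [leLHS](_ : _ = e)//; field.
by rewrite !gt_eqF.
Qed.

(** Up to the factor [Omega ^ r / (r-1)!], this is the integrand of [eta_bar] in the variable [u]:
    [eta_bar] is essentially the Laplace transform of [u ^ (r-1) * L (1 / u)]. *)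
Definition laplace_weight (Omega u : R) : R :=
  u ^+ r.-1 * expR (- (Omega * u)) * L u^-1.

Lemma laplace_weight_ge0 Omega u : 0 <= u -> 0 <= laplace_weight Omega u.
Proof.
by move=> u0; rewrite !mulr_ge0 ?expR_ge0 ?exprn_ge0//; apply: admissible_ge0 aL _.
Qed.

Lemma measurable_laplace_weight Omega D : measurable_fun D (laplace_weight Omega).
Proof.
apply: measurable_funTS; apply: measurable_funM; last first.
  exact: (measurableT_comp (admissible_measurable aL) measurable_inv).
apply: measurable_funM => //; apply: continuous_measurable_fun => x.
apply: (@continuous_comp _ _ _ (fun u => - (Omega * u)) expR); last exact: continuous_expR.
by apply: continuousN; apply: mulrl_continuous.
Qed.

Lemma eta_bar_laplace Omega : 0 < Omega -> eta_bar r L Omega =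
  ((Omega ^+ r / (r.-1)`!%:R)%:E *
   \int[mu]_(u in pos) (laplace_weight Omega u)%:E)%E.
Proof.
move=> O0; rewrite eta_bar_kernel// -ge0_integralZl//.
- apply: eq_integral => u _; rewrite -EFinM gamma_kernelE// /laplace_weight.
  by rewrite !mulrA.
- by apply/measurable_EFinP; exact: measurable_laplace_weight.
- by move=> u; rewrite /= in_itv/= andbT => u0; rewrite lee_fin laplace_weight_ge0// ltW.
- by rewrite lee_fin divr_ge0 ?exprn_ge0// ltW.
Qed.

Lemma integral_laplace_lty Omega : 0 < Omega ->
  (\int[mu]_(u in pos) (laplace_weight Omega u)%:E < +oo)%E.
Proof.
move=> O0; have := eta_bar_lty r0 aL O0; rewrite eta_bar_laplace//.
have c0 : 0 < Omega ^+ r / (r.-1)`!%:R by rewrite divr_gt0 ?exprn_gt0// ltr0n fact_gt0.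
have : (0 <= \int[mu]_(u in pos) (laplace_weight Omega u)%:E)%E.
  by apply: integral_ge0 => u; rewrite /= in_itv/= andbT => u0; rewrite lee_fin laplace_weight_ge0// ltW.
case: (integral _ _ _) => [x _ _||//]; first by rewrite ltry.
by rewrite gt0_muley ?lte_fin.
Qed.

Lemma integrable_laplace Omega : 0 < Omega ->
  mu.-integrable pos (EFin \o laplace_weight Omega).
Proof.
move=> O0; apply/integrableP; split.
  by apply/measurable_EFinP; exact: measurable_laplace_weight.
apply: le_lt_trans (integral_laplace_lty O0).
rewrite le_eqVlt; apply/orP; left; apply/eqP; apply: eq_integral => u /set_mem.
by rewrite /= in_itv/= andbT => u0; rewrite ger0_norm// laplace_weight_ge0// ltW.
Qed.

(** Dominated convergence in the Laplace form, where [Omega] enters the integral through a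
    decreasing exponential: the integrand at [Omega / 2] majorizes those at all nearby parameters,
    whatever the discontinuities of [L]. *)
Lemma continuous_eta_bar Omega : 0 < Omega ->
  {for Omega, continuous (fine \o eta_bar r L)}.
Proof.
move=> O0.
have O20 : 0 < Omega / 2 by rewrite divr_gt0.
have cJ : {in `](Omega / 2), (Omega + 1)[%classic, continuous
    (fun x => \int[mu]_(u in pos) laplace_weight x u)%R}.
  apply: (@continuity_under_integral _ _ _ mu laplace_weight pos _ _ _ _ _
    (laplace_weight (Omega / 2))) => //.
  - move=> x; rewrite /= in_itv/= => /andP[x1 _]; apply: integrable_laplace.
    exact: lt_trans x1.
  - apply: aeW => u _ x _.
    have cE : continuous (fun x : R => expR (- (x * u))).
      move=> y; apply: (@continuous_comp _ _ _ (fun x : R => - (x * u)) expR).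
        by apply: continuousN; apply: mulrr_continuous.
      exact: continuous_expR.
    apply: cvgM; last exact: cvg_cst.
    by apply: cvgM; [exact: cvg_cst | exact: cE].
  - exact: integrable_laplace.
  - move=> x; rewrite /= in_itv/= => /andP[x1 _]; apply: aeW => u.
    rewrite /= in_itv/= andbT => u0; rewrite ger0_norm ?laplace_weight_ge0 ?(ltW u0)//.
    rewrite ler_wpM2r ?(admissible_ge0 aL)// ler_wpM2l ?exprn_ge0 ?(ltW u0)//.
    by rewrite ler_expR lerN2 ler_wpM2r ?(ltW u0)// ltW.
have /cJ cJO : Omega \in `](Omega / 2), (Omega + 1)[%classic.
  by rewrite inE/= in_itv/= ltr_pdivrMr// ltr_pMr// ltr1n ltrDl ltr01.
have h : {for Omega, continuous (fun x : R => x ^+ r / (r.-1)`!%:R *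
    (\int[mu]_(u in pos) laplace_weight x u)%R)}.
  apply: cvgM; last exact: cJO.
  by apply: cvgM; [exact: exprn_continuous|exact: cvg_cst].
have E x : 0 < x -> fine (eta_bar r L x) =
    x ^+ r / (r.-1)`!%:R * (\int[mu]_(u in pos) laplace_weight x u)%R.
  move=> x0; rewrite eta_bar_laplace// fineM//.
  by rewrite integrable_fin_num//; exact: integrable_laplace.
move: h; rewrite /prop_for /continuous_at -E// => h.
apply: cvg_trans h; apply: near_eq_cvg; near=> x; rewrite /= E//.
by near: x; exact: lt_nbhsr.
Unshelve. all: by end_near. Qed.

(** With [nu = p * n], restricting [nu] to [[M^-1, M]] confines [p] to within a factor [M] of
    [1 / n], so that in an average over [p] in [[a, b]] each [n] well inside contributes a complete
    integral. *)
Definition eta_core (M Omega : R) : \bar R :=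
  (\int[mu]_(nu in `[M^-1%R, M]) (gamma_pdf r nu * L (Omega / nu))%:E)%E.

Lemma core_pos (M : R) : 1 < M -> `[M^-1, M]%classic `<=` pos.
Proof.
move=> M1 x /=; rewrite !in_itv/= andbT => /andP[+ _]; apply: lt_le_trans.
by rewrite invr_gt0 (lt_trans _ M1).
Qed.

Lemma eta_integrand_ge0 Omega nu : 0 <= nu -> 0 <= gamma_pdf r nu * L (Omega / nu).
Proof. by move=> nu0; rewrite mulr_ge0 ?gamma_pdf_ge0 ?(admissible_ge0 aL). Qed.

Lemma eta_core_le_eta_bar M Omega : 1 < M -> (eta_core M Omega <= eta_bar r L Omega)%E.
Proof.
move=> M1; apply: ge0_subset_integral => //.
- exact: (measurable_eta_bar_integrand aL).
- move=> x; rewrite /= in_itv/= andbT => x0.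
  by rewrite lee_fin eta_integrand_ge0// ltW.
- exact: core_pos.
Qed.

Lemma eta_core_mono M M' Omega : 1 < M -> M <= M' ->
  (eta_core M Omega <= eta_core M' Omega)%E.
Proof.
move=> M1 MM'; have M0 : 0 < M := lt_trans ltr01 M1.
apply: ge0_subset_integral => //.
- exact: (measurable_eta_bar_integrand aL).
- move=> x /(core_pos (lt_le_trans M1 MM')); rewrite /= in_itv/= andbT => x0.
  by rewrite lee_fin eta_integrand_ge0// ltW.
- apply: subset_itv; rewrite bnd_simp//.
  by rewrite lef_pV2 ?posrE ?(lt_le_trans M0).
Qed.

(** [M] does not depend on [Omega], because the integrands for [Omega] in [[a, b]] share an
    integrable majorant. *)
Lemma eta_bar_tail (a b e : R) : 0 < a -> 0 < e -> exists2 M, 1 < M &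
  forall Omega, a <= Omega -> Omega <= b ->
    (eta_bar r L Omega <= eta_core M Omega + e%:E)%E.
Proof.
move=> a0 e0; have [W [mW W0 Woo HW]] := eta_bar_integrand_dominated r0 aL b a0.
have mWpos : measurable_fun pos W by exact: measurable_funTS.
have [M M1 HM] := integral_tail mWpos (fun x _ => W0 x) Woo e0.
exists M => // Omega aO Ob.
rewrite /eta_bar -[in leLHS](setDUK (core_pos M1)) ge0_integral_setU//=.
- rewrite leeD2l//; apply: le_trans HM; apply: ge0_le_integral.
  + exact: measurableD.
  + move=> x []; rewrite /= in_itv/= andbT => x0 _.
    by rewrite lee_fin eta_integrand_ge0// ltW.
  + exact: (measurable_eta_bar_integrand aL).
  + by apply/measurable_EFinP; exact: measurable_funTS.
  + by move=> x []; rewrite /= in_itv/= andbT => x0 _; rewrite lee_fin; exact: HW.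
- exact: measurableD.
- exact: (measurable_eta_bar_integrand aL).
- move=> x [/(core_pos M1)|[]]; rewrite /= in_itv/= andbT => x0.
    by rewrite lee_fin eta_integrand_ge0// ltW.
  by move=> _; rewrite lee_fin eta_integrand_ge0// ltW.
- by apply/disj_setPS => x [Fx []].
Qed.

Lemma gamma_core (c c' : R) : 0 <= c -> c < c' -> exists2 M, 1 < M &
  (c%:E <= c'%:E * \int[mu]_(nu in `[M^-1%R, M]) (gamma_pdf r nu)%:E)%E.
Proof.
move=> c0 cc'; have c'0 : 0 < c' := le_lt_trans c0 cc'.
have mg : measurable_fun pos (@gamma_pdf R r) by exact: (@measurable_gamma_pdf _ r _).
have g0 x : 0 < x -> 0 <= gamma_pdf r x :> R by move=> x0; rewrite gamma_pdf_ge0// ltW.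
have goo : (\int[mu]_(x in pos) (gamma_pdf r x)%:E < +oo)%E.
  by rewrite integral_gamma_pdf// ltry.
(* A tail of mass at most [1 - c / c'] leaves mass at least [c / c'] in the core. *)
have e0 : 0 < 1 - c / c' by rewrite subr_gt0 ltr_pdivrMr// mul1r.
have [M M1 HM] := integral_tail mg g0 goo e0.
exists M => //.
have := integral_gamma_pdf r0 (R := R).
rewrite -(setDUK (core_pos M1)) ge0_integral_setU//=; last 4 first.
- exact: measurableD.
- by apply/measurable_EFinP; exact: (@measurable_gamma_pdf _ r _).
- move=> x [/(core_pos M1)|[]]; rewrite /= in_itv/= andbT => x0.
    by rewrite lee_fin g0.
  by move=> _; rewrite lee_fin g0.
- by apply/disj_setPS => x [Fx []].
have : (0 <= \int[mu]_(nu in `[M^-1%R, M]) (gamma_pdf r nu)%:E)%E.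
  by apply: integral_ge0 => x /(core_pos M1); rewrite /= in_itv/= andbT lee_fin => /g0.
have : (0 <= \int[mu]_(nu in pos `\` `[M^-1%R, M]) (gamma_pdf r nu)%:E)%E.
  by apply: integral_ge0 => x []; rewrite /= in_itv/= andbT lee_fin => /g0.
move: HM; case: (integral _ (_ `\` _) _) => [y| |]; case: (integral _ _ _) => [x| |]//.
rewrite !lee_fin => yc y0 x0 [xy].
rewrite mulrC -ler_pdivrMr//; lra.
Qed.

Lemma eta_core_ge M c Omega : 1 < M -> 0 <= c ->
  (forall nu, M^-1 <= nu -> nu <= M -> c <= L (Omega / nu)) ->
  (c%:E * \int[mu]_(nu in `[M^-1%R, M]) (gamma_pdf r nu)%:E <= eta_core M Omega)%E.
Proof.
move=> M1 c0 Lc; have g0 x : `[M^-1, M]%classic x -> 0 <= gamma_pdf r x :> R.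
  by move=> /(core_pos M1); rewrite /= in_itv/= andbT => x0; rewrite gamma_pdf_ge0// ltW.
rewrite -ge0_integralZl//.
- apply: ge0_le_integral => //.
  + by move=> x /g0 ?; rewrite -EFinM lee_fin mulr_ge0.
  + by apply: emeasurable_funM => //; apply/measurable_EFinP; exact: (@measurable_gamma_pdf _ r _).
  + exact: (measurable_eta_bar_integrand aL).
  + move=> x xM; rewrite -EFinM lee_fin mulrC ler_wpM2l ?g0//.
    by move: xM; rewrite /= in_itv/= => /andP[? ?]; exact: Lc.
- by apply/measurable_EFinP; exact: (@measurable_gamma_pdf _ r _).
Qed.

(** On the core [nu] varies by a factor [M] either way, so such an [Omega] keeps [Omega / nu] in the
    region where [L >= c] for every [nu] at once. *)
Lemma eta_core_ge_outside M c delta Delta Omega : 1 < M -> 0 <= c ->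
  (forall x, 0 < x -> x < delta -> c <= L x) ->
  (forall x, Delta < x -> c <= L x) ->
  0 < Omega -> Omega < delta / M \/ Delta * M < Omega ->
  (c%:E * \int[mu]_(nu in `[M^-1%R, M]) (gamma_pdf r nu)%:E <= eta_core M Omega)%E.
Proof.
move=> M1 c0 Hd HD O0 HO; apply: eta_core_ge => // nu Mnu nuM.
have M0 : 0 < M := lt_trans ltr01 M1.
have nu0 : 0 < nu by apply: lt_le_trans Mnu; rewrite invr_gt0.
case: HO => HO; [apply: Hd; first exact: divr_gt0 | apply: HD].
- rewrite ltr_pdivrMr//; apply: (lt_le_trans HO).
  have d0 : 0 < delta.
    by have := lt_trans O0 HO; rewrite pmulr_lgt0// invr_gt0.
  by rewrite ler_wpM2l// ltW.
(* The sign of [Delta] is free: if it is negative, [Delta * nu < 0 < Omega]. *)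
- rewrite ltr_pdivlMr//; have [D0|D0] := leP 0 Delta.
    by apply: le_lt_trans HO; rewrite ler_wpM2l.
  by apply: lt_trans O0; rewrite nmulr_rlt0.
Qed.

(* The uniform version of [c < eta_star] that truncation of [nu] requires. *)
Lemma eta_core_uniform (c c' delta Delta : R) : 0 <= c -> c < c' ->
  (c'%:E <= eta_star r L)%E -> 0 < delta ->
  (forall x, 0 < x -> x < delta -> c' <= L x) ->
  (forall x, Delta < x -> c' <= L x) ->
  exists2 M, 1 < M & forall Omega, 0 < Omega -> (c%:E <= eta_core M Omega)%E.
Proof.
move=> c0 cc' c'eta d0 Hd HD; have c'0 : 0 <= c' := le_trans c0 (ltW cc').
(* [M1] settles the extreme [Omega] and thereby fixes the compact range on which [M2] is chosen. *)
have [M1 M11 HM1] := gamma_core c0 cc'.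
have M10 : 0 < M1 := lt_trans ltr01 M11.
have dM0 : 0 < delta / M1 by rewrite divr_gt0.
have cc'0 : 0 < c' - c by rewrite subr_gt0.
have [M2 M21 HM2] := eta_bar_tail (Delta * M1) dM0 cc'0.
exists (Num.max M1 M2); first by rewrite lt_max M11.
move=> Omega O0; have [Od|dO] := ltP Omega (delta / M1).
  apply: le_trans (eta_core_mono _ M11 _); last by rewrite le_max lexx.
  apply: (le_trans HM1); apply: (eta_core_ge_outside M11 c'0 Hd HD O0).
  by left.
have [DO|OD] := ltP (Delta * M1) Omega.
  apply: le_trans (eta_core_mono _ M11 _); last by rewrite le_max lexx.
  apply: (le_trans HM1); apply: (eta_core_ge_outside M11 c'0 Hd HD O0).
  by right.
apply: le_trans (eta_core_mono _ M21 _); last by rewrite le_max lexx orbT.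
have := le_trans (le_trans c'eta (eta_star_le r L O0)) (HM2 _ dO OD).
by rewrite -leeBlDr// -EFinB opprB addrC subrK.
Qed.

End eta_bar_extrema.

(** * Comparisons at large and at small [Omega], and attainment of the minimum *)

Section eta_bar_minimum.
Context {R : realType}.
Local Notation mu := (@lebesgue_measure R).
Local Notation pos := (`]0%R, +oo[%classic : set R).

(** An inequality between differences, with every term moved to the side where it is non-negative:
    only non-negative integrals occur, and infinite values need no separate treatment. *)
Lemma ge0_le_integralD_in (I1 I2 : set R) (f1 f2 g1 g2 : R -> R) :
  measurable I1 -> I1 `<=` pos -> measurable I2 -> I2 `<=` pos ->
  measurable_fun setT f1 -> measurable_fun setT f2 ->
  measurable_fun setT g1 -> measurable_fun setT g2 ->
  (forall u, 0 < u -> [/\ 0 <= f1 u, 0 <= f2 u, 0 <= g1 u & 0 <= g2 u]) ->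
  (forall u, 0 < u -> f1 u + f2 u * \1_I1 u <= g1 u + g2 u * \1_I2 u) ->
  (\int[mu]_(u in pos) (f1 u)%:E + \int[mu]_(u in I1) (f2 u)%:E <=
   \int[mu]_(u in pos) (g1 u)%:E + \int[mu]_(u in I2) (g2 u)%:E)%E.
Proof.
move=> mI1 I1p mI2 I2p mf1 mf2 mg1 mg2 ge0 le.
have restr (J : set R) (f : R -> R) : measurable J -> J `<=` pos ->
    (\int[mu]_(u in J) (f u)%:E = \int[mu]_(u in pos) (f u * \1_J u)%:E)%E.
  move=> mJ Jp; rewrite -[in LHS](setIidr Jp) integral_mkcondr.
  apply: eq_integral => u _; rewrite patchE indicE.
  by case: ifPn => _; rewrite ?mulr1// mulr0.
have mind (J : set R) (f : R -> R) : measurable J -> measurable_fun setT f ->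
    measurable_fun pos (fun u => (f u * \1_J u)%:E).
  move=> mJ mf; apply/measurable_EFinP; apply: measurable_funTS.
  by apply: measurable_funM => //; exact: measurable_indic.
have mpos (f : R -> R) : measurable_fun setT f ->
    measurable_fun pos (fun u => (f u)%:E).
  by move=> mf; apply/measurable_EFinP; exact: measurable_funTS.
have posP u : pos u -> 0 < u by rewrite /= in_itv/= andbT.
have ind0 (f : R -> R) (J : set R) u : 0 <= f u -> (0 <= (f u * \1_J u)%:E)%E.
  by move=> fu; rewrite lee_fin mulr_ge0.
rewrite (restr I1)// (restr I2)//.
rewrite -(@ge0_integralD _ _ _ mu pos _ (fun u => (f1 u)%:E) (fun u => (f2 u * \1_I1 u)%:E))//; first last.
- exact: mind.
- by move=> u /posP/ge0[_ + _ _]; exact: ind0.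
- exact: mpos.
- by move=> u /posP/ge0[? _ _ _]; rewrite lee_fin.
rewrite -(@ge0_integralD _ _ _ mu pos _ (fun u => (g1 u)%:E) (fun u => (g2 u * \1_I2 u)%:E))//; first last.
- exact: mind.
- by move=> u /posP/ge0[_ _ _]; exact: ind0.
- exact: mpos.
- by move=> u /posP/ge0[_ _ ? _]; rewrite lee_fin.
apply: ge0_le_integral => //.
- move=> u /posP/ge0[? ? _ _]; rewrite adde_ge0//; last exact: ind0.
- by apply: emeasurable_funD; [exact: mpos | exact: mind].
- by apply: emeasurable_funD; [exact: mpos | exact: mind].
- by move=> u /posP u0; rewrite -!EFinD lee_fin; exact: le.
Qed.

Variables (r : nat) (L : R -> R).
Hypothesis r0 : (0 < r)%N.
Hypothesis aL : admissible r L.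

Let L0 : forall x, 0 <= L x. Proof. exact: admissible_ge0 aL. Qed.

(* As [Omega] grows the kernel concentrates, relative to its mass beyond
   [a^-1], on the values of [u = 1 / x] with [x > a]. *)
Lemma eta_bar_lt_large (a b l c : R) : 0 < a -> a < b -> 0 <= l -> l < c ->
  (forall x, a < x -> x < b -> L x <= l) -> (forall x, b <= x -> L x <= c) ->
  exists2 Omega, 0 < Omega & (eta_bar r L Omega < c%:E)%E.
Proof.
move=> a0 ab l0 lc Ll Lc; apply: contrapT => H.
have {}H Om : 0 < Om -> (c%:E <= eta_bar r L Om)%E.
  by move=> O0; rewrite leNgt; apply/negP => h; apply: H; exists Om.
have b0 : 0 < b := lt_trans a0 ab.
have c0 : 0 <= c := le_trans l0 (ltW lc).
(* In the variable [u = 1 / x] the dip is [(be, al)] and the region without control is [u >= al].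
   Only the half [(be, ga)] of the dip is used: up to a common power of [Om], its kernel mass is at
   least of order exp(-Om * ga), which outweighs exp(-Om * al). *)
pose al := a^-1; pose be := b^-1; pose ga := (al + be) / 2.
have be0 : 0 < be by rewrite invr_gt0.
have beal : be < al by rewrite ltf_pV2.
have bega : be < ga by rewrite /ga; lra.
have gaal : ga < al by rewrite /ga; lra.
have E1fin := eta_bar_fin_num r0 aL (ltr01 : 0 < (1 : R)).
pose E1 := fine (eta_bar r L 1).
have E10 : 0 <= E1 by rewrite fine_ge0// (eta_bar_ge0 aL).
pose d := (c - l) * ((ga - be) * (be ^+ r.-1 / (r.-1)`!%:R)).
have d0 : 0 < d.
  rewrite mulr_gt0 ?subr_gt0// mulr_gt0 ?subr_gt0// divr_gt0 ?exprn_gt0//.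
(* The deficit collected on the dip cannot exceed what the region [u >= al] adds; both carry the
   factor [Om ^ r], which is cancelled. *)
have key Om : 1 <= Om -> d * expR (- (Om * ga)) <= expR (- ((Om - 1) * al)) * E1.
  move=> O1; have O0 : 0 < Om := lt_le_trans ltr01 O1.
  pose K := gamma_kernel r Om.
  have K0 u : 0 < u -> 0 <= K u by move=> u0; apply: gamma_kernel_ge0; exact: ltW.
  have mK D : measurable_fun D (fun u => (K u)%:E).
    by apply/measurable_EFinP; exact: measurable_gamma_kernel.
  have mcK e D : measurable_fun D (fun u => (e * K u)%:E).
    by apply/measurable_EFinP; apply: measurable_funM => //; exact: measurable_gamma_kernel.
  have mKL D : measurable_fun D (fun u => (K u * L u^-1)%:E).
    exact: measurable_kernel_loss aL _ _.
  pose I1 := (`]be, ga[%classic : set R).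
  pose I2 := (`[al, +oo[%classic : set R).
  have pos1 : I1 `<=` pos.
    by move=> u; rewrite /I1 /= !in_itv/= andbT => /andP[+ _]; apply: lt_trans.
  have pos2 : I2 `<=` pos.
    by move=> u; rewrite /I2 /= !in_itv/= !andbT; apply: lt_le_trans; rewrite invr_gt0.
  have ineq : (eta_bar r L Om + \int[mu]_(u in I1) ((c - l) * K u)%:E <=
      c%:E + \int[mu]_(u in I2) (K u * L u^-1)%:E)%E.
    have -> : (c%:E = \int[mu]_(u in pos) (c * K u)%:E)%E.
      under eq_integral do rewrite EFinM.
      rewrite ge0_integralZl//.
      - by rewrite integral_gamma_kernel// mule1.
      - exact: mK.
      - by move=> u; rewrite /= in_itv/= andbT lee_fin => /K0.
    rewrite eta_bar_kernel//; apply: ge0_le_integralD_in => //.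
    - exact: measurable_itv.
    - exact: measurable_itv.
    - by apply/measurable_EFinP; exact: mKL.
    - by apply/measurable_EFinP; exact: mcK.
    - by apply/measurable_EFinP; exact: mcK.
    - by apply/measurable_EFinP; exact: mKL.
    - move=> u /K0 Ku; have cl : 0 <= c - l by rewrite subr_ge0 ltW.
      by split; rewrite mulr_ge0.
    move=> u u0; have Ku := K0 u u0; have Lu := L0 u^-1.
    have small : u <= be -> L u^-1 <= c.
      by move=> ube; apply: Lc; rewrite -(invrK b) lef_pV2 ?posrE.
    have mid : be < u -> u < al -> L u^-1 <= l.
      move=> beu ual; apply: Ll.
        by rewrite -(invrK a) ltf_pV2 ?posrE ?invr_gt0.
      by rewrite -(invrK b) ltf_pV2 ?posrE.
    rewrite -?[gamma_kernel r Om u]/(K u) !indicE [u \in I1](_ : _ = (be < u < ga)); last first.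
      by apply/idP/idP => [/set_mem|?]; [|apply/mem_set]; rewrite /I1 /= in_itv.
    rewrite [u \in I2](_ : _ = (al <= u)); last first.
      by apply/idP/idP => [/set_mem|?]; [|apply/mem_set]; rewrite /I2 /= in_itv/= andbT.
    have [ual|ual] := leP al u.
      rewrite [u < ga]ltNge (ltW (lt_le_trans gaal ual)) andbF mulr0 addr0 mulr1.
      by rewrite lerDr mulr_ge0.
    rewrite mulr0 addr0; have [beu|ube] := ltP be u; last first.
      by rewrite mulr0 addr0 mulrC ler_wpM2r// small.
    have Ll1 := mid beu ual; rewrite /=; have [_|_] := ltP u ga.
      rewrite mulr1 -subr_ge0 (_ : _ - _ = K u * (l - L u^-1)); last by ring.
      by rewrite mulr_ge0// subr_ge0.
    by rewrite mulr0 addr0 mulrC ler_wpM2r// (le_trans Ll1)// ltW.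
  have fin2 : (\int[mu]_(u in I2) (K u * L u^-1)%:E <=
      (Om ^+ r * expR (- ((Om - 1) * al)) * E1)%:E)%E.
    (* For [u >= al], [exp(-Om * u) <= exp(-(Om - 1) * al) * exp(-u)]: the integral is compared with
       [eta_bar] at 1, known to be finite. *)
    have h1 u : al <= u -> K u * L u^-1 <=
        Om ^+ r * expR (- ((Om - 1) * al)) * (gamma_kernel r 1 u * L u^-1).
      move=> alu; have u0 : 0 < u by apply: lt_le_trans alu; rewrite invr_gt0.
      rewrite /K !gamma_kernelE// expr1n mul1r mul1r.
      rewrite [leLHS](_ : _ =
          Om ^+ r * (expR (- (Om * u)) * (u ^+ r.-1 / (r.-1)`!%:R * L u^-1))); last by ring.
      rewrite [leRHS](_ : _ = Om ^+ r * (expR (- ((Om - 1) * al)) * expR (- u) *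
        (u ^+ r.-1 / (r.-1)`!%:R * L u^-1))); last by ring.
      rewrite ler_wpM2l ?exprn_ge0 ?(ltW O0)// ler_wpM2r//.
        by rewrite mulr_ge0// divr_ge0// exprn_ge0// ltW.
      by rewrite -expRD ler_expR; nra.
    have k0 : 0 <= Om ^+ r * expR (- ((Om - 1) * al)).
      by rewrite mulr_ge0 ?expR_ge0// exprn_ge0// ltW.
    rewrite EFinM /E1 fineK// eta_bar_kernel// -ge0_integralZl//; first last.
    - by move=> u; rewrite /= in_itv/= andbT => u0; rewrite lee_fin mulr_ge0// gamma_kernel_ge0// ltW.
    - exact: measurable_kernel_loss aL _ _.
    apply: (@le_trans _ _ (\int[mu]_(u in I2) ((Om ^+ r * expR (- ((Om - 1) * al)))%:E *
        (gamma_kernel r 1 u * L u^-1)%:E))%E).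
      apply: ge0_le_integral => //.
      - exact: measurable_itv.
      - by move=> u /pos2; rewrite /= in_itv/= andbT => /K0 ?; rewrite lee_fin mulr_ge0.
      - exact: mKL.
      - by apply: emeasurable_funM => //; exact: measurable_kernel_loss aL _ _.
      - by move=> u; rewrite /I2 /= in_itv/= andbT => alu; rewrite -EFinM lee_fin h1.
    apply: ge0_subset_integral => //.
    - exact: measurable_itv.
    - by apply: emeasurable_funM => //; exact: measurable_kernel_loss aL _ _.
    - move=> u; rewrite /= in_itv/= andbT => u0.
      by rewrite -EFinM lee_fin mulr_ge0// mulr_ge0// gamma_kernel_ge0// ltW.
  have fin1 : ((Om ^+ r * (d * expR (- (Om * ga))))%:E <=
      \int[mu]_(u in I1) ((c - l) * K u)%:E)%E.
    have -> : (Om ^+ r * (d * expR (- (Om * ga))))%:E =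
      (\int[mu]_(u in I1) (Om ^+ r * ((c - l) * (be ^+ r.-1 / (r.-1)`!%:R)) * expR (- (Om * ga)))%:E)%E.
      rewrite integral_cst; last exact: measurable_itv.
      rewrite /= /I1 lebesgue_measure_itv/= lte_fin bega -EFinB -EFinM; congr (_%:E).
      by rewrite /d; ring.
    have cl : 0 <= c - l by rewrite subr_ge0 ltW.
    apply: ge0_le_integral => //.
    - exact: measurable_itv.
    - by move=> u _; rewrite lee_fin !mulr_ge0 ?expR_ge0 ?exprn_ge0 ?(ltW O0) ?(ltW be0).
    - exact: mcK.
    - move=> u; rewrite /I1 /= in_itv/= => /andP[beu uga]; rewrite lee_fin /K gamma_kernelE//.
      have u0 : 0 < u := lt_trans be0 beu.
      rewrite [leRHS](_ : _ =
          Om ^+ r * ((c - l) * (u ^+ r.-1 / (r.-1)`!%:R)) * expR (- (Om * u))); last by ring.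
      apply: ler_pM; rewrite ?expR_ge0 ?mulr_ge0 ?exprn_ge0 ?(ltW O0) ?(ltW be0)//.
        rewrite ler_wpM2l ?exprn_ge0 ?(ltW O0)// ler_wpM2l// ler_wpM2r//.
        by rewrite lerXn2r ?nnegrE ?(ltW be0) ?(ltW u0) ?(ltW beu).
      by rewrite ler_expR lerN2 ler_wpM2l ?(ltW O0) ?(ltW uga).
  have : ((Om ^+ r * (d * expR (- (Om * ga))))%:E <=
      (Om ^+ r * expR (- ((Om - 1) * al)) * E1)%:E)%E.
    apply: (le_trans fin1); apply: le_trans fin2.
    rewrite -(@leeD2lE _ c%:E)//; apply: le_trans ineq.
    by rewrite leeD2r// H.
  by rewrite lee_fin -mulrA ler_pM2l// exprn_gt0.
(* Makes [Om * (al - ga)] larger than [exp(al) * E1 / d]; then [1 + y <= exp y] contradicts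
   [key]. *)
pose Om := 1 + expR al * E1 / d / (al - ga).
have alga : 0 < al - ga by rewrite subr_gt0.
have O1 : 1 <= Om.
  rewrite /Om lerDl divr_ge0 ?(ltW alga)// divr_ge0 ?(ltW d0)//.
  by rewrite mulr_ge0 ?expR_ge0.
have := key _ O1; rewrite leNgt => /negP; apply.
have -> : - ((Om - 1) * al) = al + - (Om * (al - ga)) + - (Om * ga) by ring.
rewrite expRD mulrAC ltr_pM2r ?expR_gt0// expRD expRN mulrAC ltr_pdivrMr ?expR_gt0//.
rewrite -ltr_pdivrMl// mulrC.
apply: lt_le_trans (expR_ge1Dx _).
rewrite /Om mulrDl mul1r [X in 1 + (_ + X)]divfK ?gt_eqF//.
by rewrite addrA ltrDr addr_gt0.
Qed.

(** Let [Omega] tend to 0. Since [L <= m] on [(0, xi]], the values [u >= 1 / xi] contribute at most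
    [m] times their mass, so the lower bound on [eta_bar] makes the integral of the kernel times
    [m - L (1 / u)] over [u < 1 / xi] non-positive. Divided by [Omega ^ r], the kernel tends to a
    multiple of [u ^ (r-1)], and [x = 1 / u] turns this weight into [x ^ -(r+1)]; finally
    [L xi <= m]. *)
Lemma loss_deficit_le0 (xi m : R) : 0 < xi -> 0 <= m ->
  (forall Omega, 0 < Omega -> (m%:E <= eta_bar r L Omega)%E) ->
  (forall x, 0 < x -> x <= xi -> L x <= m) ->
  (\int[mu]_(x in `]xi, +oo[) ((L xi - L x) / x ^+ r.+1)%:E <= 0)%E.
Proof.
move=> xi0 m0 HE Hm; pose I := (`]0, xi^-1[%classic : set R).
have xiV0 : 0 < xi^-1 by rewrite invr_gt0.
have Ipos : I `<=` pos.
  by move=> u; rewrite /I /= !in_itv/= andbT => /andP[].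
have mI : measurable I by exact: measurable_itv.
have mLV D : measurable_fun D (fun u : R => L u^-1).
  apply: measurable_funTS.
  exact: (measurableT_comp (admissible_measurable aL) measurable_inv).
have mX D : measurable_fun D (fun u : R => u ^+ r.-1).
  by apply: measurable_funTS; exact: exprn_measurable.
pose w1 (u : R) := u ^+ r.-1; pose w2 (u : R) := L u^-1 * u ^+ r.-1.
have w10 u : 0 <= u -> 0 <= w1 u by move=> u0; rewrite exprn_ge0.
have w20 u : 0 <= u -> 0 <= w2 u by move=> u0; rewrite mulr_ge0// exprn_ge0.
have mw2 D : measurable_fun D w2 by apply: measurable_funM; [exact: mLV | exact: mX].
(* On this bounded range [exp(-u)] is bounded below, so the weights without exponential inherit
   integrability from the Laplace integrand and from the gamma density. *)
have expI u : I u -> 1 <= expR xi^-1 * expR (- u).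
  rewrite /I /= in_itv/= => /andP[_ uxi]; rewrite -expRD -[leLHS]expR0 ler_expR.
  by rewrite subr_ge0 ltW.
have iw2 : mu.-integrable I (EFin \o w2).
  apply: (@le_integrable _ _ _ mu I _ _
    (fun u => (expR xi^-1)%:E * (laplace_weight r L 1 u)%:E)%E) => //.
  - by apply/measurable_EFinP; exact: mw2.
  - move=> u Iu; have u0 : 0 < u by have := Ipos u Iu; rewrite /= in_itv/= andbT.
    rewrite /= lee_fin !ger0_norm ?mulr_ge0 ?expR_ge0 ?exprn_ge0 ?(ltW u0)//.
    rewrite /laplace_weight mul1r /w2.
    rewrite [leRHS](_ : _ = (expR xi^-1 * expR (- u)) * (L u^-1 * u ^+ r.-1)); last by ring.
    by rewrite ler_peMl ?expI// mulr_ge0// exprn_ge0// ltW.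
  - apply: integrableZl => //; apply: (@integrableS _ _ _ mu pos I) => //.
    exact: integrable_laplace.
have iw1 : mu.-integrable I (EFin \o w1).
  apply: (@le_integrable _ _ _ mu I _ _
    (fun u => (expR xi^-1 * (r.-1)`!%:R)%:E * (gamma_pdf r u)%:E)%E) => //.
  - by apply/measurable_EFinP; exact: mX.
  - move=> u Iu; have u0 : 0 < u by have := Ipos u Iu; rewrite /= in_itv/= andbT.
    rewrite /= lee_fin !ger0_norm ?mulr_ge0 ?gamma_pdf_ge0 ?expR_ge0 ?w10 ?(ltW u0)//.
    rewrite /gamma_pdf /w1.
    rewrite [leRHS](_ : _ = (expR xi^-1 * expR (- u)) * u ^+ r.-1); last first.
      by field; rewrite pnatr_eq0 -lt0n fact_gt0.
    by rewrite ler_peMl ?expI// exprn_ge0// ltW.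
  - apply: integrableZl => //; apply: (@integrableS _ _ _ mu pos I) => //.
    apply/integrableP; split.
      by apply/measurable_EFinP; exact: (@measurable_gamma_pdf _ r _).
    rewrite (_ : integral _ _ _ = 1%E) ?ltry// -(integral_gamma_pdf r0).
    apply: eq_integral => u /set_mem; rewrite /= in_itv/= andbT => u0.
    by rewrite ger0_norm// gamma_pdf_ge0// ltW.
have Pfin : (\int[mu]_(u in I) (w1 u)%:E)%E \is a fin_num.
  by apply: integrable_fin_num.
have Qfin : (\int[mu]_(u in I) (w2 u)%:E)%E \is a fin_num.
  by apply: integrable_fin_num.
pose P := fine (\int[mu]_(u in I) (w1 u)%:E)%E.
pose Q := fine (\int[mu]_(u in I) (w2 u)%:E)%E.
have P0 : 0 <= P.
  apply: fine_ge0; apply: integral_ge0 => u /Ipos.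
  by rewrite /= in_itv/= andbT => u0; rewrite lee_fin w10// ltW.
(* In place of a passage to the limit, the exponential is bounded below by its value at [1 / xi] on
   one side and above by 1 on the other. *)
have key Om : 0 < Om -> m * expR (- (Om * xi^-1)) * P <= Q.
  move=> O0; pose K := gamma_kernel r Om; pose b := Om ^+ r / (r.-1)`!%:R.
  have b0 : 0 < b by rewrite divr_gt0 ?exprn_gt0// ltr0n fact_gt0.
  have KE u : K u = b * (u ^+ r.-1 * expR (- (Om * u))) by exact: gamma_kernelE.
  have K0 u : 0 < u -> 0 <= K u by move=> u0; apply: gamma_kernel_ge0; exact: ltW.
  have mK D : measurable_fun D (fun u => m * K u).
    by apply: measurable_funM => //; exact: measurable_gamma_kernel.
  have mKL D : measurable_fun D (fun u => K u * L u^-1).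
    by apply/measurable_EFinP; exact: measurable_kernel_loss aL _ _.
  have ineq : (eta_bar r L Om + \int[mu]_(u in I) (m * K u)%:E <=
      m%:E + \int[mu]_(u in I) (K u * L u^-1)%:E)%E.
    have -> : (m%:E = \int[mu]_(u in pos) (m * K u)%:E)%E.
      under eq_integral do rewrite EFinM.
      rewrite ge0_integralZl//.
      - by rewrite integral_gamma_kernel// mule1.
      - by apply/measurable_EFinP; exact: measurable_gamma_kernel.
      - by move=> u; rewrite /= in_itv/= andbT lee_fin => /K0.
    rewrite eta_bar_kernel//; apply: ge0_le_integralD_in => //.
      by move=> u /K0 Ku; split; rewrite mulr_ge0.
    move=> u u0; rewrite -?[gamma_kernel r Om u]/(K u) !indicE.
    have [uI|] := boolP (u \in I); first by rewrite !mulr1 addrC.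
    rewrite !mulr0 !addr0 => /negP uI; rewrite mulrC ler_wpM2r ?K0//.
    apply: Hm; first by rewrite invr_gt0.
    rewrite leNgt; apply/negP => xiu; apply: uI; apply/mem_set.
    by rewrite /I /= in_itv/= u0 -[u]invrK ltf_pV2 ?posrE ?invr_gt0.
  have fin2 : (\int[mu]_(u in I) (K u * L u^-1)%:E <= (b * Q)%:E)%E.
    rewrite EFinM /Q fineK// -ge0_integralZl//; first last.
    - by rewrite lee_fin ltW.
    - by move=> u /Ipos; rewrite /= in_itv/= andbT => u0; rewrite lee_fin w20// ltW.
    - by apply/measurable_EFinP; exact: mw2.
    apply: ge0_le_integral => //.
    - by move=> u /Ipos; rewrite /= in_itv/= andbT => /K0 ?; rewrite lee_fin mulr_ge0.
    - by apply/measurable_EFinP; exact: mKL.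
    - by apply: emeasurable_funM => //; apply/measurable_EFinP; exact: mw2.
    - move=> u /Ipos; rewrite /= in_itv/= andbT => u0; rewrite -EFinM lee_fin KE /w2.
      rewrite -mulrA ler_wpM2l ?(ltW b0)// mulrC ler_wpM2l//.
      rewrite ler_piMr ?exprn_ge0 ?(ltW u0)// expR_le1 oppr_le0 mulr_ge0// ltW//.
  have fin1 : ((b * (m * expR (- (Om * xi^-1)) * P))%:E <=
      \int[mu]_(u in I) (m * K u)%:E)%E.
    rewrite mulrA EFinM /P fineK// -ge0_integralZl//; first last.
    - by rewrite lee_fin mulr_ge0 ?(ltW b0)// mulr_ge0// expR_ge0.
    - by move=> u /Ipos; rewrite /= in_itv/= andbT => u0; rewrite lee_fin w10// ltW.
    - by apply/measurable_EFinP; exact: mX.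
    apply: ge0_le_integral => //.
    - move=> u /Ipos; rewrite /= in_itv/= andbT => u0.
      rewrite -EFinM lee_fin mulr_ge0 ?w10 ?(ltW u0)// mulr_ge0 ?(ltW b0)//.
      by rewrite mulr_ge0// expR_ge0.
    - by apply: emeasurable_funM => //; apply/measurable_EFinP; exact: mX.
    - by apply/measurable_EFinP; exact: mK.
    - move=> u Iu; have u0 : 0 < u by have := Ipos u Iu; rewrite /= in_itv/= andbT.
      rewrite -EFinM lee_fin KE /w1.
      rewrite [leRHS](_ : _ = b * (m * expR (- (Om * u))) * u ^+ r.-1); last by ring.
      rewrite ler_wpM2r ?exprn_ge0 ?(ltW u0)// ler_wpM2l ?(ltW b0)// ler_wpM2l//.
      rewrite ler_expR lerN2 ler_wpM2l ?(ltW O0)//.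
      by move: Iu; rewrite /I /= in_itv/= => /andP[_ /ltW].
  have : ((b * (m * expR (- (Om * xi^-1)) * P))%:E <= (b * Q)%:E)%E.
    apply: (le_trans fin1); apply: le_trans fin2.
    rewrite -(@leeD2lE _ m%:E)//; apply: le_trans ineq.
    by rewrite leeD2r// HE.
  by rewrite lee_fin ler_pM2l.
have mPQ : m * P <= Q.
  rewrite leNgt; apply/negP => QmP.
  have mP0 : 0 < m * P.
    apply: le_lt_trans QmP; apply: fine_ge0; apply: integral_ge0 => u /Ipos.
    by rewrite /= in_itv/= andbT => u0; rewrite lee_fin w20// ltW.
  (* Chosen so that [m * P * (1 - Om / xi)] is the midpoint of [Q] and [m * P]. *)
  pose Om := xi * ((m * P - Q) / (2 * (m * P))).
  have O0 : 0 < Om by rewrite mulr_gt0// divr_gt0 ?subr_gt0// mulr_gt0.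
  have := key _ O0; apply/negP; rewrite -ltNge.
  have OxE : Om * xi^-1 = (m * P - Q) / (2 * (m * P)) by rewrite /Om mulrAC divff ?gt_eqF// mul1r.
  rewrite mulrAC; apply: (@lt_le_trans _ _ (m * P * (1 + - (Om * xi^-1)))); last first.
    by rewrite ler_pM2l// expR_ge1Dx.
  rewrite OxE mulrDr mulr1 mulrN.
  rewrite [X in _ < _ - X](_ : _ = (m * P - Q) / 2); first by lra.
  by move: mP0; set z := m * P => z0; field; rewrite gt_eqF.
rewrite (@integral_inv _ (fun x => (L xi - L x) / x ^+ r.+1))//; last first.
  apply: measurable_funM.
    by apply: measurable_funB => //; exact: admissible_measurable aL.
  apply: (measurableT_comp measurable_inv); exact: exprn_measurable.
have -> : (\int[mu]_(u in `]0%R, xi^-1%R[) ((L xi - L u^-1) / u^-1 ^+ r.+1 / u ^+ 2)%:E =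
    \int[mu]_(u in I) ((L xi)%:E * (w1 u)%:E - (w2 u)%:E))%E.
  apply: eq_integral => u /set_mem /Ipos; rewrite /= in_itv/= andbT => u0.
  rewrite -EFinM -EFinB; congr (_%:E); rewrite /w1 /w2 exprVn invrK.
  have -> : u ^+ r.+1 = u ^+ r.-1 * u ^+ 2 by rewrite -exprD addn2 prednK.
  by field; rewrite gt_eqF.
rewrite integralB//; last by apply: integrableZl.
rewrite integralZl// -/(w1 _) leeBlDr ?add0e// -[leLHS]fineK; last first.
  by rewrite fin_numM.
rewrite -[leRHS]fineK// lee_fin fineM//= -/P -/Q; apply: le_trans mPQ.
by rewrite ler_wpM2r// Hm.
Qed.

(** Below [al] and above [be] the truncated integral already forces [eta_bar] to be at least some
    [c' > eta_star], so the infimum is that over a compact interval, where continuity applies. *)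
Lemma eta_bar_attains (c delta Delta : R) : (eta_star r L < c%:E)%E -> 0 < delta ->
  (forall x, 0 < x -> x < delta -> c <= L x) ->
  (forall x, Delta < x -> c <= L x) ->
  exists2 Omega, 0 < Omega & eta_bar r L Omega = eta_star r L.
Proof.
move=> etac d0 Hd HD; have efin := eta_star_fin_num r0 aL.
pose m := fine (eta_star r L).
have m0 : 0 <= m by rewrite fine_ge0// (eta_star_ge0 aL).
have mE : eta_star r L = m%:E by rewrite fineK.
have mc : m < c by rewrite -lte_fin -mE.
pose c' := (m + c) / 2.
have mc' : m < c' by rewrite /c'; lra.
have c'c : c' < c by rewrite /c'; lra.
have c'0 : 0 <= c' := le_trans m0 (ltW mc').
have [M M1 HM] := gamma_core r0 c'0 c'c.
have M0 : 0 < M := lt_trans ltr01 M1.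
pose al := delta / M; pose be := Num.max al (Delta * M).
have al0 : 0 < al by rewrite divr_gt0.
have albe : al <= be by rewrite le_max lexx.
have outside Om : 0 < Om -> Om < al \/ be < Om -> (c'%:E <= eta_bar r L Om)%E.
  move=> O0 HO; apply: le_trans (eta_core_le_eta_bar aL _ M1).
  apply: (le_trans HM); apply: (eta_core_ge_outside aL M1 (le_trans c'0 (ltW c'c)) Hd HD O0).
  case: HO => HO; [by left|right].
  by apply: le_lt_trans HO; rewrite le_max lexx orbT.
have [Om Omab Ommin] : exists2 Om, Om \in `[al, be] &
    forall t, t \in `[al, be] -> fine (eta_bar r L Om) <= fine (eta_bar r L t).
  apply: EVT_min => //; apply: continuous_in_subspaceT => x /set_mem.
  rewrite /= in_itv/= => /andP[alx _].
  by apply: continuous_eta_bar => //; exact: lt_le_trans alx.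
have O0 : 0 < Om by move: Omab; rewrite in_itv/= => /andP[/(lt_le_trans al0)].
exists Om => //; apply/eqP; rewrite eq_le eta_star_le// andbT leNgt; apply/negP => lt.
have : (ereal_inf (eta_bar_values r L) < Order.min (eta_bar r L Om) c'%:E)%E.
  by rewrite lt_min -/(eta_star r L) lt mE lte_fin.
move=> /ereal_inf_lt[_ [t t0 <-]]; rewrite lt_min => /andP[tOm tc'].
have [tal|alt] := ltP t al.
  by have := outside t t0 (or_introl tal); rewrite leNgt tc'.
have [bet|tbe] := ltP be t.
  by have := outside t t0 (or_intror bet); rewrite leNgt tc'.
have := Ommin t; rewrite in_itv/= alt tbe => /(_ isT).
rewrite -lee_fin !fineK ?(eta_bar_fin_num r0 aL)//.
by rewrite leNgt tOm.
Qed.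

End eta_bar_minimum.

(** * Gamma limit of inverse binomial sampling *)

Section negbin.
Context {R : realType}.
Local Notation mu := (@lebesgue_measure R).
Local Notation pos := (`]0%R, +oo[%classic : set R).

Lemma ffact_le_expn n m : (n ^_ m <= n ^ m)%N.
Proof.
elim: m => [|m IH]; first by rewrite ffactn0 expn0.
by rewrite ffactnSr expnSr leq_mul// leq_subr.
Qed.

Lemma expn_sub_le_ffact n m : ((n - m) ^ m <= n ^_ m)%N.
Proof.
elim: m => [|m IH]; first by rewrite ffactn0 expn0.
rewrite ffactnSr expnSr leq_mul//; last by rewrite leq_sub2l.
by apply: leq_trans IH; case: m => // m; rewrite leq_exp2r// leq_sub2l.
Qed.

Lemma bin_le_expr n r : ('C(n.-1, r.-1)%:R : R) <= n%:R ^+ r.-1 / (r.-1)`!%:R.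
Proof.
rewrite ler_pdivlMr ?ltr0n ?fact_gt0// -natrM bin_ffact -natrX ler_nat.
apply: (leq_trans (ffact_le_expn _ _)).
by case: r.-1 => // m; rewrite leq_exp2r// leq_pred.
Qed.

Lemma bin_ge_expr n r : (0 < r)%N -> (r <= n)%N ->
  (n%:R - r%:R) ^+ r.-1 / (r.-1)`!%:R <= ('C(n.-1, r.-1)%:R : R).
Proof.
move=> r0 rn; rewrite ler_pdivrMr ?ltr0n ?fact_gt0// -natrM bin_ffact -natrB// -natrX ler_nat.
apply: leq_trans (expn_sub_le_ffact _ _).
by rewrite -!subn1 subnBA// subnK// (leq_trans r0).
Qed.

Lemma expr_onem_le (p : R) (n r : nat) : 0 < p -> p < 1 -> (r <= n)%N ->
  (1 - p) ^+ (n - r) <= expR (- (p * n%:R)) * expR (p * r%:R).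
Proof.
move=> p0 p1 rn; have h : 1 - p <= expR (- p) by exact: expR_ge1Dx.
apply: (@le_trans _ _ (expR (- p) ^+ (n - r))).
  by apply: lerXn2r => //; rewrite nnegrE ?expR_ge0// subr_ge0 ltW.
rewrite -expRM_natl -expRD ler_expR natrB//.
by rewrite le_eqVlt; apply/orP; left; apply/eqP; ring.
Qed.

(** [(1 - p)^-1 = 1 + p / (1 - p) <= exp(p / (1 - p))]; the exponent is first raised from [n - r] to
    [n], which only lowers the power. *)
Lemma expr_onem_ge (p : R) (n r : nat) : 0 < p -> p < 1 -> (r <= n)%N ->
  expR (- (p * n%:R / (1 - p))) <= (1 - p) ^+ (n - r).
Proof.
move=> p0 p1 rn; have q0 : 0 < 1 - p by rewrite subr_gt0.
apply: (@le_trans _ _ ((1 - p) ^+ n)); last first.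
  apply: ler_wiXn2l; rewrite ?leq_subr// ?(ltW q0)//.
  by rewrite lerBlDr lerDl ltW.
rewrite (_ : - (p * n%:R / (1 - p)) = n%:R * (- (p / (1 - p)))); last by ring.
rewrite expRM_natl; apply: lerXn2r; rewrite ?nnegrE ?expR_ge0 ?(ltW q0)//.
rewrite expRN invf_ple ?posrE ?expR_gt0//; apply: le_trans (expR_ge1Dx _).
rewrite le_eqVlt; apply/orP; left; apply/eqP; field.
by rewrite gt_eqF.
Qed.

Lemma negbin_pmf_ge0 r (p : R) n : 0 <= p -> p <= 1 -> 0 <= negbin_pmf r p n.
Proof.
by move=> p0 p1; rewrite /negbin_pmf !mulr_ge0// exprn_ge0// subr_ge0.
Qed.

(** Divided by [p], the mass function is a density in [x = p * n], whose values are spaced by [p];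
    the right-hand side is [gamma_pdf r x] times the error factor [exp(p * r)]. *)
Lemma negbin_pmf_le r (p : R) n : 0 < p -> p < 1 -> (0 < r)%N -> (r <= n)%N ->
  negbin_pmf r p n / p <=
  (p * n%:R) ^+ r.-1 / (r.-1)`!%:R * (expR (- (p * n%:R)) * expR (p * r%:R)).
Proof.
move=> p0 p1 r0 rn; rewrite /negbin_pmf.
rewrite [leLHS](_ : _ = 'C(n.-1, r.-1)%:R * p ^+ r.-1 * (1 - p) ^+ (n - r)); last first.
  rewrite -{2}(prednK r0) exprS; field; exact: lt0r_neq0.
apply: ler_pM; rewrite ?expr_onem_le ?mulr_ge0 ?exprn_ge0 ?subr_ge0 ?(ltW p0) ?(ltW p1)//.
rewrite exprMn mulrC -mulrA ler_wpM2l ?exprn_ge0 ?(ltW p0)//.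
exact: bin_le_expr.
Qed.

Lemma negbin_pmf_ge r (p : R) n : 0 < p -> p < 1 -> (0 < r)%N -> (r <= n)%N ->
  (p * n%:R - p * r%:R) ^+ r.-1 / (r.-1)`!%:R * expR (- (p * n%:R / (1 - p))) <=
  negbin_pmf r p n / p.
Proof.
move=> p0 p1 r0 rn; rewrite /negbin_pmf.
rewrite [leRHS](_ : _ = 'C(n.-1, r.-1)%:R * p ^+ r.-1 * (1 - p) ^+ (n - r)); last first.
  rewrite -{2}(prednK r0) exprS; field; exact: lt0r_neq0.
have nr : 0 <= n%:R - r%:R :> R by rewrite subr_ge0 ler_nat.
apply: ler_pM; rewrite ?expr_onem_ge ?expR_ge0//.
  by rewrite -mulrBr divr_ge0// exprn_ge0// mulr_ge0// ltW.
rewrite -mulrBr exprMn [leRHS]mulrC -mulrA ler_wpM2l ?exprn_ge0 ?(ltW p0)//.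
exact: bin_ge_expr.
Qed.

Lemma integral_step (F : nat -> R) (p : R) : 0 < p -> (forall m, 0 <= F m) ->
  measurable_fun pos (fun nu => F (Num.truncn (nu / p))) /\
  (\int[mu]_(nu in pos) (F (Num.truncn (nu / p)) / p)%:E =
   \sum_(0 <= m <oo) (F m)%:E)%E.
Proof.
move=> p0 F0; pose E (m : nat) := (`[m%:R * p, m.+1%:R * p[%classic : set R).
have EP m x : E m x -> Num.truncn (x / p) = m.
  rewrite /E /= in_itv/= => /andP[mx xm]; apply: truncn_def.
  by rewrite ler_pdivlMr// mx ltr_pdivrMr.
have UE : (`[0, +oo[%classic : set R) = \bigcup_m E m.
  apply/seteqP; split => [x|x [m _]].
    rewrite /= in_itv/= andbT => x0.
    exists (Num.truncn (x / p)) => //; rewrite /E /= in_itv/= -ler_pdivlMr// -ltr_pdivrMr//.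
    by apply: truncn_itv; rewrite divr_ge0// ltW.
  rewrite /E /= !in_itv/= andbT => /andP[+ _]; apply: le_trans.
  by rewrite mulr_ge0// ltW.
have mE m : measurable (E m) by exact: measurable_itv.
have muE m : mu (E m) = p%:E.
  rewrite /E lebesgue_measure_itv/= lte_fin ltr_pM2r// ltr_nat ltnSn -EFinB.
  by rewrite -mulrBl -natrB// subSnn mul1r.
have mF : measurable_fun (`[0, +oo[%classic : set R) (fun nu => F (Num.truncn (nu / p))).
  rewrite UE; apply/measurable_fun_bigcup => // m.
  apply: (@eq_measurable_fun _ _ _ _ (E m) (cst (F m))) => //.
  by move=> x /set_mem /EP ->.
have mFp : measurable_fun (`[0, +oo[%classic : set R) (fun nu => (F (Num.truncn (nu / p)) / p)%:E).
  by apply/measurable_EFinP; apply: measurable_funM.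
split.
  by apply: measurable_funS mF => //; apply: subset_itvr; rewrite bnd_simp.
rewrite integral_itv_obnd_cbnd; last first.
  by apply: measurable_funS mFp => //; apply: subset_itvr; rewrite bnd_simp.
rewrite UE ge0_integral_bigcup//.
- apply: eq_eseriesr => m _.
  rewrite (eq_integral (fun=> (F m / p)%:E)); last by move=> x /set_mem /EP ->.
  rewrite integral_cst; last exact: mE.
  rewrite [X in (_ * X)%E]muE -EFinM.
  by rewrite divfK// gt_eqF.
- by rewrite -UE.
- by move=> x _; rewrite lee_fin divr_ge0// ltW.
- apply/trivIsetP => i j _ _ ij; rewrite -subset0 => x [/EP xi /EP xj].
  by move: ij; rewrite -xi -xj eqxx.
Qed.

(** Adding [r] aligns the cells of length [p] with a sum that starts at [n = r]. As [r >= 1], it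
    also moves the lattice point to the right of [nu], the side on which its negative powers are
    dominated by those of [nu]. *)
Lemma step_bounds (nu p : R) (r : nat) : 0 < nu -> 0 < p -> (0 < r)%N ->
  let x := p * (Num.truncn (nu / p) + r)%:R in
  [/\ nu <= x, x <= nu + p * r%:R & nu - p <= x - p * r%:R].
Proof.
move=> nu0 p0 r0 /=; have nup : 0 <= nu / p by rewrite divr_ge0// ltW.
have /andP[lo hi] := truncn_itv nup; rewrite natrD.
rewrite ler_pdivlMr// in lo; rewrite ltr_pdivrMr// -natr1 in hi.
have r1 : 1 <= r%:R :> R by rewrite ler1n.
have pr1 : p <= p * r%:R by rewrite ler_peMr// ltW.
set t := (Num.truncn _)%:R in lo hi *.
split; lra.
Qed.

Lemma negbin_pmf_cvg (r : nat) (nu : R) : (0 < r)%N -> 0 < nu ->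
  negbin_pmf r p (Num.truncn (nu / p) + r) / p @[p --> 0^'+] --> gamma_pdf r nu.
Proof.
move=> r0 nu0.
have cexpr (f : R -> R) (a : R) n : f p @[p --> 0^'+] --> a ->
    (f p) ^+ n @[p --> 0^'+] --> a ^+ n.
  by move=> fa; apply: (@cvg_comp _ _ _ f (fun x : R => x ^+ n) _ (nbhs a)) => //; exact: exprn_continuous.
have cexp (f : R -> R) (a : R) : f p @[p --> 0^'+] --> a ->
    expR (f p) @[p --> 0^'+] --> expR a.
  by move=> fa; apply: (@cvg_comp _ _ _ f expR _ (nbhs a)) => //; exact: continuous_expR.
have cid : (p : R) @[p --> 0^'+] --> (0 : R) by apply: cvg_at_right_filter; exact: cvg_id.
have cpr : p * r%:R @[p --> 0^'+] --> (0 : R).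
  by rewrite -[X in _ --> X](mul0r (r%:R : R)); apply: cvgM => //; exact: cvg_cst.
have cy : nu + p * r%:R @[p --> 0^'+] --> nu.
  by rewrite -[X in _ --> X]addr0; apply: cvgD => //; exact: cvg_cst.
have cz : nu - p @[p --> 0^'+] --> nu.
  by rewrite -[X in _ --> X]subr0; apply: cvgB => //; exact: cvg_cst.
have cq : (1 - p)^-1 @[p --> 0^'+] --> (1 : R).
  rewrite -[X in _ --> X]invr1; apply: cvgV; first exact: oner_neq0.
  by rewrite -[X in _ --> X]subr0; apply: cvgB => //; exact: cvg_cst.
(* The two bounds on the mass function, with [p * n] replaced by an end of [[nu, nu + p * r]] and
   [p * n - p * r] by [nu - p]. *)
apply: (@squeeze_cvgr _ _ _ _
  (fun p => (nu - p) ^+ r.-1 / (r.-1)`!%:R * expR (- ((nu + p * r%:R) / (1 - p))))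
  (fun p => (nu + p * r%:R) ^+ r.-1 / (r.-1)`!%:R * (expR (- nu) * expR (p * r%:R)))).
- near=> p.
  have p0 : 0 < p by near: p; exact: nbhs_right_gt.
  have p1 : p < 1 by near: p; exact: nbhs_right_lt.
  have pnu : p <= nu by apply: ltW; near: p; exact: nbhs_right_lt.
  have [] := step_bounds nu0 p0 r0; set n := (_ + r)%N => nx xn xnr.
  have rn : (r <= n)%N by rewrite leq_addl.
  have pr0 : 0 <= p * r%:R by rewrite mulr_ge0// ltW.
  apply/andP; split.
  + apply: le_trans (negbin_pmf_ge p0 p1 r0 rn).
    apply: ler_pM; rewrite ?expR_ge0//.
    * by rewrite divr_ge0// exprn_ge0// subr_ge0.
    * rewrite ler_wpM2r//; apply: lerXn2r => //; rewrite nnegrE ?subr_ge0//.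
      by rewrite ler_pM2l// ler_nat.
    * by rewrite ler_expR lerN2 ler_wpM2r// invr_ge0 subr_ge0 ltW.
  + apply: (le_trans (negbin_pmf_le p0 p1 r0 rn)).
    have x0 : 0 <= p * n%:R by rewrite mulr_ge0// ltW.
    apply: ler_pM; rewrite ?mulr_ge0 ?expR_ge0 ?divr_ge0 ?exprn_ge0//.
    * rewrite ler_wpM2r//; apply: lerXn2r => //; rewrite nnegrE.
      exact: le_trans xn.
    * by rewrite ler_wpM2r ?expR_ge0// ler_expR lerN2.
- rewrite /gamma_pdf mulrAC; apply: cvgM.
    by apply: cvgM; [exact: cexpr | exact: cvg_cst].
  apply: cexp; apply: cvgN; rewrite -[X in _ --> X]mulr1.
  by apply: cvgM.
- rewrite /gamma_pdf mulrAC; apply: cvgM.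
    by apply: cvgM; [exact: cexpr | exact: cvg_cst].
  rewrite -[X in _ --> X]mulr1; apply: cvgM; first exact: cvg_cst.
  by rewrite -[X in _ --> X]expR0; apply: cexp.
Unshelve. all: by end_near. Qed.

(** The loss terms are an arbitrary [u p n], so that the limit applies both to the exact risk of
    [Omega / N] and to a majorant of the risk of [1 / N ^ 2]. The set [D] holds the [nu] at which
    the pointwise limit may fail because of a discontinuity of [L]. *)
Lemma negbin_sum_cvg (r : nat) (u : R -> nat -> R) (W l : R -> R) (D : set R) :
  (0 < r)%N ->
  (forall p n, 0 < p -> p < 1 -> 0 <= u p n) ->
  measurable_fun setT W -> (forall x, 0 <= W x) ->
  (\int[mu]_(nu in pos) (W nu)%:E < +oo)%E ->
  (forall nu p n, 0 < nu -> 0 < p -> p < 1 -> (r <= n)%N ->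
    nu <= p * n%:R -> p * n%:R <= nu + 1 ->
    (p * n%:R) ^+ r.-1 * u p n * expR (- nu) <= W nu) ->
  measurable_fun pos l -> countable D ->
  (forall nu, 0 < nu -> ~ D nu ->
    u p (Num.truncn (nu / p) + r)%N @[p --> 0^'+] --> l nu) ->
  (\int[mu]_(nu in pos) (gamma_pdf r nu * l nu)%:E)%E \is a fin_num /\
  (\sum_(r <= n <oo) (negbin_pmf r p n * u p n)%:E)%E @[p --> 0^'+] -->
    (\int[mu]_(nu in pos) (gamma_pdf r nu * l nu)%:E)%E.
Proof.
move=> r0 u0 mW W0 Woo HW ml cD Hl.
pose fp p nu := negbin_pmf r p (Num.truncn (nu / p) + r) * u p (Num.truncn (nu / p) + r)%N / p.
have stepE p : 0 < p -> p < 1 -> measurable_fun pos (EFin \o fp p) /\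
    (\sum_(r <= n <oo) (negbin_pmf r p n * u p n)%:E =
     \int[mu]_(nu in pos) (fp p nu)%:E)%E.
  move=> p0 p1.
  have h0 m : 0 <= negbin_pmf r p m * u p m.
    by rewrite mulr_ge0 ?u0// negbin_pmf_ge0// ltW.
  have [mF eF] := @integral_step (fun m => negbin_pmf r p (m + r) * u p (m + r)%N) p p0 (fun m => h0 _).
  split; first by apply/measurable_EFinP; apply: measurable_funM.
  by rewrite eF (nneseries_addn r (f := fun n => (negbin_pmf r p n * u p n)%:E))// => i; rewrite lee_fin.
(* [exp(r)] bounds the error factor [exp(p * r)] for [p < 1]. *)
pose e := expR (r%:R : R) / (r.-1)`!%:R.
have dom p nu : 0 < nu -> 0 < p -> p * r%:R <= 1 -> p < 1 -> 0 <= fp p nu <= e * W nu.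
  move=> nu0 p0 pr1 p1; have [] := step_bounds nu0 p0 r0.
  rewrite /fp; set n := (_ + r)%N => nx xn _.
  have rn : (r <= n)%N by rewrite leq_addl.
  have un := u0 p n p0 p1.
  have f0 : 0 <= negbin_pmf r p n by rewrite negbin_pmf_ge0// ltW.
  apply/andP; split; first by rewrite divr_ge0 ?(ltW p0)//; exact: mulr_ge0.
  rewrite mulrAC.
  apply: (le_trans (ler_wpM2r un (negbin_pmf_le p0 p1 r0 rn))).
  apply: (@le_trans _ _ (e * ((p * n%:R) ^+ r.-1 * u p n * expR (- nu)))); last first.
    rewrite ler_wpM2l ?divr_ge0 ?expR_ge0//; apply: HW => //.
    by apply: (le_trans xn); rewrite lerD2l.
  rewrite /e [leLHS](_ : _ = (p * n%:R) ^+ r.-1 * u p n / (r.-1)`!%:R *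
    (expR (- (p * n%:R)) * expR (p * r%:R))); last by ring.
  rewrite [leRHS](_ : _ = (p * n%:R) ^+ r.-1 * u p n / (r.-1)`!%:R *
    (expR (- nu) * expR (r%:R))); last by ring.
  have x0 : 0 <= p * n%:R by rewrite mulr_ge0// ltW.
  rewrite ler_wpM2l ?divr_ge0 ?mulr_ge0 ?exprn_ge0//.
  apply: ler_pM; rewrite ?expR_ge0// ler_expR ?lerN2//.
  by rewrite ler_piMl// ltW.
have mfl : measurable_fun pos (fun nu => (gamma_pdf r nu * l nu)%:E).
  by apply/measurable_EFinP; apply: measurable_funM => //; exact: (@measurable_gamma_pdf _ r _).
have e0 : 0 <= e by rewrite divr_ge0 ?expR_ge0.
have meW : measurable_fun pos (fun nu => (e * W nu)%:E).
  by apply/measurable_EFinP; apply: measurable_funTS; exact: measurable_funM.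
have iW : mu.-integrable pos (fun nu => (e * W nu)%:E).
  apply/integrableP; split => //.
  rewrite (_ : integral _ _ _ = (e%:E * \int[mu]_(nu in pos) (W nu)%:E)%E).
    by rewrite lte_mul_pinfty// lee_fin.
  rewrite -ge0_integralZl//.
  - by apply: eq_integral => nu _; rewrite gee0_abs ?EFinM// lee_fin mulr_ge0.
  - by apply/measurable_EFinP; exact: measurable_funTS.
  - by move=> nu _; rewrite lee_fin.
(* Dominated convergence is for sequences. The conditions on [q] are asked at every index; a general
   sequence tending to 0 meets them after a shift. *)
have main (q : nat -> R) : (forall n, 0 < q n) -> (forall n, q n < 1) ->
   (forall n, q n * r%:R <= 1) -> q @ \oo --> (0 : R) ->
   mu.-integrable pos (fun nu => (gamma_pdf r nu * l nu)%:E) /\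
   (\int[mu]_(nu in pos) (fp (q n) nu)%:E)%E @[n --> \oo] -->
   (\int[mu]_(nu in pos) (gamma_pdf r nu * l nu)%:E)%E.
  move=> q0 q1 qr qcvg.
  have h1 n : measurable_fun pos (fun nu => (fp (q n) nu)%:E).
    exact: (stepE (q n) (q0 n) (q1 n)).1.
  have h2 : {ae mu, forall nu, pos nu ->
      (fp (q n) nu)%:E @[n --> \oo] --> (gamma_pdf r nu * l nu)%:E}.
    exists D; split; [exact: countable_measurable|exact: countable_lebesgue_measure0|].
    move=> nu /=; apply: contra_notP => nuD; rewrite in_itv/= andbT => nu0.
    apply: cvg_EFin; first exact: nearW.
    have hp : fp p nu @[p --> 0^'+] --> gamma_pdf r nu * l nu.
      rewrite /fp; under eq_cvg do rewrite mulrAC.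
      by apply: cvgM; [exact: negbin_pmf_cvg | exact: Hl].
    exact: ((cvg_at_rightP _ _ _).1 hp q (conj q0 qcvg)).
  have h3 : {ae mu, forall nu n, pos nu -> (`|(fp (q n) nu)%:E| <= (e * W nu)%:E)%E}.
    apply: aeW => nu n; rewrite /= in_itv/= andbT => nu0.
    have /andP[f0 fW] := dom (q n) nu nu0 (q0 n) (qr n) (q1 n).
    by rewrite lee_fin ger0_norm.
  by have [? _ ?] := @dominated_convergence _ (measurableTypeR R) R mu pos
    (measurable_itv _) (fun n nu => (fp (q n) nu)%:E)
    (fun nu => (gamma_pdf r nu * l nu)%:E) (fun nu => (e * W nu)%:E) h1 mfl h2 iW h3.
(* Any one sequence allowed in [main] shows that the limit is integrable; [1 / (n + 1 + r)] is
   one. *)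
have fin : (\int[mu]_(nu in pos) (gamma_pdf r nu * l nu)%:E)%E \is a fin_num.
  have [//||||h _] := main (fun n => (n.+1 + r)%:R^-1).
  - by move=> n; rewrite invf_lt1 ?ltr0n// ltr1n addSn ltnS (leq_trans r0)// leq_addl.
  - by move=> n; rewrite mulrC ler_pdivrMr ?ltr0n// mul1r ler_nat leq_addl.
  - apply/gtr0_cvgV0; first by apply: nearW => n; rewrite ltr0n.
    under eq_cvg do rewrite addSnnS.
    by have h := @cvgr_idn R; rewrite -(cvg_shiftn r.+1) in h; exact: h.
  exact: integrable_fin_num.
split=> //; rewrite -(fineK fin); apply/cvge_at_rightP => v [v0 vcvg]; rewrite fineK//.
have [N _ HN] : \forall n \near \oo, v n < 1 /\ v n * r%:R <= 1.
  near=> n; split; first by near: n; exact: (cvgr_lt (0 : R)).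
  rewrite -ler_pdivlMr ?ltr0n// div1r ltW//; near: n.
  by apply: (cvgr_lt (0 : R)) => //; rewrite invr_gt0 ltr0n.
rewrite -(cvg_shiftn N).
have [|||| _ h] := main (fun n => v (n + N)%N).
- by move=> n; exact: v0.
- by move=> n; exact: (HN _ (leq_addl _ _)).1.
- by move=> n; exact: (HN _ (leq_addl _ _)).2.
- by rewrite (cvg_shiftn N v).
apply: cvg_trans h; apply: near_eq_cvg; apply: nearW => n /=.
by rewrite (stepE _ (v0 _) (HN _ (leq_addl _ _)).1).2.
Unshelve. all: by end_near. Qed.

End negbin.

(** * Averaging over the scale-invariant prior *)

Section lower_bound.
Context {R : realType}.
Local Notation mu := (@lebesgue_measure R).
Local Notation pos := (`]0%R, +oo[%classic : set R).

(** [f 0 = 0] gives [(0, n]] the mass [f n], which tends to 1. *)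
Lemma lebesgue_stieltjes_pos (f : cumulativeBounded (0 : R) (1 : R)) : f 0 = 0 ->
  lebesgue_stieltjes_measure f pos = 1%E.
Proof.
move=> f0; pose I n : set (measurableTypeR R) := `]0, n%:R]%classic.
have -> : pos = \bigcup_n I n by rewrite itv_bndy_bigcup_BRight; apply: eq_bigcupr => n _; rewrite /I add0r.
have h1 : lebesgue_stieltjes_measure f (I n) @[n --> \oo] --> 1%E.
  have -> : (fun n => lebesgue_stieltjes_measure f (I n)) = (fun n => (f n%:R)%:E).
    apply/funext=> n; rewrite /lebesgue_stieltjes_measure.
    rewrite /measure_extension measurable_mu_extE/=; last exact: is_ocitv.
    by rewrite wlength_itv_bnd// f0 subr0.
  apply: cvg_EFin; first exact: nearW.
  exact: (cvg_comp _ _ (@cvgr_idn R) (cumulativey f)).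
have h2 : lebesgue_stieltjes_measure f (I n) @[n --> \oo] -->
    lebesgue_stieltjes_measure f (\bigcup_n I n).
  apply: nondecreasing_cvg_mu; rewrite /I//; first exact: bigcup_measurable.
  by move=> *; apply/subsetPset/subset_itv; rewrite leBSide/= ?ler_nat.
exact: cvg_unique h2 h1.
Qed.

(** The point is uniformity in [p]: on the core [p <= M / n], so the ratio of the lower bound on the
    mass function to the gamma density is at least a function of [1 / n] alone, which tends to 1. *)
Lemma negbin_pmf_ge_gamma (r : nat) (M theta : R) : (0 < r)%N -> 1 < M ->
  theta < 1 -> exists n0 : nat, forall n p, (n0 <= n)%N ->
    M^-1 <= p * n%:R -> p * n%:R <= M ->
    [/\ 0 < p, p < 1, (r <= n)%N &
      theta * gamma_pdf r (p * n%:R) <= negbin_pmf r p n / p].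
Proof.
move=> r0 M1 th1; have M0 : 0 < M := lt_trans ltr01 M1.
(* That ratio at [t = 1 / n], with [p * n] and [p] replaced in the exponent by their largest values
   [M] and [M * t]. *)
pose g (t : R) := (1 - r%:R * t) ^+ r.-1 * expR (- (M * (M * t / (1 - M * t)))).
have cl (a : R) : a * t @[t --> 0^'+] --> (0 : R).
  rewrite -[X in _ --> X](mulr0 a); apply: cvgM; first exact: cvg_cst.
  by apply: cvg_at_right_filter; exact: cvg_id.
have c1 (a : R) : 1 - a * t @[t --> 0^'+] --> (1 : R).
  by rewrite -[X in _ --> X]subr0; apply: cvgB => //; exact: cvg_cst.
have ce : - (M * (M * t / (1 - M * t))) @[t --> 0^'+] --> (0 : R).
  rewrite [X in _ --> X](_ : 0 = - (M * (0 * 1^-1))); last by rewrite mul0r mulr0 oppr0.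
  apply: cvgN; apply: cvgM; first exact: cvg_cst.
  apply: cvgM; first exact: cl.
  by apply: cvgV; [exact: oner_neq0|exact: c1].
have gcvg : g t @[t --> 0^'+] --> (1 : R).
  rewrite [X in _ --> X](_ : 1 = 1 ^+ r.-1 * expR 0); last by rewrite expr1n expR0 mulr1.
  apply: cvgM.
    apply: (@cvg_comp _ _ _ (fun t : R => 1 - r%:R * t) (fun x : R => x ^+ r.-1) _ (nbhs (1 : R))).
      exact: c1.
    exact: exprn_continuous.
  apply: (@cvg_comp _ _ _ (fun t : R => - (M * (M * t / (1 - M * t)))) expR _ (nbhs (0 : R))).
    exact: ce.
  exact: continuous_expR.
have [d /= d0 Hd] : \forall t \near (0 : R)^'+, [/\ theta < g t, M * t < 1 & r%:R * t <= 1].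
  near=> t; split; first by near: t; exact: (cvgr_gt (1 : R)).
    by near: t; apply: (cvgr_lt (0 : R)) => //; exact: cl.
  by apply: ltW; near: t; apply: (cvgr_lt (0 : R)) => //; exact: cl.
exists (Num.truncn d^-1).+1 => n p n0n pn1 pn2.
have n0 : 0 < n%:R :> R by rewrite ltr0n (leq_trans _ n0n).
have nd : n%:R^-1 < d.
  rewrite invf_plt ?posrE//; apply: (lt_le_trans (truncnS_gt _)).
  by rewrite ler_nat.
have [||thg Mn rn] := Hd n%:R^-1.
- by rewrite /ball /= sub0r normrN gtr0_norm ?invr_gt0.
- by rewrite invr_gt0.
have x0 : 0 < p * n%:R by apply: lt_le_trans pn1; rewrite invr_gt0.
have p0 : 0 < p by move: x0; rewrite pmulr_lgt0.
have pM : p <= M * n%:R^-1 by rewrite ler_pdivlMr.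
have p1 : p < 1 by exact: le_lt_trans Mn.
have rn' : (r <= n)%N by move: rn; rewrite ler_pdivrMr// mul1r ler_nat.
split => //.
apply: le_trans (negbin_pmf_ge p0 p1 r0 rn').
set x := p * n%:R in pn1 pn2 x0 *.
have -> : x - p * r%:R = x * (1 - r%:R * n%:R^-1).
  by rewrite /x; field; exact: lt0r_neq0.
apply: (@le_trans _ _ (g n%:R^-1 * gamma_pdf r x)).
  by rewrite ler_wpM2r ?gamma_pdf_ge0 ?(ltW x0)// ltW.
rewrite /g /gamma_pdf [in leRHS](exprMn _ x).
rewrite [leLHS](_ : _ = x ^+ r.-1 * (1 - r%:R * n%:R^-1) ^+ r.-1 / (r.-1)`!%:R *
  (expR (- x) * expR (- (M * (M * n%:R^-1 / (1 - M * n%:R^-1)))))); last by ring.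
rewrite ler_wpM2l//.
  by rewrite divr_ge0// mulr_ge0// exprn_ge0 ?subr_ge0 ?(ltW x0).
rewrite -expRD ler_expR -opprD lerN2.
have q0 : 0 < 1 - p by rewrite subr_gt0.
have -> : x / (1 - p) = x + x * (p / (1 - p)) by field; exact: lt0r_neq0.
rewrite lerD2l; apply: ler_pM; rewrite ?(ltW x0)//.
  by rewrite divr_ge0 ?(ltW p0) ?(ltW q0).
apply: ler_pM; rewrite ?(ltW p0) ?invr_ge0 ?(ltW q0)//.
rewrite lef_pV2 ?posrE ?subr_gt0//.
by rewrite lerD2l lerN2.
Unshelve. all: by end_near. Qed.

Lemma ln_le_harmonic (m n : nat) : (0 < m)%N -> (m <= n)%N ->
  ln n%:R - ln m%:R <= \sum_(m <= i < n) i%:R^-1 :> R.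
Proof.
move=> m0; elim: n => [|n IH]; first by rewrite leqn0 => /eqP ->; rewrite subrr big_geq.
rewrite leq_eqVlt ltnS => /predU1P[<-|mn]; first by rewrite subrr big_geq.
have n0 : 0 < n%:R :> R by rewrite ltr0n (leq_trans m0).
rewrite big_nat_recr//= -lerBlDr; apply: le_trans (IH mn).
rewrite lerBlDr addrAC lerD2r -lerBlDl.
have -> : ln n.+1%:R - ln n%:R = ln (1 + n%:R^-1) :> R.
  rewrite -ln_div ?posrE//; congr ln; rewrite -natr1; field; exact: lt0r_neq0.
by apply: le_ln1Dx; apply: lt_trans (_ : 0 < _); rewrite ?invr_gt0// oppr_lt0.
Qed.

Lemma integral_invr (a b : R) : 0 < a -> a < b ->
  (\int[mu]_(p in `[a, b]) (p^-1)%:E = (ln b - ln a)%:E)%E.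
Proof.
move=> a0 ab.
have dln (x : R) : 0 < x -> is_derive x 1 (@ln R) x^-1 by move=> x0; exact: is_derive1_ln.
rewrite (@continuous_FTC2 _ _ (@ln R))//.
- apply: continuous_in_subspaceT => x /set_mem; rewrite /= in_itv/= => /andP[ax _].
  by apply: inv_continuous; rewrite gt_eqF// (lt_le_trans a0).
- split.
  + by move=> x; rewrite in_itv/= => /andP[/(lt_trans a0)/dln[]].
  + by apply: cvg_at_right_filter; exact: continuous_ln.
  + by apply: cvg_at_left_filter; apply: continuous_ln; exact: lt_trans ab.
- move=> x; rewrite in_itv/= => /andP[/(lt_trans a0) x0 _].
  by rewrite derive1E; apply: derive_val; exact: dln.
Qed.

Variables (r : nat) (L : R -> R).
Hypothesis r0 : (0 < r)%N.
Hypothesis aL : admissible r L.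

Let L0 : forall x, 0 <= L x. Proof. exact: admissible_ge0 aL. Qed.

Let mL : measurable_fun setT L. Proof. exact: admissible_measurable aL. Qed.

Variable Pi : nat -> cumulativeBounded (0 : R) (1 : R).
Hypothesis estPi : estimator r Pi.

Let cond_risk n p : \bar R :=
  (\int[lebesgue_stieltjes_measure (Pi n)]_(y in pos) (L (y / p))%:E)%E.

Let measurable_loss_ratio :
  measurable_fun setT (fun z : measurableTypeR R * measurableTypeR R =>
    (L (z.2 / z.1))%:E).
Proof.
apply/measurable_EFinP; apply: (measurableT_comp mL); apply: measurable_funM.
  exact: measurable_snd.
exact: (measurableT_comp measurable_inv measurable_fst).
Qed.

Let cond_risk_ge0 n p : (0 <= cond_risk n p)%E.
Proof. by apply: integral_ge0 => y _; rewrite lee_fin. Qed.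

Let measurable_cond_risk n : measurable_fun setT (cond_risk n).
Proof.
apply: (@measurable_integral_tonelli _ _ (measurableTypeR R) (measurableTypeR R) R
  (lebesgue_stieltjes_measure (Pi n)) pos (fun z => (L (z.2 / z.1))%:E)) => //.
by move=> z; rewrite lee_fin.
Qed.

Let measurable_negbin_div n : measurable_fun setT (fun p : R => negbin_pmf r p n / p).
Proof.
apply: measurable_funM; last exact: measurable_inv.
apply: measurable_funM; first by apply: measurable_funM.
by apply: measurable_funX; apply: measurable_funB.
Qed.

(* The average of the contribution of [N = n] over the scale-invariant prior dp/p:
   by Tonelli it is a mixture over y of truncated values [eta_core M (n * y)]. *)
Let cond_risk_average (M theta c : R) n : 1 < M -> 0 <= theta -> 0 <= c ->
  (r <= n)%N ->
  (forall p, M^-1 <= p * n%:R -> p * n%:R <= M ->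
    [/\ 0 < p, p < 1 & theta * gamma_pdf r (p * n%:R) <= negbin_pmf r p n / p]) ->
  (forall Omega, 0 < Omega -> (c%:E <= eta_core r L M Omega)%E) ->
  ((theta * c / n%:R)%:E <= \int[mu]_(p in `[((M * n%:R)^-1)%R, (M / n%:R)%R])
    ((negbin_pmf r p n / p)%:E * cond_risk n p))%E.
Proof.
move=> M1 th0 c0 rn Hpmf Hcore.
have M0 : 0 < M := lt_trans ltr01 M1.
have n0 : 0 < n%:R :> R by rewrite ltr0n (leq_trans r0).
pose J := (`[(M * n%:R)^-1, M / n%:R]%classic : set R).
have JP p : J p -> M^-1 <= p * n%:R /\ p * n%:R <= M.
  rewrite /J /= in_itv/= => /andP[p1 p2]; split; last by rewrite -ler_pdivlMr.
  by rewrite -ler_pdivrMr// -invfM.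
have J0 p : J p -> 0 < p.
  by move=> /JP[p1 _]; rewrite -(pmulr_lgt0 _ n0) (lt_le_trans _ p1)// invr_gt0.
pose lsm := lebesgue_stieltjes_measure (Pi n).
pose F (z : measurableTypeR R * measurableTypeR R) : \bar R :=
  ((gamma_pdf r (`|z.1| * n%:R) * L (z.2 / z.1))%:E)%E.
have mF : measurable_fun setT F.
  apply/measurable_EFinP; apply: measurable_funM; last exact/measurable_EFinP.
  apply: (measurableT_comp (@measurable_gamma_pdf _ r setT)).
  apply: measurable_funM => //.
  exact: (measurableT_comp (@normr_measurable R setT) measurable_fst).
have F0 z : (0 <= F z)%E.
  by rewrite lee_fin mulr_ge0// gamma_pdf_ge0// mulr_ge0.
have inner y : 0 < y -> ((c / n%:R)%:E <= \int[mu]_(p in J) F (p, y))%E.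
  move=> y0.
  have mFy : measurable_fun setT (fun p : R => F (p, y)).
    exact: (measurableT_comp mF (measurable_pair2 y)).
  rewrite (@ge0_integral_scale _ n%:R^-1)//; last 3 first.
  - by rewrite invr_gt0.
  - exact: measurable_itv.
  - exact: measurable_funS mFy.
  rewrite mulrC EFinM lee_pmul2l ?lte_fin ?invr_gt0//.
  apply: le_trans (Hcore (n%:R * y) (mulr_gt0 n0 y0)) _.
  rewrite /eta_core.
  have -> : ( *%R n%:R^-1 @^-1` J) = (`[M^-1, M]%classic : set R).
    apply/seteqP; split => x; rewrite /J /= !in_itv/= => /andP[h1 h2].
      rewrite invfM ler_pdivlMl// mulrCA mulfV ?gt_eqF// mulr1 in h1.
      by rewrite h1; rewrite mulrC ler_pM2r ?invr_gt0 in h2.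
    by rewrite invfM [X in _ <= X <= _]mulrC !ler_pM2r ?invr_gt0// h1.
  rewrite le_eqVlt; apply/orP; left; apply/eqP; apply: eq_integral => nu.
  move=> /set_mem/(core_pos M1); rewrite /= in_itv/= andbT => nu0.
  have e1 : n%:R^-1 * nu * n%:R = nu by field; exact: lt0r_neq0.
  have e2 : y / (n%:R^-1 * nu) = n%:R * y / nu.
    by field; rewrite !gt_eqF.
  by rewrite /F /= gtr0_norm ?mulr_gt0 ?invr_gt0// e1 e2.
apply: (@le_trans _ _ (\int[mu]_(p in J) (theta%:E * \int[lsm]_(y in pos) F (p, y)))%E).
  rewrite ge0_integralZl//; last 3 first.
  - exact: measurable_itv.
  - apply: (measurable_funS measurableT) => //.
    exact: (@measurable_integral_tonelli _ _ (measurableTypeR R) (measurableTypeR R) R lsm pos F).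
  - by move=> p _; exact: integral_ge0.
  rewrite [X in (_ <= _ * X)%E](@fubini_tonelli_in _ _ (measurableTypeR R)
    (measurableTypeR R) R mu lsm J pos F)//; last exact: measurable_itv.
  rewrite -mulrA EFinM lee_wpmul2l ?lee_fin//.
  (* The conditional law given [N = n] has mass 1 on [(0, +oo)], so a lower bound valid for each [y]
     survives averaging over [y]: randomization does not help. *)
  rewrite -[leLHS]mule1 -(lebesgue_stieltjes_pos (estPi rn)) -integral_cst//.
  apply: ge0_le_integral => //.
  - by move=> y _; rewrite lee_fin divr_ge0.
  - apply: (measurable_funS measurableT) => //.
    apply: (@measurable_integral_tonelli _ _ (measurableTypeR R)
      (measurableTypeR R) R mu J (fun z => F (z.2, z.1))); first exact: measurable_itv.
      exact: (measurableT_comp mF (@measurable_swap _ _ (measurableTypeR R) (measurableTypeR R))).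
    by move=> z; exact: F0.
  - by move=> y; rewrite /= in_itv/= andbT; exact: inner.
apply: ge0_le_integral => //.
- exact: measurable_itv.
- by move=> p _; rewrite mule_ge0// integral_ge0.
- apply: emeasurable_funM => //; apply: (measurable_funS measurableT) => //.
  exact: (@measurable_integral_tonelli _ _ (measurableTypeR R) (measurableTypeR R) R lsm pos F).
- apply: emeasurable_funM.
    by apply/measurable_EFinP; apply: measurable_funTS; exact: measurable_negbin_div.
  by apply: measurable_funTS; exact: measurable_cond_risk.
move=> p Jp; have p0 := J0 p Jp; have [pM1 pM2] := JP p Jp.
have [_ p1 pmf] := Hpmf p pM1 pM2.
apply: (@le_trans _ _ ((theta * gamma_pdf r (p * n%:R))%:E * cond_risk n p)%E); last first.
  by rewrite lee_wpmul2r// lee_fin.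
rewrite EFinM -muleA lee_wpmul2l ?lee_fin//.
rewrite /cond_risk -ge0_integralZl//; last 3 first.
- apply/measurable_EFinP; apply: measurable_funTS; apply: (measurableT_comp mL).
  by apply: measurable_funM.
- by move=> y _; rewrite lee_fin.
- by rewrite lee_fin gamma_pdf_ge0// mulr_ge0// ltW.
rewrite le_eqVlt; apply/orP; left; apply/eqP; apply: eq_integral => y _.
by rewrite /F /= gtr0_norm// EFinM.
Qed.

(** Averaging over [[1 / (M * N), M / m]] would give [c2 * ln(N / m) <= c * (ln(N / m) + 2 * ln M)]:
    the truncation costs the fixed [2 * ln M], and since [c < c2] this fails once [N / m] is
    large. *)
Lemma risk_unbounded_near0 (c c1 M b : R) : 0 <= c -> c < c1 -> 1 < M -> 0 < b ->
  (forall Omega, 0 < Omega -> (c1%:E <= eta_core r L M Omega)%E) ->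
  ~ (forall p, 0 < p -> p < b -> (risk r L Pi p <= c%:E)%E).
Proof.
move=> c0 cc1 M1 b0 Hcore Hrisk.
have M0 : 0 < M := lt_trans ltr01 M1.
have c10 : 0 < c1 := le_lt_trans c0 cc1.
(* [c2] lies strictly between [c] and [c1], and [theta = c2 / c1 < 1] is the factor conceded when
   the mass function is replaced by the gamma density. *)
pose c2 := (c + c1) / 2; pose theta := c2 / c1.
have cc2 : c < c2 by rewrite /c2; lra.
have th0 : 0 <= theta by rewrite divr_ge0 ?(ltW c10)// (le_trans c0)// ltW.
have th1 : theta < 1 by rewrite /theta ltr_pdivrMr// mul1r /c2; lra.
have thc1 : theta * c1 = c2 by rewrite /theta divfK// gt_eqF.
have [n0 Hn0] := negbin_pmf_ge_gamma r0 M1 th1.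
pose b1 := Num.min b 1.
have b10 : 0 < b1 by rewrite lt_min b0 ltr01.
(* From [m] on, the comparison with the gamma density holds, [n >= r], and the window
   [[1 / (M * n), M / n]] lies in [(0, b)] and below 1. *)
pose m := maxn (maxn n0 r) (Num.truncn (M / b1)).+1.
have n0m : (n0 <= m)%N by rewrite /m -maxnA leq_maxl.
have rm : (r <= m)%N by rewrite /m maxnAC leq_maxr.
have m0 : (0 < m)%N by apply: leq_trans rm.
have mR0 : 0 < m%:R :> R by rewrite ltr0n.
have Mmb : M / m%:R < b1.
  rewrite ltr_pdivrMr// mulrC -ltr_pdivrMr//; apply: (lt_le_trans (truncnS_gt _)).
  by rewrite ler_nat leq_maxr.
have key N : (m < N)%N -> c2 * (ln N%:R - ln m%:R) <=
    c * (ln (M / m%:R) - ln (M * N%:R)^-1).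
  move=> mN; have NR0 : 0 < N%:R :> R by rewrite ltr0n (leq_trans _ mN).
  pose I := (`[(M * N%:R)^-1, M / m%:R]%classic : set R).
  have mI : measurable I by exact: measurable_itv.
  have aI : (M * N%:R)^-1 < M / m%:R.
    rewrite invfM ltr_pM ?invr_ge0 ?(ltW M0) ?(ltW NR0)//.
      by apply: (lt_trans _ M1); rewrite invf_lt1.
    by rewrite ltf_pV2 ?posrE// ltr_nat.
  have a0 : 0 < (M * N%:R)^-1 by rewrite invr_gt0 mulr_gt0.
  have IP p : I p -> [/\ 0 < p, p < b & p <= 1].
    rewrite /I /= in_itv/= => /andP[p1 p2].
    have := le_lt_trans p2 Mmb; rewrite lt_min => /andP[pb p11].
    by split; [exact: lt_le_trans p1 | | exact: ltW].
  pose G n p := ((negbin_pmf r p n / p)%:E * cond_risk n p)%E.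
  have mG n D : measurable_fun D (G n).
    apply: measurable_funTS; apply: emeasurable_funM; last exact: measurable_cond_risk.
    by apply/measurable_EFinP; exact: measurable_negbin_div.
  have G0 n p : I p -> (0 <= G n p)%E.
    move=> Ip; have [p0 _ p1] := IP p Ip; rewrite mule_ge0// lee_fin divr_ge0 ?(ltW p0)//.
    by rewrite negbin_pmf_ge0 ?(ltW p0).
  have up : (\int[mu]_(p in I) \sum_(i <- index_iota m N) G i p <=
      (c * (ln (M / m%:R) - ln (M * N%:R)^-1))%:E)%E.
    rewrite EFinM -(integral_invr a0 aI) -ge0_integralZl//; last 2 first.
    - by apply/measurable_EFinP; apply: measurable_funTS; exact: measurable_inv.
    - by move=> p /IP[p0 _ _]; rewrite lee_fin invr_ge0 ltW.
    apply: ge0_le_integral => //.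
    - by move=> p Ip; apply: sume_ge0 => i _; exact: G0.
    - by apply: emeasurable_sum => i; exact: mG.
    - by apply: emeasurable_funM => //; apply/measurable_EFinP;
        apply: measurable_funTS; exact: measurable_inv.
    move=> p Ip; have [p0 pb p1] := IP p Ip.
    rewrite (eq_bigr (fun i => (p^-1)%:E * ((negbin_pmf r p i)%:E * cond_risk i p)))%E; last first.
      by move=> i _; rewrite /G mulrC EFinM muleA.
    rewrite -ge0_sume_distrr; last first.
      by move=> i _; rewrite mule_ge0// lee_fin negbin_pmf_ge0 ?(ltW p0).
    rewrite muleC lee_wpmul2r ?lee_fin ?invr_ge0 ?(ltW p0)//.
    apply: le_trans (Hrisk p p0 pb); rewrite /risk.
    apply: le_trans (nneseries_lim_ge N _); last first.
      by move=> i _ _; rewrite mule_ge0// ?cond_risk_ge0// lee_fin negbin_pmf_ge0 ?(ltW p0).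
    rewrite [leRHS](big_cat_nat rm (ltnW mN))//= leeDr//; apply: sume_ge0 => i _.
    by rewrite mule_ge0// ?cond_risk_ge0// lee_fin negbin_pmf_ge0 ?(ltW p0).
  rewrite -lee_fin; apply: le_trans up.
  rewrite ge0_integral_sum//; last by move=> i; exact: mG.
  apply: (@le_trans _ _ (\sum_(i <- index_iota m N) (c2 / i%:R)%:E)%E).
    rewrite sumEFin lee_fin -mulr_sumr ler_wpM2l//.
      by rewrite (le_trans c0)// ltW.
    exact: ln_le_harmonic m0 (ltnW mN).
  rewrite big_seq [leRHS]big_seq; apply: lee_sum => i.
  rewrite mem_index_iota => /andP[mi iN].
  have iR0 : 0 < i%:R :> R by rewrite ltr0n (leq_trans m0).
  rewrite -thc1; apply: le_trans (cond_risk_average (n := i) M1 th0 (ltW c10) _ _ Hcore) _.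
  - exact: leq_trans mi.
  - by move=> p p1 p2; have [] := Hn0 i p (leq_trans n0m mi) p1 p2.
  apply: ge0_subset_integral => //.
  - exact: mG.
  - by move=> p; exact: G0.
  apply: subset_itv; rewrite bnd_simp.
    by rewrite lef_pV2 ?posrE ?mulr_gt0// ler_pM2l// ler_nat ltnW.
  by rewrite ler_pM2l// lef_pV2 ?posrE// ler_nat.
(* With [N = m * K], [key] reads [(c2 - c) * ln K <= 2 * c * ln M], that is [ln K <= X]; the shift
   by 2 in [K] also gives [K >= 2], hence [m < m * K]. *)
pose X := 2 * c * ln M / (c2 - c).
pose K := (Num.truncn (expR X)).+2.
have lnK : X < ln K%:R.
  rewrite -[ltLHS]expRK ltr_ln ?posrE ?expR_gt0//.
  by apply: (lt_trans (truncnS_gt _)); rewrite ltr_nat.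
have := key (m * K)%N; rewrite -{1}[m]muln1 ltn_pmul2l// => /(_ isT).
rewrite natrM invfM [ln (_ / _)]ln_div ?posrE// lnM ?posrE//.
rewrite [ln (_ * _)]lnM ?posrE ?invr_gt0 ?mulr_gt0// !lnV ?posrE ?mulr_gt0// lnM ?posrE//.
move: lnK; rewrite /X ltr_pdivrMr ?subr_gt0//; nra.
Qed.

End lower_bound.

(** * Consequences of the shape of the loss *)

Section loss_shape.
Context {R : realType}.
Implicit Types (L : R -> R).

Lemma class_C_MVT t L (a b : R) i x y : class_C t L a b -> (i < t)%N ->
  a < x -> x < y -> y < b -> exists2 c, x < c < y &
    derive1n i L y - derive1n i L x = derive1n i.+1 L c * (y - x).
Proof.
move=> [dL _] it ax xy yb.
have dv z : z \in `[x, y] -> derivable (derive1n i L) z 1.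
  rewrite in_itv/= => /andP[z1 z2]; apply: dL => //.
  by rewrite in_itv/= (lt_le_trans ax)// (le_lt_trans z2).
have isd z : z \in `]x, y[ -> is_derive z 1 (derive1n i L) (derive1n i.+1 L z).
  rewrite in_itv/= => /andP[z1 z2].
  change (is_derive z 1 (derive1n i L) (derive1 (derive1n i L) z)).
  rewrite derive1E; apply/derivableP; apply: dv.
  by rewrite in_itv/= !ltW.
have [c cxy e] := MVT xy isd (derivable_within_continuous dv).
by exists c => //; move: cxy; rewrite in_itv.
Qed.

(** Induction downwards on the order: near [x0] the derivative of order [t] keeps its sign, and each
    lower one vanishes at [x0], so by the mean value theorem on [[x, x0]] it has the opposite sign
    on the left. After [t - 1] reversals the factor [(-1) ^ (t-1)] makes the first derivative
    positive. *)
Lemma increasing_before_critical_point t L (a b x0 : R) : (0 < t)%N ->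
  a < x0 -> x0 < b -> class_C t L a b ->
  (forall i, (0 < i)%N -> (i < t)%N -> derive1n i L x0 = 0) ->
  0 < (-1) ^+ t.-1 * derive1n t L x0 ->
  exists2 d, [/\ 0 < d & a <= x0 - d] &
    forall x y, x0 - d < x -> x < y -> y <= x0 -> L x < L y.
Proof.
move=> t0 ax xb CL d0 dt; have [_ cL] := CL.
have := cL x0; rewrite in_itv/= ax xb => /(_ isT) ct.
have : \forall x \near x0, 0 < (-1) ^+ t.-1 * derive1n t L x.
  have : (-1) ^+ t.-1 * derive1n t L x @[x --> x0] --> (-1) ^+ t.-1 * derive1n t L x0.
    by apply: cvgMr; exact: ct.
  by move/cvgr_gt; apply.
move=> /nbhs_ballP[e /= e0 He].
pose d := Num.min e (x0 - a); have dpos : 0 < d by rewrite lt_min e0 subr_gt0.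
have dxa : a <= x0 - d by rewrite lerBrDl -lerBrDr ge_min lexx orbT.
exists d; first by split.
have pos i : (i < t)%N -> forall x, x0 - d < x -> x < x0 ->
    0 < (-1) ^+ (t - i).-1 * derive1n (t - i) L x.
  elim: i => [_ x x1 x2|i IH it x x1 x2].
    rewrite subn0; apply: He; rewrite /ball /= gtr0_norm ?subr_gt0//.
    by rewrite ltrBlDr -ltrBlDl (le_lt_trans _ x1)// lerB// ge_min lexx.
  have h1 : (0 < t - i.+1)%N by rewrite subn_gt0.
  have it' : (t - i.+1 < t)%N by rewrite ltn_subrL t0.
  have [c /andP[c1 c2]] := class_C_MVT CL it' (le_lt_trans dxa x1) x2 xb.
  rewrite d0// ?ltn_subrL ?t0// sub0r subnSK ?(ltnW it)// => e1.
  have := IH (ltnW it) c (lt_trans x1 c1) c2.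
  have -> : (t - i).-1 = (t - i.+1).-1.+1 by rewrite subnS prednK// -subnS.
  rewrite exprS mulN1r mulNr -mulrN => h; move: e1 => /(congr1 -%R); rewrite opprK => ->.
  by rewrite -mulNr mulrA mulr_gt0// subr_gt0.
move=> x y x1 xy yx0.
have [c /andP[c1 c2]] := class_C_MVT CL t0 (le_lt_trans dxa x1) xy (le_lt_trans yx0 xb).
rewrite /= => e1; rewrite -subr_gt0 e1 mulr_gt0 ?subr_gt0//.
have := pos t.-1; rewrite prednK// => /(_ (leqnn _) c (lt_trans x1 c1) (lt_le_trans c2 yx0)).
have -> : (t - t.-1 = 1)%N by rewrite -[t.-1]subn1 subKn.
by rewrite /= expr0 mul1r.
Qed.

(** Puts both forms of (5) into one shape, the one needed to compare [eta_bar] with the supremum of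
    [L]: a dip [(a, b)] where [L <= l], followed after [x1] by values at least [m > l]. Nothing is
    claimed of [L x1] when [L] jumps there. *)
Lemma dip_before (L : R -> R) (x1 : R) : 0 < x1 ->
  (forall x, 0 < x -> 0 <= L x) ->
  {in `]x1, +oo[ &, {homo L : x y / x <= y}} ->
  (exists l1 l2 : R, [/\ L x @[x --> x1^'-] --> l1, L x @[x --> x1^'+] --> l2 & l1 < l2])
  \/ (exists t : nat, [/\ (0 < t)%N,
       exists a b : R, [/\ 0 <= a, a < x1, x1 < b & class_C t L a b],
       forall i, (0 < i)%N -> (i < t)%N -> derive1n i L x1 = 0
     & 0 < (-1) ^+ t.-1 * derive1n t L x1]) ->
  exists a b l m : R, [/\ 0 < a, a < b, b <= x1, 0 <= l & l < m] /\
    [/\ forall x, a < x -> x < b -> L x <= l,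
        forall x, b <= x -> x < x1 -> L x <= m &
        forall x, x1 < x -> m <= L x].
Proof.
move=> x10 L0 mono.
have right_le l2 : L x @[x --> x1^'+] --> l2 -> forall x, x1 < x -> l2 <= L x.
  move=> cl x xx; apply: (cvgr_to_le cl); near=> y; apply: mono.
  - by rewrite in_itv/= andbT.
  - by rewrite in_itv/= andbT.
  - by near: y; exact: nbhs_right_le.
case=> [[l1 [l2 [c1 c2 l12]]]|[t [t0 [a [b [a0 ax xb CL]]] d0 dt]]].
  have lm : l1 < (l1 + l2) / 2 by lra.
  have ml : (l1 + l2) / 2 < l2 by lra.
  have /cvgr_lt/(_ _ lm)[e /= e0 He] := c1.
  pose d := Num.min e x1; have dp : 0 < d by rewrite lt_min e0.
  have Ll x : x1 - d < x -> x < x1 -> L x <= (l1 + l2) / 2.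
    move=> h1 h2; apply/ltW/He => //; rewrite /ball /= gtr0_norm ?subr_gt0//.
    by rewrite ltrBlDr -ltrBlDl (le_lt_trans _ h1)// lerB// ge_min lexx.
  have x1d : 0 <= x1 - d by rewrite subr_ge0 ge_min lexx orbT.
  (* With a jump, the dip reaches up to [x1]: [l] is the midpoint of the one-sided limits and the
     middle range is empty. *)
  exists (x1 - d / 2), x1, ((l1 + l2) / 2), l2; split; split => //.
  - by lra.
  - by lra.
  - by apply: le_trans (Ll (x1 - d / 2) _ _); [apply: L0; lra|lra|lra].
  - by move=> x h1 h2; apply: Ll => //; lra.
  - by move=> x h1 h2; have := le_lt_trans h1 h2; rewrite ltxx.
  - exact: right_le.
have [d [dp ad] inc] := increasing_before_critical_point t0 ax xb CL d0 dt.
have cx : L x @[x --> x1^'+] --> L x1.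
  apply: cvg_at_right_filter; case: CL => dL _.
  apply: differentiable_continuous; apply/derivable1_diffP.
  by apply: (dL 0%N) => //; rewrite in_itv/= ax xb.
(* Stopping at [x1 - d / 4] leaves room for a strict increase from [l] to [m = L x1]; the values in
   between are at most [m]. *)
exists (x1 - d / 2), (x1 - d / 4), (L (x1 - d / 4)), (L x1); split; split => //.
- by lra.
- by lra.
- by lra.
- by apply: L0; lra.
- by apply: inc; lra.
- by move=> x h1 h2; apply/ltW/inc; lra.
- by move=> x h1 h2; apply/ltW/inc; lra.
- exact: right_le.
Unshelve. all: by end_near. Qed.

End loss_shape.

(** * Growth bounds, and extension of the loss to the real line *)

Section extension.
Context {R : realType}.
Implicit Types (L : R -> R) (r : nat).
Local Notation mu := (@lebesgue_measure R).
Local Notation pos := (`]0%R, +oo[%classic : set R).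

Lemma bounded_variation_bounded L (a b : R) : a <= b -> bounded_variation a b L ->
  exists2 A, 0 <= A & forall x, a <= x -> x <= b -> L x <= A.
Proof.
move=> ab /(bounded_variationP _ ab) TVfin.
exists (`|L a| + fine (total_variation a b L)).
  by rewrite addr_ge0// fine_ge0// total_variation_ge0.
move=> x ax xb; rewrite -lerBlDl; apply: (@le_trans _ _ `|L x - L a|).
  by apply: le_trans (ler_norm _); rewrite lerB// ler_norm.
rewrite -lee_fin fineK// (total_variationD L ax xb).
by apply: (le_trans (total_variation_ge L ax)); rewrite leeDl// total_variation_ge0.
Qed.

(** The finite exceptional set is closed and all its subsets are measurable; off it, [L] is
    continuous on an open set. *)
Lemma measurable_fun_finite_discontinuities L :
  finite_set [set x | 0 < x /\ ~ {for x, continuous L}] -> measurable_fun pos L.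
Proof.
set S := [set x | _]; move=> fS.
have cS : closed S by apply: accessible_finite_set_closed.1 fS; exact/hausdorff_accessible/norm_hausdorff.
have Spos : S `<=` pos by move=> x [x0 _]; rewrite /= in_itv/= x0.
have mS B : B `<=` S -> measurable B.
  move=> BS; apply: countable_measurable; first exact: measurable_set1.
  exact/finite_set_countable/(sub_finite_set BS).
have -> : pos = S `|` (pos `\` S) by rewrite setDUK.
apply/measurable_funU; [exact: mS|by apply: measurableD => //; exact: mS|split].
  by move=> _ B mB; apply: mS; exact: subIsetl.
apply: open_continuous_measurable_fun.
  by apply: openI; [exact: interval_open|exact: closed_openC].
move=> x /set_mem[]; rewrite /= in_itv/= andbT => x0 /not_andP[//|].
by move/contrapT.
Qed.

(** Nothing is assumed of [L] on [(-oo, 0]], whereas measurability and non-negativity are used on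
    the whole line; [eta_bar] at [Omega > 0] and the risk at [p > 0] see positive arguments only. *)
Definition positive_extension L (x : R) : R := if 0 < x then L x else 0.

Lemma positive_extensionE L x : 0 < x -> positive_extension L x = L x.
Proof. by rewrite /positive_extension => ->. Qed.

Lemma measurable_positive_extension L : measurable_fun pos L ->
  measurable_fun setT (positive_extension L).
Proof.
move=> mL; apply: measurable_fun_if => //.
- by apply: measurable_fun_ltr.
- rewrite setTI; apply: measurable_funS mL => //.
  by move=> x /= x0; rewrite in_itv /= x0.
Qed.

Lemma admissible_positive_extension r L : (0 < r)%N ->
  (forall x, 0 < x -> 0 <= L x) ->
  (forall x1 x2, 0 < x1 -> x1 < x2 -> bounded_variation x1 x2 L) ->
  finite_set [set x | 0 < x /\ ~ {for x, continuous L}] ->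
  (exists K : R, Theta_at_0 L (fun x => x `^ K)) ->
  (exists2 K : R, K < r%:R & Theta_at_infty L (fun x => x `^ K)) ->
  admissible r (positive_extension L).
Proof.
move=> r0 L0 BV fS [K [a [m [M [a0 _ M0 HK]]]]] [K' K'r [a' [m' [M' [a'0 _ M'0 HK']]]]].
split.
- apply: measurable_positive_extension.
  exact: measurable_fun_finite_discontinuities.
- by move=> x; rewrite /positive_extension; case: ifPn => [/L0|].
(* [k >= |K|] turns [x ^ K] into [x ^- k] for [x <= 1]; [kap] is halfway between [max(r-1, K')] and
   [r], so it is above [K'] and in the range that [admissible] asks for. Between the two ends,
   bounded variation bounds [L], and [x ^- k + x ^ kap >= 1]. *)
pose k := (Num.truncn `|K|).+1.
pose kap := (Num.max r.-1%:R K' + r%:R) / 2.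
have mr : Num.max r.-1%:R K' < r%:R by rewrite gt_max K'r andbT ltr_nat prednK.
have kap1 : Num.max r.-1%:R K' < kap by rewrite /kap; lra.
have kap2 : kap < r%:R by rewrite /kap; lra.
have rk : r.-1%:R < kap by apply: le_lt_trans kap1; rewrite le_max lexx.
have kap0 : 0 <= kap by apply: le_trans (ltW rk).
pose u := Num.min a 1; pose v := Num.max a' 1.
have u0 : 0 < u by rewrite lt_min a0 ltr01.
have u1 : u <= 1 by rewrite ge_min lexx orbT.
have v1 : 1 <= v by rewrite le_max lexx orbT.
have uv : u < v + 1 by apply: le_lt_trans u1 _; lra.
have [B B0 HB] := bounded_variation_bounded (ltW uv) (BV _ _ u0 uv).
exists k, kap, (M + M' + B); split => //; first by lra.
move=> x x0; rewrite positive_extensionE//.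
have e1 : 0 <= x ^- k by rewrite invr_ge0 exprn_ge0// ltW.
have e2 : 0 <= x `^ kap by exact: powR_ge0.
have [xu|ux] := leP x u.
  have x1 := le_trans xu u1.
  apply: (@le_trans _ _ (M * x `^ K)).
    by apply: (HK x x0 _).2; apply: le_trans xu _; rewrite ge_min lexx.
  apply: (@le_trans _ _ (M * x ^- k)); last by nra.
  rewrite ler_pM2l// -powR_invn ?(ltW x0)//; apply: ger_powR; first by rewrite x0.
  rewrite lerNl; apply: le_trans (ler_norm _) _; rewrite normrN.
  exact/ltW/truncnS_gt.
have [vx|xv] := leP v x.
  have x1 := le_trans v1 vx.
  apply: (@le_trans _ _ (M' * x `^ K')).
    by apply: (HK' x _).2; apply: le_trans vx; rewrite le_max lexx.
  apply: (@le_trans _ _ (M' * x `^ kap)); last by nra.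
  rewrite ler_pM2l//; apply: ler_powR => //; apply: le_trans (ltW kap1).
  by rewrite le_max lexx orbT.
have LB : L x <= B by apply: HB; [exact: ltW|lra].
have e3 : 1 <= x ^- k + x `^ kap.
  have [x1|x1] := leP x 1.
    have : 1 <= x ^- k by rewrite invf_ge1 ?exprn_gt0// exprn_ile1// ltW.
    by lra.
  have : 1 <= x `^ kap by rewrite -[leLHS](powRr0 x) ler_powR// ltW.
  by lra.
by nra.
Qed.

Lemma eta_bar_positive_extension r L Omega : 0 < Omega ->
  eta_bar r (positive_extension L) Omega = eta_bar r L Omega.
Proof.
move=> O0; apply: eq_integral => nu /set_mem; rewrite /= in_itv/= andbT => nu0.
by rewrite positive_extensionE// divr_gt0.
Qed.

Lemma eta_bar_values_positive_extension r L :
  eta_bar_values r (positive_extension L) = eta_bar_values r L.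
Proof.
by apply/seteqP; split => _ [Om O0 <-]; exists Om => //;
  rewrite eta_bar_positive_extension.
Qed.

Lemma risk_positive_extension r L Pi p : 0 < p ->
  risk r (positive_extension L) Pi p = risk r L Pi p.
Proof.
move=> p0; apply: eq_eseriesr => n _; congr (_ * _)%E.
apply: eq_integral => y /set_mem; rewrite /= in_itv/= andbT => y0.
by rewrite positive_extensionE// divr_gt0.
Qed.

End extension.

(** * The loss near infinity exceeds [eta_star] *)

Section dichotomy.
Context {R : realType}.
Variables (r : nat) (L : R -> R).
Hypothesis r0 : (0 < r)%N.
Hypothesis aL : admissible r L.
Local Notation mu := (@lebesgue_measure R).
Local Notation pos := (`]0%R, +oo[%classic : set R).

(* The value of [L] at the single point [x1] is unconstrained, and irrelevant to [eta_bar]. *)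
Let cap (x1 l : R) := fun x => if x == x1 then Num.min (L x) l else L x.

Let admissible_cap x1 l : 0 <= l -> admissible r (cap x1 l).
Proof.
move=> l0; case: (aL) => mL L0 [k [kap [A [rk kr A0 LA]]]]; split.
- apply: measurable_fun_ifT => //.
  + by apply: measurable_fun_eqr.
  + exact: measurable_minr.
- by move=> x; rewrite /cap; case: ifP => // _; rewrite le_min L0.
- exists k, kap, A; split => // x x0; apply: le_trans (LA x x0).
  by rewrite /cap; case: ifP => // _; rewrite ge_min lexx.
Qed.

Let eta_bar_cap x1 l Omega : 0 < x1 -> 0 <= l -> 0 < Omega ->
  eta_bar r (cap x1 l) Omega = eta_bar r L Omega.
Proof.
move=> x10 l0 O0; apply: ae_eq_integral => //.
- exact: (measurable_eta_bar_integrand (admissible_cap x1 l0)).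
- exact: (measurable_eta_bar_integrand aL).
exists [set Omega / x1]; split => //; first exact: lebesgue_measure_set1.
move=> nu /= H; apply: contrapT => Hnu; apply: H; rewrite in_itv/= andbT => nu0.
rewrite /cap; case: eqP => // e; exfalso; apply: Hnu; rewrite -e.
by field; rewrite !gt_eqF.
Qed.

(** If [L] is unbounded on [(x1, +oo)], monotonicity makes it eventually exceed any level above
    [eta_star]. Otherwise let [c] be its supremum there: beyond the dip [L], once capped at [x1], is
    at most [c], so some [eta_bar Omega] is below [c], and a level strictly between [eta_star] and
    [c] is reached. *)
Lemma eta_star_lt_large_loss (x1 a b l m : R) :
  0 < x1 -> {in `]x1, +oo[ &, {homo L : x y / x <= y}} ->
  0 < a -> a < b -> b <= x1 -> 0 <= l -> l < m ->
  (forall x, a < x -> x < b -> L x <= l) ->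
  (forall x, b <= x -> x < x1 -> L x <= m) ->
  (forall x, x1 < x -> m <= L x) ->
  exists c Delta, (eta_star r L < c%:E)%E /\ forall x, Delta < x -> c <= L x.
Proof.
move=> x10 mono a0 ab bx1 l0 lm Ll Lm mL.
have efin := eta_star_fin_num r0 aL.
have ge_from c x0 : x1 < x0 -> c <= L x0 -> forall x, x0 < x -> c <= L x.
  move=> h1 h2 x h3; apply: le_trans h2 _; apply: mono.
  - by rewrite in_itv/= h1.
  - by rewrite in_itv/= (lt_trans h1).
  - exact: ltW.
pose S := [set L x | x in `]x1, +oo[%classic].
have S0 : S !=set0 by exists (L (x1 + 1)), (x1 + 1) => //=; rewrite in_itv/= ltrDl ltr01.
have [[B ubB]|nub] := pselect (has_ubound S); last first.
  exists (fine (eta_star r L) + 1).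
  have : exists2 x0, x1 < x0 & fine (eta_star r L) + 1 <= L x0.
    apply: contrapT => H; apply: nub; exists (fine (eta_star r L) + 1).
    move=> y [x]; rewrite /= in_itv/= andbT => xx <-; rewrite leNgt; apply/negP => h.
    by apply: H; exists x => //; exact: ltW.
  move=> [x0 h1 h2]; exists x0; split; last exact: ge_from.
  by rewrite -[ltLHS]fineK// lte_fin ltrDl.
have hsS : has_sup S by split => //; exists B.
pose c := sup S.
have Lc x : x1 < x -> L x <= c.
  by move=> h; apply: sup_upper_bound => //; exists x => //=; rewrite in_itv/= h.
have mc : m <= c by apply: le_trans (Lc (x1 + 1) _); [apply: mL|]; rewrite ltrDl.
have capl x : a < x -> x < b -> cap x1 l x <= l.
  by move=> h1 h2; rewrite /cap lt_eqF ?(lt_le_trans h2)//; exact: Ll.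
have capc x : b <= x -> cap x1 l x <= c.
  move=> bx; rewrite /cap; case: eqVneq => [_|xx1].
    by rewrite ge_min; apply/orP; right; exact: le_trans (ltW lm) mc.
  case: (ltP x x1) => h; first exact: le_trans (Lm x bx h) mc.
  by apply: Lc; rewrite lt_neqAle eq_sym xx1.
have [Om O0] := eta_bar_lt_large r0 (admissible_cap x1 l0) a0 ab l0 (lt_le_trans lm mc) capl capc.
rewrite eta_bar_cap// => Hc.
pose e := fine (eta_star r L).
have ec : e < c.
  by rewrite -lte_fin fineK//; apply: le_lt_trans Hc; exact: eta_star_le.
have [y [x0]] : exists2 y, S y & (e + c) / 2 < y.
  by apply: sup_gt => //; rewrite -/c; lra.
rewrite /= in_itv/= andbT => h1 <- h2.
exists ((e + c) / 2), x0; split.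
  by rewrite -[ltLHS]fineK// lte_fin -/e; lra.
by apply: ge_from => //; exact: ltW.
Qed.
End dichotomy.

(** * Optimal estimators *)

Section point_mass.
Context {R : realType}.
Local Notation mu := (@lebesgue_measure R).
Local Notation pos := (`]0%R, +oo[%classic : set R).

Definition point_mass_cdf (a x : R) : R := (a <= x)%R%:R.

Let point_mass_nd a : nondecreasing (point_mass_cdf a).
Proof.
move=> x y xy; rewrite /point_mass_cdf ler_nat.
by case: (boolP (a <= x)) => // ax; rewrite (le_trans ax xy).
Qed.

Let point_mass_rc a : right_continuous (point_mass_cdf a).
Proof.
move=> x; apply: cvg_near_cst; rewrite /point_mass_cdf.
have [ax|xa] := leP a x.
  near=> y; have xy : x < y by near: y; exact: nbhs_right_gt.
  by rewrite (le_trans ax)// ltW.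
near=> y; have ya : y < a by near: y; exact: nbhs_right_lt.
by rewrite leNgt ya.
Unshelve. all: by end_near. Qed.

HB.instance Definition _ a :=
  isCumulative.Build R _ R (point_mass_cdf a) (@point_mass_nd a) (@point_mass_rc a).

Let point_mass_Ny a : point_mass_cdf a @ -oo --> (0 : R).
Proof.
apply: cvg_near_cst; near=> y; rewrite /point_mass_cdf leNgt.
by have -> : y < a by near: y; apply: nbhs_ninfty_lt; exact: num_real.
Unshelve. all: by end_near. Qed.

Let point_mass_y a : point_mass_cdf a @ +oo --> (1 : R).
Proof.
apply: cvg_near_cst; near=> y; rewrite /point_mass_cdf.
by have -> : a <= y by near: y; apply: nbhs_pinfty_ge; exact: num_real.
Unshelve. all: by end_near. Qed.

HB.instance Definition _ a :=
  isCumulativeBounded.Build R 0 1 (point_mass_cdf a) (@point_mass_Ny a) (@point_mass_y a).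

Definition point_mass (a : R) : cumulativeBounded (0 : R) (1 : R) := point_mass_cdf a.

Lemma lebesgue_stieltjes_point_mass (a : R) (X : set (measurableTypeR R)) :
  measurable X -> lebesgue_stieltjes_measure (point_mass a) X = \d_a X.
Proof.
apply: (@lebesgue_stieltjes_measure_unique R (point_mass a)
  (@dirac _ (measurableTypeR R) a R)) => _ [[x y] _ <-] /=.
rewrite /lebesgue_stieltjes_measure /measure_extension measurable_mu_extE/=; last exact: is_ocitv.
have [xy|yx] := leP x y.
  rewrite wlength_itv_bnd//= diracE /point_mass_cdf; congr EFin.
  rewrite mem_setE in_itv/=.
  have [ax|xa] := leP a x; first by rewrite (le_trans ax xy) subrr.
  by rewrite subr0.
by rewrite set_itv_ge ?bnd_simp -?leNgt ?(ltW yx)// measure0 dirac0.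
Qed.

Lemma integral_point_mass (a : R) (f : R -> \bar R) : 0 < a ->
  measurable_fun setT f ->
  (\int[lebesgue_stieltjes_measure (point_mass a)]_(y in pos) f y = f a)%E.
Proof.
move=> a0 mf; rewrite (@eq_measure_integral _ (measurableTypeR R) R pos
  (@dirac _ (measurableTypeR R) a R))//; last first.
  by move=> A mA _; exact: lebesgue_stieltjes_point_mass.
rewrite integral_dirac//.
  by rewrite diracE mem_set ?mul1e//= in_itv/= a0.
exact: measurable_funTS.
Qed.

Lemma estimator_point_mass r (g : nat -> R) :
  (forall n, (r <= n)%N -> 0 < g n) -> estimator r (fun n => point_mass (g n)).
Proof.
move=> g0 n rn; rewrite /point_mass.
by change (point_mass_cdf (g n) 0 = 0); rewrite /point_mass_cdf leNgt g0.
Qed.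

End point_mass.

(** * The limiting risk of two explicit estimators *)

Section upper_bound.
Context {R : realType}.
Variables (r : nat) (L : R -> R).
Hypothesis r0 : (0 < r)%N.
Hypothesis aL : admissible r L.
Local Notation mu := (@lebesgue_measure R).
Local Notation pos := (`]0%R, +oo[%classic : set R).

Lemma limf_esup_le (f h : R -> \bar R) (F : set_system R) (l : \bar R) : Filter F ->
  l \is a fin_num -> (\forall x \near F, (f x <= h x)%E) ->
  h x @[x --> F] --> l -> (limf_esup f F <= l)%E.
Proof.
move=> FF lfin fh hl; apply/lee_addgt0Pr => e e0.
have le : (l < l + e%:E)%E by rewrite lteDl// lte_fin.
have hlt : \forall x \near F, (h x < l + e%:E)%E.
  by apply: (hl [set y | (y < l + e%:E)%E]); exact: open_ereal_lt' le.
have fl : \forall x \near F, (f x <= l + e%:E)%E.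
  by apply: filterS2 fh hlt => x h1 h2; exact: le_trans h1 (ltW h2).
apply: (@le_trans _ _ (ereal_sup (f @` [set x | (f x <= l + e%:E)%E]))).
  by apply: ereal_inf_lbound; exists [set x | (f x <= l + e%:E)%E].
by apply: ge_ereal_sup => _ [x /= ? <-].
Qed.

Lemma risk_point_mass (g : nat -> R) p : (forall n, (r <= n)%N -> 0 < g n) ->
  risk r L (fun n => point_mass (g n)) p =
  (\sum_(r <= n <oo) (negbin_pmf r p n * L (g n / p))%:E)%E.
Proof.
move=> g0; apply/congr_lim/funext => m.
rewrite big_nat_cond [RHS]big_nat_cond; apply: eq_bigr => n /andP[/andP[rn _] _].
rewrite integral_point_mass ?g0//.
apply/measurable_EFinP; apply: (measurableT_comp (admissible_measurable aL)).
exact: measurable_funM.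
Qed.

Lemma cvg_risk_inverse (Omega : R) : 0 < Omega ->
  finite_set [set x | 0 < x /\ ~ {for x, continuous L}] ->
  risk r L (fun n => point_mass (Omega / n%:R)) p @[p --> 0^'+] --> eta_bar r L Omega.
Proof.
move=> O0 fD.
have [W [mW W0 Woo HW]] := loss_dominated r0 aL Omega O0.
(* These [nu] are finitely many, since [nu] is recovered as [Omega / x] from a discontinuity [x] of
   [L]. *)
pose D := [set nu | 0 < nu /\ ~ {for (Omega / nu), continuous L}].
have cD : countable D.
  apply: finite_set_countable.
  apply: (@sub_finite_set _ _ ((fun x => Omega / x) @` [set x | 0 < x /\ ~ {for x, continuous L}])).
    move=> nu [nu0 h]; exists (Omega / nu); first by split => //; rewrite divr_gt0.
    by field; rewrite !gt_eqF.
  exact: finite_image.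
pose u p n := L (Omega / n%:R / p).
have u0 p n : 0 < p -> p < 1 -> 0 <= u p n.
  by move=> _ _; exact: admissible_ge0 aL _.
have uW nu p n : 0 < nu -> 0 < p -> p < 1 -> (r <= n)%N ->
    nu <= p * n%:R -> p * n%:R <= nu + 1 ->
    (p * n%:R) ^+ r.-1 * u p n * expR (- nu) <= W nu.
  move=> nu0 p0 p1 rn h1 h2; rewrite /u.
  have -> : Omega / n%:R / p = Omega / (p * n%:R).
    by rewrite invfM mulrA mulrAC.
  exact: HW.
have ul nu : 0 < nu -> ~ D nu ->
    u p (Num.truncn (nu / p) + r)%N @[p --> 0^'+] --> L (Omega / nu).
  move=> nu0 /not_andP[//|/contrapT cL].
  have cpr : p * r%:R @[p --> 0^'+] --> (0 : R).
    rewrite -[X in _ --> X](mul0r (r%:R : R)); apply: cvgM; last exact: cvg_cst.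
    by apply: cvg_at_right_filter; exact: cvg_id.
  have cx : p * (Num.truncn (nu / p) + r)%:R @[p --> 0^'+] --> nu.
    apply: (@squeeze_cvgr _ _ _ _ (fun=> nu) (fun p => nu + p * r%:R)).
    + near=> p; have p0 : 0 < p by near: p; exact: nbhs_right_gt.
      by have [-> ->] := step_bounds nu0 p0 r0.
    + exact: cvg_cst.
    + by rewrite -[X in _ --> X]addr0; apply: cvgD => //; exact: cvg_cst.
  have cO : Omega / (p * (Num.truncn (nu / p) + r)%:R) @[p --> 0^'+] --> Omega / nu.
    by apply: cvgM; [exact: cvg_cst|apply: cvgV => //; rewrite gt_eqF].
  have := @cvg_comp _ _ _ _ L _ _ _ cO cL.
  apply: cvg_trans; apply: near_eq_cvg; near=> p => /=.
  by rewrite /u /= -[in RHS]mulrA -invfM [_%:R * p]mulrC.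
have [_ cv] := negbin_sum_cvg r0 u0 mW W0 Woo uW (measurable_loss_div aL Omega (D := pos)) cD ul.
have g0 n : (r <= n)%N -> 0 < Omega / n%:R.
  by move=> rn; rewrite divr_gt0// ltr0n (leq_trans r0).
move: cv; apply: cvg_trans; apply: near_eq_cvg; near=> p.
by rewrite risk_point_mass.
Unshelve. all: by end_near. Qed.

(** The ratio of estimate to [p] is [p / (p * n) ^ 2], which tends to 0 for fixed [p * n]. [L] need
    not converge at 0, so the limit theorem is applied to the majorant of the loss made of [c] and a
    multiple of the power [kap], and only the limsup is bounded. *)
Lemma limsup_risk_inverse_square (xi c : R) : 0 < xi -> 0 <= c ->
  (forall x, 0 < x -> x < xi -> L x <= c) ->
  (limsup_risk r L (fun n => point_mass (n%:R ^- 2)) <= c%:E)%E.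
Proof.
move=> xi0 c0 Lc; have [kap [B [rk kr B0 HB]]] := loss_le_powR aL xi0 c0 Lc.
have kap0 : 0 < kap by apply: le_lt_trans rk.
have [C C0 HC] := gamma_weight_le_dominator 0 r0 rk.
pose s := kap - r.-1%:R.
have s0 : 0 <= s by rewrite subr_ge0 ltW.
have s1 : s < 1 by rewrite /s ltrBlDl natr1 prednK.
pose W nu := (c + B) * C * dominator s nu.
have cBC : 0 <= (c + B) * C by rewrite mulr_ge0 ?addr_ge0 ?(ltW B0) ?(ltW C0).
have W0 nu : 0 <= W nu by rewrite mulr_ge0// dominator_ge0.
have mW : measurable_fun setT W by apply: measurable_funM => //; exact: measurable_dominator.
have Woo : (\int[mu]_(nu in pos) (W nu)%:E < +oo)%E.
  under eq_integral do rewrite /W EFinM.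
  rewrite ge0_integralZl//; last 2 first.
  - by apply/measurable_EFinP; apply: measurable_funTS; exact: measurable_dominator.
  - by move=> nu _; rewrite lee_fin dominator_ge0.
  by rewrite lte_mul_pinfty// integral_dominator_lty.
pose u (p : R) (n : nat) := c + B * ((n%:R ^- 2) / p) `^ kap.
have u0 p n : 0 < p -> p < 1 -> 0 <= u p n.
  by move=> _ _; rewrite addr_ge0// mulr_ge0 ?powR_ge0// ltW.
have uW nu p n : 0 < nu -> 0 < p -> p < 1 -> (r <= n)%N ->
    nu <= p * n%:R -> p * n%:R <= nu + 1 ->
    (p * n%:R) ^+ r.-1 * u p n * expR (- nu) <= W nu.
  move=> nu0 p0 p1 rn h1 h2; set x := p * n%:R.
  have n0 : 0 < n%:R :> R by rewrite ltr0n (leq_trans r0).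
  have x0 : 0 < x by rewrite mulr_gt0.
  apply: (@le_trans _ _ ((c + B) * (x ^+ r.-1 * (x ^+ 0 + x `^ (- kap)) * expR (- nu)))).
    rewrite !mulrA ler_wpM2r ?expR_ge0// [leRHS]mulrAC mulrC ler_wpM2r ?exprn_ge0 ?(ltW x0)//.
    rewrite expr0 /u.
    (* Since [n >= 1], the ratio [1 / (p * n ^ 2)] is at most [1 / x], whose powers the dominator
       already handles. *)
    have h : ((n%:R ^- 2) / p) `^ kap <= x `^ (- kap).
      have -> : x `^ (- kap) = x^-1 `^ kap.
        by rewrite -[x^-1]powR_inv1 ?(ltW x0)// -powRrM mulN1r.
      apply: ge0_ler_powR; rewrite ?nnegrE ?(ltW kap0)//.
      + by rewrite divr_ge0 ?(ltW p0)// invr_ge0 exprn_ge0// ltW.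
      + by rewrite invr_ge0 ltW.
      rewrite -invfM lef_pV2 ?posrE ?mulr_gt0// ?exprn_gt0//.
      rewrite /x mulrC ler_wpM2r ?(ltW p0)// expr2 ler_peMr ?(ltW n0)// ler1n.
      exact: leq_trans r0 rn.
    have := powR_ge0 x (- kap); nra.
  by rewrite /W -[leRHS]mulrA ler_wpM2l ?addr_ge0 ?(ltW B0)//; exact: HC.
have ul nu : 0 < nu -> ~ (set0 : set R) nu ->
    u p (Num.truncn (nu / p) + r)%N @[p --> 0^'+] --> c.
  move=> nu0 _.
  pose g p := B * (nu ^- 2 * p) `^ kap.
  have cg : g p @[p --> 0^'+] --> (0 : R).
    rewrite -[X in _ --> X](mulr0 B); apply: cvgM; first exact: cvg_cst.
    have : (nu ^- 2) `^ kap * p `^ kap @[p --> 0^'+] --> (0 : R).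
      rewrite -[X in _ --> X](mulr0 ((nu ^- 2) `^ kap)); apply: cvgM; first exact: cvg_cst.
      exact: powR_cvg0.
    apply: cvg_trans; apply: near_eq_cvg; near=> p.
    by rewrite powRM// ?invr_ge0 ?exprn_ge0 ?(ltW nu0).
  apply: (@squeeze_cvgr _ _ _ _ (fun=> c) (fun p => c + g p)).
  + near=> p; have p0 : 0 < p by near: p; exact: nbhs_right_gt.
    have [h1 _ _] := step_bounds nu0 p0 r0; move: h1.
    rewrite /u /g; set n := (_ + r)%N => h1.
    have n0 : 0 < n%:R :> R by rewrite ltr0n addn_gt0 r0 orbT.
    rewrite lerDl mulr_ge0 ?powR_ge0 ?(ltW B0)//= lerD2l ler_wpM2l ?(ltW B0)//.
    apply: ge0_ler_powR; rewrite ?nnegrE ?(ltW kap0)//.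
    * by rewrite divr_ge0 ?(ltW p0)// invr_ge0 exprn_ge0// ltW.
    * by rewrite mulr_ge0 ?(ltW p0)// invr_ge0 exprn_ge0// ltW.
    rewrite -[X in nu ^- 2 * X]invrK -!invfM lef_pV2 ?posrE ?mulr_gt0 ?exprn_gt0 ?invr_gt0//.
    rewrite ler_pdivrMr// -mulrA -expr2 mulrC -exprMn lerXn2r ?nnegrE ?(ltW nu0)//.
    by rewrite mulr_ge0 ?(ltW p0)// ltW.
  + exact: cvg_cst.
  + by rewrite -[X in _ --> X]addr0; apply: cvgD => //; exact: cvg_cst.
have [efin cv] := negbin_sum_cvg r0 u0 mW W0 Woo uW (measurable_cst c) (countable0 R) ul.
have g0 n : (r <= n)%N -> 0 < n%:R ^- 2 :> R.
  by move=> rn; rewrite invr_gt0 exprn_gt0// ltr0n (leq_trans r0).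
have -> : (c%:E = \int[mu]_(nu in pos) (gamma_pdf r nu * c)%:E)%E.
  under eq_integral do rewrite mulrC EFinM.
  rewrite ge0_integralZl//.
  - by rewrite integral_gamma_pdf// mule1.
  - by apply/measurable_EFinP; exact: (@measurable_gamma_pdf _ r _).
  - by move=> nu; rewrite /= in_itv/= andbT => nu0; rewrite lee_fin gamma_pdf_ge0// ltW.
apply: limf_esup_le efin _ cv; near=> p.
have p0 : 0 < p by near: p; exact: nbhs_right_gt.
have p1 : p < 1 by near: p; exact: nbhs_right_lt.
have pmf0 n : 0 <= negbin_pmf r p n by rewrite negbin_pmf_ge0 ?ltW.
rewrite risk_point_mass//; apply: lee_lim.
- by apply: is_cvg_ereal_nneg_natsum_cond => n _ _; rewrite lee_fin mulr_ge0// (admissible_ge0 aL).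
- by apply: is_cvg_ereal_nneg_natsum_cond => n _ _; rewrite lee_fin mulr_ge0// u0.
apply: nearW => m; rewrite big_nat_cond [leRHS]big_nat_cond.
apply: lee_sum => n /andP[/andP[rn _] _]; rewrite lee_fin ler_wpM2l ?negbin_pmf_ge0 ?(ltW p0) ?(ltW p1)//.
by apply: HB; rewrite divr_gt0// g0.
Unshelve. all: by end_near. Qed.

End upper_bound.

(** * The lower bound for every estimator, and its attainment *)

Section minimax.
Context {R : realType}.

Lemma le_limf_esup (f g : R -> \bar R) (F : set_system R) : Filter F ->
  (\forall x \near F, (f x <= g x)%E) -> (limf_esup f F <= limf_esup g F)%E.
Proof.
move=> FF fg; apply: le_ereal_inf_tmp => _ [V FV <-].
apply: (@le_trans _ _ (ereal_sup (f @` (V `&` [set x | (f x <= g x)%E])))).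
  by apply: ereal_inf_lbound; exists (V `&` [set x | (f x <= g x)%E]) => //; exact: filterI.
apply: ge_ereal_sup => _ [x [Vx /= fgx] <-]; apply: le_trans fgx _.
by apply: ereal_sup_ubound; exists x.
Qed.

Lemma limsup_risk_positive_extension r (L : R -> R) Pi :
  limsup_risk r (positive_extension L) Pi = limsup_risk r L Pi.
Proof.
apply/eqP; rewrite eq_le; apply/andP; split; apply: le_limf_esup; near=> p;
  by rewrite risk_positive_extension.
Unshelve. all: by end_near. Qed.

Lemma positive_extension_discontinuities (L : R -> R) :
  finite_set [set x | 0 < x /\ ~ {for x, continuous L}] ->
  finite_set [set x | 0 < x /\ ~ {for x, continuous (positive_extension L)}].
Proof.
apply: sub_finite_set => x [x0 nc]; split => // cL; apply: nc.
change (positive_extension L y @[y --> x] --> positive_extension L x).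
rewrite positive_extensionE//; apply: cvg_trans cL; apply: near_eq_cvg; near=> y.
by rewrite positive_extensionE//; near: y; exact: lt_nbhsr.
Unshelve. all: by end_near. Qed.

Variables (r : nat) (L : R -> R).
Hypothesis r0 : (0 < r)%N.
Hypothesis aL : admissible r L.
Variable xi : R.
Hypothesis xi0 : 0 < xi.
Hypothesis mono0 : forall x y, 0 < x -> x <= y -> y < xi -> L y <= L x.
Variables c2 Delta : R.
Hypothesis c2eta : (eta_star r L < c2%:E)%E.
Hypothesis c2L : forall x, Delta < x -> c2 <= L x.

Lemma eta_bar_attains_eta_star :
  (exists2 x, 0 < x < xi & (eta_star r L < (L x)%:E)%E) ->
  exists2 Omega, 0 < Omega & eta_bar r L Omega = eta_star r L.
Proof.
move=> [x /andP[x0 xxi] etaL].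
apply: (@eta_bar_attains _ _ _ r0 aL (Num.min (L x) c2) x Delta) => //.
- by rewrite /Num.min; case: ifP.
- by move=> y y0 yx; rewrite ge_min mono0// ltW.
- by move=> y /c2L; rewrite ge_min => ->; rewrite orbT.
Qed.

Lemma risk_ge0 Pi (p : R) : 0 <= p -> p <= 1 -> (0 <= risk r L Pi p)%E.
Proof.
move=> p0 p1; apply: nneseries_ge0 => n _ _; rewrite mule_ge0//.
  by rewrite lee_fin negbin_pmf_ge0.
by apply: integral_ge0 => y _; rewrite lee_fin (admissible_ge0 aL).
Qed.

(** If the limsup were smaller, the risk would be at most a constant [c < eta_star] on some
    [(0, b)]. Two levels are put in between, [c < c1 < c' < eta_star]: [c'] bounds [L] from below
    near 0 and near infinity, [c1] bounds every truncated integral from below, and the gap between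
    [c] and [c1] contradicts the averaged risk. *)
Lemma limsup_risk_ge Pi : estimator r Pi -> (eta_star r L <= limsup_risk r L Pi)%E.
Proof.
move=> estPi; rewrite leNgt; apply/negP => /ereal_inf_lt[_ [V [b /= b0 HV] <-] supV].
have riskV p : 0 < p -> p < b -> (risk r L Pi p <= ereal_sup (risk r L Pi @` V))%E.
  move=> p0 pb; apply: ereal_sup_ubound; exists p => //; apply: HV => //.
  by rewrite /ball /= sub0r normrN gtr0_norm.
(* Any point of [(0, b)] at most 1; it shows that the supremum [s] is non-negative, hence finite. *)
pose p := Num.min (b / 2) 1.
have p0 : 0 < p by rewrite lt_min divr_gt0//=.
have pb : p < b by rewrite gt_min; apply/orP; left; rewrite ltr_pdivrMr// mulr2n mulrDr mulr1 ltrDl.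
have p1 : p <= 1 by rewrite ge_min lexx orbT.
have s0 := le_trans (risk_ge0 Pi (ltW p0) p1) (riskV p p0 pb).
have efin := eta_star_fin_num r0 aL.
set s := ereal_sup _ in riskV s0 supV.
have sfin : s \is a fin_num.
  by rewrite ge0_fin_numE// (lt_le_trans supV)// leey.
pose c := fine s; pose e := fine (eta_star r L).
have ce : c < e by rewrite -lte_fin !fineK.
have c0 : 0 <= c by exact: fine_ge0.
pose c' := (c + e) / 2; pose c1 := (c + c') / 2.
have cc' : c < c' by rewrite /c'; lra.
have c'e : c' < e by rewrite /c'; lra.
have cc1 : c < c1 by rewrite /c1; lra.
have c1c' : c1 < c' by rewrite /c1; lra.
(* If [L <= c'] on all of [(0, xi)], then [eta_star <= c'], against the choice of [c']; otherwise
   monotonicity propagates a value above [c'] towards 0. *)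
have [d d0 Hd] : exists2 d, 0 < d & forall x, 0 < x -> x < d -> c' <= L x.
  have [[x /andP[x0 xxi] c'L]|H] := pselect (exists2 x, 0 < x < xi & c' < L x).
    by exists x => // y y0 yx; apply: le_trans (ltW c'L) _; rewrite mono0// ltW.
  have : (eta_star r L <= c'%:E)%E.
    apply: (eta_star_le_small_loss r0 aL xi0); first exact: le_trans (ltW cc').
    by move=> x x0 xxi; rewrite leNgt; apply/negP => h; apply: H; exists x; rewrite ?x0.
  by rewrite -[leLHS]fineK// lee_fin leNgt -/e c'e.
have c'eta : (c'%:E <= eta_star r L)%E by rewrite -[leRHS]fineK// lee_fin ltW.
have HD x : Delta < x -> c' <= L x.
  move=> /c2L; apply: le_trans; rewrite ltW// -lte_fin.
  exact: le_lt_trans c'eta c2eta.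
have [M M1 HM] := eta_core_uniform r0 aL (le_trans c0 (ltW cc1)) c1c' c'eta d0 Hd HD.
apply: (risk_unbounded_near0 r0 aL estPi c0 cc1 M1 b0 HM) => q q0 qb.
by rewrite fineK//; exact: riskV.
Qed.

Lemma limsup_risk_attains :
  finite_set [set x | 0 < x /\ ~ {for x, continuous L}] ->
  exists2 Pi, estimator r Pi & (limsup_risk r L Pi <= eta_star r L)%E.
Proof.
move=> fD; have efin := eta_star_fin_num r0 aL.
have [etaL|H] := pselect (exists2 x, 0 < x < xi & (eta_star r L < (L x)%:E)%E).
  have [Om O0 EO] := eta_bar_attains_eta_star etaL.
  exists (fun n => point_mass (Om / n%:R)).
    by apply: estimator_point_mass => n rn; rewrite divr_gt0// ltr0n (leq_trans r0).
  apply: limf_esup_le efin _ _; last by rewrite -EO; exact: cvg_risk_inverse.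
  exact: nearW.
exists (fun n => point_mass (n%:R ^- 2)).
  by apply: estimator_point_mass => n rn; rewrite invr_gt0 exprn_gt0// ltr0n (leq_trans r0).
rewrite -[leRHS]fineK//; apply: (limsup_risk_inverse_square r0 aL xi0).
  by rewrite fine_ge0// (eta_star_ge0 aL).
move=> x x0 xxi; rewrite -lee_fin fineK// leNgt; apply/negP => h.
by apply: H; exists x; rewrite ?x0.
Qed.

End minimax.

Unset Implicit Arguments.
Set Strict Implicit.
Set Printing Implicit Defensive.

(** The second conjunct carries a condition because monotonicity on the open interval says nothing
    of [L xi] itself: a large isolated value at [xi] can make the integral in (4) positive although
    [eta_bar] has no minimum. *)
Theorem theorem3 (R : realType) (r : nat) (r_gt0 : (0 < r)%N)
  (L : R -> R) (L_ge0 : forall x, 0 < x -> 0 <= L x)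
  (H1 : forall x1 x2, 0 < x1 -> x1 < x2 -> bounded_variation x1 x2 L)
  (H2 : finite_set [set x | 0 < x /\ ~ {for x, continuous L}])
  (H3_0 : exists2 K : R, K < r%:R & Theta_at_0 L (fun x => x `^ K))
  (H3_infty : exists2 K' : R, K' < r%:R & Theta_at_infty L (fun x => x `^ K'))
  (xi : R) (xi_gt0 : 0 < xi)
  (H4_mono : {in `]0, xi[ &, {homo L : x y /~ x <= y}})
  (H4_int : (0 < \int[lebesgue_measure]_(x in `]xi, +oo[)
                   ((L xi - L x) / x ^+ r.+1)%:E)%E)
  (xi' : R) (xi'_gt0 : 0 < xi')
  (H5_mono : {in `]xi', +oo[ &, {homo L : x y / x <= y}})
  (H5 : (exists l1 l2 : R, [/\ L x @[x --> xi'^'-] --> l1,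
                               L x @[x --> xi'^'+] --> l2 & l1 < l2])
     \/ (exists t : nat, [/\ (0 < t)%N,
           exists a b : R, [/\ 0 <= a, a < xi', xi' < b & class_C t L a b],
           forall i, (0 < i)%N -> (i < t)%N -> derive1n i L xi' = 0
         & 0 < (-1) ^+ t.-1 * derive1n t L xi'])) :
  is_minimum [set limsup_risk r L Pi | Pi in estimator r] (eta_star r L) /\
  ((exists2 x, 0 < x < xi & L xi <= L x) ->
   is_minimum (eta_bar_values r L) (eta_star r L)).
Proof.
pose L' := positive_extension L.
have aL : admissible r L'.
  apply: admissible_positive_extension => //.
  by have [K _ HK] := H3_0; exists K.
have LE x : 0 < x -> L' x = L x by exact: positive_extensionE.
have etaE : eta_star r L' = eta_star r L.
  by rewrite /eta_star eta_bar_values_positive_extension.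
have mono0 x y : 0 < x -> x <= y -> y < xi -> L' y <= L' x.
  move=> x0 xy yxi; have y0 := lt_le_trans x0 xy.
  by rewrite !LE//; apply: H4_mono; rewrite ?in_itv/= ?x0 ?y0//; exact: le_lt_trans yxi.
have [a [b [l [m [[a0 ab bxi' l0 lm] [Ll Lm mL]]]]]] := dip_before xi'_gt0 L_ge0 H5_mono H5.
have [c2 [Delta [c2eta c2L]]] : exists c Delta, (eta_star r L' < c%:E)%E /\
    forall x, Delta < x -> c <= L' x.
  apply: (eta_star_lt_large_loss r_gt0 aL xi'_gt0 _ a0 ab bxi' l0 lm).
  - move=> x y xI yI xy.
    have pos z : z \in `]xi', +oo[ -> 0 < z.
      by rewrite in_itv/= andbT; exact: (lt_trans xi'_gt0).
    by rewrite (LE x (pos x xI)) (LE y (pos y yI)); exact: H5_mono.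
  - by move=> x ax xb; rewrite LE ?(lt_trans a0)//; exact: Ll.
  - by move=> x bx xxi; rewrite LE ?(lt_le_trans _ bx) ?(lt_trans a0)//; exact: Lm.
  - by move=> x xx; rewrite LE ?(lt_trans xi'_gt0)//; exact: mL.
split.
  have lb Pi : estimator r Pi -> (eta_star r L <= limsup_risk r L Pi)%E.
    rewrite -etaE -limsup_risk_positive_extension.
    exact: (limsup_risk_ge r_gt0 aL xi_gt0 mono0 c2eta c2L).
  split; last by move=> _ [Pi estPi <-]; exact: lb.
  have [|Pi estPi Hle] := limsup_risk_attains r_gt0 aL xi_gt0 mono0 c2eta c2L.
    exact: positive_extension_discontinuities.
  exists Pi => //; apply/eqP; rewrite eq_le lb// andbT.
  by rewrite -etaE -limsup_risk_positive_extension.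
move=> [x /andP[x0 xxi] Lx].
split; last by move=> _ [Om O0 <-]; exact: eta_star_le.
suff [Om O0 EO] : exists2 Om, 0 < Om & eta_bar r L' Om = eta_star r L'.
  by exists Om => //; rewrite -etaE -EO eta_bar_positive_extension.
apply: (eta_bar_attains_eta_star r_gt0 aL mono0 c2eta c2L).
apply: contrapT => H.
have efin := eta_star_fin_num r_gt0 aL.
have le_eta y : 0 < y -> y < xi -> L' y <= fine (eta_star r L').
  move=> y0 yxi; rewrite -lee_fin fineK// leNgt; apply/negP => h.
  by apply: H; exists y; rewrite ?y0.
(* Under the contrary assumption [L'] is at most [eta_star] on [(0, xi)], and at [xi] by comparison
   with [x]; as [eta_bar] never falls below [eta_star], the integral in (4) would be
   non-positive. *)
have : (\int[lebesgue_measure]_(x in `]xi, +oo[) ((L' xi - L' x) / x ^+ r.+1)%:E <= 0)%E.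
  apply: (loss_deficit_le0 r_gt0 aL xi_gt0 (m := fine (eta_star r L'))).
  - by rewrite fine_ge0// (eta_star_ge0 aL).
  - by move=> Om O0; rewrite fineK//; exact: eta_star_le.
  - move=> y y0; rewrite le_eqVlt => /predU1P[->|]; last exact: le_eta.
    by apply: le_trans (le_eta x x0 xxi); rewrite !LE.
rewrite leNgt => /negP; apply; apply: (lt_le_trans H4_int).
rewrite le_eqVlt; apply/orP; left; apply/eqP; apply: eq_integral => y.
move=> /set_mem; rewrite /= in_itv/= andbT => xiy.
by rewrite !LE// (lt_trans xi_gt0).
Qed.
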